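(* Let $f(x,y)\in \mathbf{C}[[x,y]]$ be an irreducible power series of characteristic $(b_0,b_1,\ldots,b_h)$. Put $e_s=\gcd(b_0,\ldots,b_s)$ for $0\le s\le h$ and $n_i=\frac{e_{i-1}}{e_i}$ for $1\le i\le h$. Fix an integer $k$ with $1\leq k<\mathrm{ord}\, f(0,y)$, and let $i_k$ be the nonnegative integer such that $e_{i_k}\leq k < e_{i_k-1}$. Then $\frac{\partial^k}{\partial y^k}f(x,y)$ admits a factorization \[\frac{\partial^k}{\partial y^k}f(x,y)=\Gamma^{(1)}\cdots \Gamma^{(i_k)},\] where the $\Gamma^{(i)}\in\mathbf{C}[[x,y]]$ are power series, not necessarily irreducible, such that for each $1\le i\le i_k$: \begin{enumerate} \item All irreducible factors (branches) of $\Gamma^{(i)}$ have contact $b_i/b_0$ with $f$. The order of $\Gamma^{(i)}(0,y)$ equals $\left(\frac{b_0}{e_i}-\frac{b_0}{e_{i-1}}\right)k$ if $i< i_k$, and ${b_0}-\frac{b_0}{e_{i-1}}k$ if $i=i_k$. \item $\Gamma^{(i)}$ can be written as a product $\Gamma^{(i)}=\Gamma^{(i)}_1\Gamma^{(i)}_2$ of power series, where for any irreducible factor $g$ of $\Gamma^{(i)}_1$ the first $i-1$ characteristic exponents of $f$ and $g$ are the same and $\frac{b_i}{b_0}\not\in \mathrm{Char}\, g$; and $\left\{\frac{b_1}{b_0},\ldots,\frac{b_{i}}{b_0}\right\}$ is the set of characteristic exponents of any irreducible factor of $\Gamma_2^{(i)}$. \item The order of $\Gamma_1^{(i)}(0,y)$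 equals $\frac{b_0}{e_{i-1}}\left[-k \bmod n_i\right]$. \item The order of $\Gamma_2^{(i)}(0,y)$ equals $\frac{b_0}{e_{i}}\left(\min\{e_i,k\}-\lceil \frac{k}{n_i}\rceil\right)$. \item The power series $\Gamma_2^{(i)}$ has $\min\{e_i,k\}-\lceil \frac{k}{n_i}\rceil$ irreducible factors. \end{enumerate}
   Context: Puiseux series. $\mathbf{C}[[x]]^*$ denotes the set of formal Puiseux power series (elements of $\mathbf{C}[[x^{1/m}]]$ for some $m\ge 1$). The order of a nonzero Puiseux series is the minimal degree of its terms; the order of $0$ is $+\infty$. For Puiseux series $\phi,\psi$, $O(\phi,\psi)$ is the order of $\phi-\psi$. The index of a Puiseux series $\alpha$ is the smallest $n$ with $\alpha\in\mathbf{C}[[x^{1/n}]]$. Newton-Puiseux roots. For $g\in\mathbf{C}[[x,y]]$ with $\mathrm{ord}\,g(0,y)=m<\infty$ one has $g=u\prod_{j=1}^m(y-\gamma_j(x))$ with $u$ a unit and $\gamma_j$ Puiseux series of positive order; the $\gamma_j$ are the Newton-Puiseux roots of $g$, and $\mathrm{Zer}\,g$ is the set of them. Characteristic. For a Puiseux series $\alpha=\sum_i a_ix^{i/n}$ of positive order and index $n$ define $e_0=b_0=n$; if $e_k\ne1$, $b_{k+1}=\min\{i: i\not\equiv0 \bmod e_k,\ a_i\neq0\}$; and $e_k=\gcd(e_{k-1},b_k)$. The process stops at $h$ with $e_h=1$. If $f$ is irreducible with $\mathrm{ord}\,f(0,y)<\infty$, the sequence $(b_0,\ldots,b_h)$ is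 the same for all Newton-Puiseux roots of $f$ and is called the characteristic of $f$; here $b_0=\mathrm{ord}\,f(0,y)$. The set of characteristic exponents of $f$ is $\mathrm{Char}\,f=\{b_1/b_0,\ldots,b_h/b_0\}$ (listed in increasing order). Contact. For irreducible $f,g$ coprime with $x$, $\mathrm{cont}(f,g)=\max\{O(\alpha,\gamma):\alpha\in\mathrm{Zer}\,f,\ \gamma\in\mathrm{Zer}\,g\}$ is the contact of $f$ and $g$. Conventions. It is assumed that $1<\mathrm{ord}\,f(0,y)<\infty$. $[a \bmod n]$ is the remainder of the division of the integer $a$ by $n$ (in $\{0,\dots,n-1\}$); $\lceil x\rceil$ is the smallest integer $\ge x$. Irreducible factors are counted with multiplicity, up to units; the factors $\Gamma^{(i)}_1,\Gamma^{(i)}_2$ may be units. *)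

(* Defs.v *)
From HB Require Import structures.
From mathcomp Require Import all_boot all_order all_algebra.
From mathcomp Require Import complex.
From mathcomp Require Import boolp classical_sets functions reals constructive_ereal.

Set Implicit Arguments.
Unset Strict Implicit.
Unset Printing Implicit Defensive.

Import Order.TTheory GRing.Theory Num.Theory.

Local Open Scope classical_set_scope.
Local Open Scope ring_scope.

(* K[[x]].  The wrapper around nat -> K keeps the pointwise ring structure of
   functions from being inferred in place of the Cauchy product. *)
Record powser (K : Type) : Type := Powser { pcoef :> nat -> K }.

HB.instance Definition _ (K : Type) := [isNew for @pcoef K].
HB.instance Definition _ (K : eqType) := [Equality of powser K by <:].
HB.instance Definition _ (K : choiceType) := [Choice of powser K by <:].

Lemma powserP (K : Type) (p q : powser K) : (forall n, p n = q n) -> p = q.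
Proof. by case: p q => [p] [q] /= /funext ->. Qed.

Section PowserRing.
Variable K : comNzRingType.
Implicit Types p q r : powser K.

Definition ps_zero : powser K := Powser (fun=> 0).
Definition ps_opp p : powser K := Powser (fun n => - p n).
Definition ps_add p q : powser K := Powser (fun n => p n + q n).
Definition ps_const (c : K) : powser K := Powser (fun n => c *+ (n == 0)%N).
Definition ps_var : powser K := Powser (fun n => (n == 1)%:R).
Definition ps_mul p q : powser K :=
  Powser (fun n => \sum_(i < n.+1) p i * q (n - i)%N).

Fact ps_addA : associative ps_add.
Proof. by move=> p q r; apply: powserP => n; rewrite /= addrA. Qed.
Fact ps_addC : commutative ps_add.
Proof. by move=> p q; apply: powserP => n; rewrite /= addrC. Qed.
Fact ps_add0 : left_id ps_zero ps_add.
Proof. by move=> p; apply: powserP => n; rewrite /= add0r. Qed.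
Fact ps_addN : left_inverse ps_zero ps_opp ps_add.
Proof. by move=> p; apply: powserP => n; rewrite /= addNr. Qed.

HB.instance Definition _ :=
  GRing.isZmodule.Build (powser K) ps_addA ps_addC ps_add0 ps_addN.

Definition ps_trunc m p : {poly K} := \poly_(i < m) p i.

Fact ps_mul_trunc m p q n : (n < m)%N ->
  ps_mul p q n = (ps_trunc m p * ps_trunc m q)`_n.
Proof.
move=> ltnm; rewrite coefM /=; apply: eq_bigr => -[i lein] _ /=.
rewrite !coef_poly (leq_ltn_trans _ ltnm) ?(leq_ltn_trans _ ltnm) //.
exact: leq_subr.
Qed.

Fact ps_mulC : commutative ps_mul.
Proof.
by move=> p q; apply: powserP => n; rewrite !(@ps_mul_trunc n.+1) // mulrC.
Qed.

Fact ps_mulA : associative ps_mul.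
Proof.
move=> p q r; apply: powserP => n.
transitivity ((ps_trunc n.+1 p * (ps_trunc n.+1 q * ps_trunc n.+1 r))`_n).
  rewrite coefM /=; apply: eq_bigr => -[i lein] _.
  by rewrite [in RHS]coef_poly lein -ps_mul_trunc // ltnS leq_subr.
rewrite mulrA coefM /=; apply: eq_bigr => -[i lein] _.
by rewrite -ps_mul_trunc // coef_poly ltnS leq_subr.
Qed.

Fact ps_mul1 : left_id (ps_const 1) ps_mul.
Proof.
move=> p; apply: powserP => n /=.
rewrite big_ord_recl /= mulr1n mul1r subn0 big1 ?addr0 // => i _.
by rewrite mul0r.
Qed.

Fact ps_mulDl : left_distributive ps_mul ps_add.
Proof.
move=> p q r; apply: powserP => n /=; rewrite -big_split /=.
by apply: eq_bigr => i _; rewrite mulrDl.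
Qed.

Fact ps_oner_neq0 : ps_const 1 != 0.
Proof.
apply/eqP => /(congr1 (fun p : powser K => p 0%N)) /= /eqP.
by rewrite mulr1n oner_eq0.
Qed.

HB.instance Definition _ := GRing.Zmodule_isComNzRing.Build (powser K)
  ps_mulA ps_mulC ps_mul1 ps_mulDl ps_oner_neq0.

Definition ps_unit : {pred powser K} := fun p => `[< exists q, q * p = 1 >].
Definition ps_inv p : powser K := xget p [set q | q * p = 1].

Fact ps_mulV : {in ps_unit, left_inverse 1 ps_inv *%R}.
Proof. by move=> p /asboolP/(xgetPex p). Qed.
Fact ps_unitP p q : q * p = 1 -> ps_unit p.
Proof. by move=> qp1; apply/asboolP; exists q. Qed.
Fact ps_inv_out : {in [predC ps_unit], ps_inv =1 id}.
Proof.
move=> p /negP pNunit; apply: xgetPN => q qp1; apply: pNunit.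
exact: ps_unitP qp1.
Qed.

HB.instance Definition _ :=
  GRing.ComNzRing_hasMulInverse.Build (powser K) ps_mulV ps_unitP ps_inv_out.

End PowserRing.

Section Divisibility.
Variable A : comUnitRingType.

Definition divides (g f : A) : Prop := exists q, f = q * g.

Definition irreducible_elt (g : A) : Prop :=
  [/\ g != 0, g \isn't a GRing.unit &
      forall a b, g = a * b -> a \is a GRing.unit \/ b \is a GRing.unit].

Definition irreducible_factor (g f : A) : Prop :=
  irreducible_elt g /\ divides g f.

(* s lists the irreducible factors of f with multiplicity, up to units. *)
Definition factorization (f : A) (s : seq A) : Prop :=
  {in s, forall g, irreducible_elt g} /\
  exists2 u : A, u \is a GRing.unit & f = u * \prod_(g <- s) g.

End Divisibility.

(* The least element of a set of exponents, +oo if there is none. *)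
Definition least_exponent (S : set rat) : \bar rat :=
  xget +oo%E [set q%:E | q in [set q | S q /\ forall r, S r -> q <= r]].

Definition ps_order (K : nzRingType) (p : powser K) : \bar rat :=
  least_exponent [set n%:R | n in [set n | p n != 0]].

(* K[[x,y]] as K[[x]][[y]]: f j i is the coefficient of x^i y^j. *)
Notation powser2 K := (powser (powser K)).

Section TwoVariables.
Variable K : comNzRingType.
Implicit Types f : powser2 K.

(* f(0,y) *)
Definition at_x0 f : powser K := Powser (fun j => f j 0%N).

Definition ordY f : \bar rat := ps_order (at_x0 f).

(* the partial derivative with respect to y *)
Definition derivY f : powser2 K := Powser (fun j => f j.+1 *+ j.+1).

(* f(t^N, y) in K[[t,y]] *)
Definition ramify (N : nat) f : powser2 K :=
  Powser (fun j => Powser (fun i => if (N %| i)%N then f j (i %/ N)%N else 0)).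

End TwoVariables.

Arguments derivY {K} f.

(* A Puiseux series sum_q a_q x^q is given by its coefficients a : rat -> K;
   it belongs to K[[x^(1/n)]] iff all its exponents are in (1/n) nat. *)
Definition in_root (K : nzRingType) (n : nat) (a : rat -> K) : Prop :=
  (0 < n)%N /\ forall q, a q != 0 -> exists i : nat, q = i%:R / n%:R.

Definition puiseux_pred (K : nzRingType) : {pred rat -> K} :=
  fun a => `[< exists n, in_root n a >].

Fact puiseux_zmod_closed (K : nzRingType) : zmod_closed (@puiseux_pred K).
Proof.
split=> [|a b /asboolP[m [m0 am]] /asboolP[n [n0 bn]]]; apply/asboolP.
  by exists 1%N; split=> // q; rewrite eqxx.
have nz d : (0 < d)%N -> d%:R != 0 :> rat by rewrite pnatr_eq0 lt0n.
exists (m * n)%N; split=> [|q abq]; first by rewrite muln_gt0 m0.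
have [/eqP aq0|/am[i ->]] := boolP (a q == 0).
  have /bn[i ->] : b q != 0.
    by apply: contraNneq abq => bq0; rewrite !fctE aq0 bq0 subr0.
  by exists (m * i)%N; rewrite !natrM -mulf_div divff ?mul1r ?nz.
by exists (i * n)%N; rewrite !natrM -mulf_div divff ?mulr1 ?nz.
Qed.

HB.instance Definition _ (K : nzRingType) :=
  GRing.isZmodClosed.Build (rat -> K) (@puiseux_pred K)
    (@puiseux_zmod_closed K).

Record puiseux (K : nzRingType) : Type :=
  Puiseux { puiseux_coef :> rat -> K; _ : puiseux_coef \in @puiseux_pred K }.

HB.instance Definition _ (K : nzRingType) := [isSub for @puiseux_coef K].
HB.instance Definition _ (K : nzRingType) := [Choice of puiseux K by <:].
HB.instance Definition _ (K : nzRingType) :=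
  [SubChoice_isSubZmodule of puiseux K by <:].

Section Branches.
Variable K : comNzRingType.
Implicit Types (a : puiseux K) (f g : powser2 K) (b : seq nat).

Definition puiseux_order a : \bar rat := least_exponent [set q | a q != 0].

Definition coincidence a1 a2 : \bar rat := puiseux_order (a1 - a2).

Definition is_index a (n : nat) : Prop :=
  in_root n a /\ forall m, in_root m a -> (n <= m)%N.

(* The series in t = x^(1/N) equal to a, meaningful when in_root N a. *)
Definition in_t (N : nat) a : powser K := Powser (fun i => a (i%:R / N%:R)).

(* g = u prod_j (y - gamma_j), written in K[[t,y]] where t = x^(1/N) for a
   common N such that all the gamma_j are in K[[t]]; s lists the gamma_j. *)
Definition NP_factorization g (s : seq (puiseux K)) : Prop :=
  exists (N : nat) (u : powser2 K),
    [/\ (0 < N)%N, u \is a GRing.unit,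
        forall c : puiseux K, c \in s -> in_root N c /\ (0 < puiseux_order c)%E &
        ramify N g =
          ramify N u * \prod_(c <- s) (ps_var (powser K) - ps_const (in_t N c))].

Definition Zer g : set (puiseux K) :=
  [set c | exists2 s, NP_factorization g s & c \in s].

(* e_s = gcd(b_0, ..., b_s) *)
Definition egcd_upto b (s : nat) : nat := \big[gcdn/0%N]_(i < s.+1) nth 0%N b i.

(* b = (b_0, ..., b_h) is the sequence attached to a, of index n = b_0; the
   coefficient a_i in a = sum_i a_i x^(i/n) is a (i / n). *)
Definition puiseux_charac a b : Prop :=
  let n := nth 0%N b 0 in
  let jumps k := [set i : nat | ~~ (egcd_upto b k %| i)%N /\
                                a (i%:R / n%:R) != 0] in
  [/\ is_index a n,
      (0 < size b)%N,
      forall k, (k.+1 < size b)%N ->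
        [/\ egcd_upto b k != 1%N,
            jumps k (nth 0%N b k.+1) &
            forall i, jumps k i -> (nth 0%N b k.+1 <= i)%N] &
      egcd_upto b (size b).-1 = 1%N].

Definition charac f b : Prop :=
  Zer f !=set0 /\ forall a, Zer f a -> puiseux_charac a b.

(* The increasing list b_1/b_0, ..., b_h/b_0 of characteristic exponents. *)
Definition char_exponents b : seq rat :=
  [seq c%:R / (nth 0%N b 0)%:R | c <- behead b].

Definition is_contact f g (c : \bar rat) : Prop :=
  (exists a1 a2, [/\ Zer f a1, Zer g a2 & coincidence a1 a2 = c]) /\
  (forall a1 a2, Zer f a1 -> Zer g a2 -> (coincidence a1 a2 <= c)%E).

End Branches.

(* Main.v *)
Require Import Defs.
From HB Require Import structures.
From mathcomp Require Import all_boot all_order all_algebra.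
From mathcomp Require Import cyclic separable cyclotomic.
From mathcomp Require Import complex polyrcf polyorder cauchyreals.
From mathcomp Require Import boolp classical_sets functions reals constructive_ereal.
From mathcomp Require Import zify.

Set Implicit Arguments.
Unset Strict Implicit.
Unset Printing Implicit Defensive.

Import Order.TTheory GRing.Theory Num.Theory.
Local Open Scope classical_set_scope.
Local Open Scope ring_scope.

(** Let [alpha] be a Newton-Puiseux root of the irreducible series [f], a power
    series in [t = x^(1/N)]. Then [f] is a unit times the product of the [y - c]
    over the conjugates [c] of [alpha] under the Galois group of [t -> z t], where
    [z] is a primitive [N]-th root of unity. The roots of the [k]-th derivative of
    [f] are located by looking at it on the balls [y = lam + t^Q z].

    On such a ball [f] has an initial form [F(z)], the product of the factors
    [z - c_Q] over the roots [c] in the ball, where [c_Q] is the coefficient of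
    [t^Q]. By the chain rule the [k]-th derivative of [f] has, up to a constant,
    the initial form [F^(k)], provided that this polynomial is not zero. So the
    coefficients of [t^Q] of the roots of the derivative in the ball are the roots
    of [F^(k)], with multiplicities ([ballpoly_deriv]).

    At a level that lies strictly between characteristic exponents, [F] is a power
    of a linear form, with exponent greater than [k], and so the roots of the
    derivative follow those of [f] ([agree_step]). At the level of [b_i / b0],
    [F = (z^(n_i) - A)^(e_i)] with [A] nonzero ([ballpoly_alpha]). Its derivative of
    order [k < e_(i-1)] has the root [0] with multiplicity [- k mod n_i], the roots of
    [F] if [k < e_i], and otherwise only simple roots; the number of the latter is
    [n_i (min (e_i, k) - l)], where [l] is the ceiling of [k / n_i]. To see it, write
    the derivative as a power of [z] times a polynomial in [w = z^(n_i) / A], which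
    has real coefficients: Rolle on [0 <= w <= 1] yields as many distinct roots as
    the degree permits ([deriv_binomial_power_real]).

    Therefore every root of the derivative leaves the roots of [f] at some
    [b_i / b0] with [i <= i_k] ([contact_exists]), and the roots of each kind can be
    counted. The factor [G i] is the product of the minimal polynomials over
    [K[[x]]] of the roots that leave at [b_i / b0]; its two parts correspond to the
    roots whose coefficient at this exponent is zero and to the others. A root of
    the first kind has the first [i - 1] characteristic exponents of [f], and
    [b_i / b0] is not an exponent of it at all. A root of the second kind is
    determined by its terms up to [x^(b_i / b0)], by simplicity, so it is fixed by
    the Galois group over [K((x^(e_i / b0)))] ([contact_nonzero_fixed]): its
    characteristic exponents are the first [i] ones of [f], and it has [b0 / e_i]
    conjugates. The counts of roots thus become counts of branches.

    This rests on the Newton-Puiseux theorem. A root is constructed by induction on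
    the order [m] of [g(0, y)] ([puiseux_root_exists]): the root of the derivative of
    order [m - 1], given by the implicit function theorem, serves as the origin, so
    that the initial form on the first side of the Newton polygon has a root of
    multiplicity less than [m]. Branches are then the minimal polynomials of the
    roots, by Galois descent. *)

(** * Formal power series *)

Section PowserBasics.
Variable K : comNzRingType.
Implicit Types (p q : powser K) (c : K) (i M : nat).

Lemma psD p q i : (p + q) i = p i + q i. Proof. by []. Qed.
Lemma psN p i : (- p) i = - p i. Proof. by []. Qed.
Lemma psB p q i : (p - q) i = p i - q i. Proof. by []. Qed.
Lemma ps0 i : (0 : powser K) i = 0. Proof. by []. Qed.
Lemma psM p q i : (p * q) i = \sum_(a < i.+1) p a * q (i - a)%N.
Proof. by []. Qed.
Lemma ps1 i : (1 : powser K) i = (i == 0)%:R. Proof. by []. Qed.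

Lemma ps_sum I (r : seq I) (P : pred I) (F : I -> powser K) i :
  (\sum_(x <- r | P x) F x) i = \sum_(x <- r | P x) F x i.
Proof. by elim/big_rec2: _ => [|x y1 y2 _ <-] //. Qed.

Lemma psMn p n i : (p *+ n) i = p i *+ n.
Proof. by elim: n => [|n IH]; rewrite ?mulr0n // !mulrS psD IH. Qed.

Lemma psM0 p q : (p * q) 0%N = p 0%N * q 0%N.
Proof. by rewrite psM big_ord1. Qed.

Lemma psX0 p n : (p ^+ n) 0%N = p 0%N ^+ n.
Proof. by elim: n => [|n IH] //; rewrite !exprS psM0 IH. Qed.

Lemma ps_constE c i : ps_const c i = if i == 0%N then c else 0.
Proof. by rewrite /=; case: eqP. Qed.

Lemma ps_constM c p i : (ps_const c * p) i = c * p i.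
Proof.
rewrite psM big_ord_recl subn0 /= mulr1n big1 ?addr0 // => j _.
by rewrite mul0r.
Qed.

Lemma ps_const_zmod_morphism : zmod_morphism (@ps_const K).
Proof.
move=> a b; apply: powserP => i; rewrite psB !ps_constE.
by case: eqP; rewrite ?subr0.
Qed.
HB.instance Definition _ := GRing.isZmodMorphism.Build K (powser K)
  (@ps_const K) ps_const_zmod_morphism.

Lemma ps_const_monoid_morphism : monoid_morphism (@ps_const K).
Proof.
split=> // a b; apply: powserP => i; rewrite ps_constM !ps_constE.
by case: eqP; rewrite ?mulr0.
Qed.
HB.instance Definition _ := GRing.isMonoidMorphism.Build K (powser K)
  (@ps_const K) ps_const_monoid_morphism.

Lemma ps_varM p i : (ps_var K * p) i = if i is j.+1 then p j else 0.
Proof.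
case: i => [|i]; first by rewrite psM0 /= mul0r.
rewrite psM !big_ord_recl /= mul0r mul1r add0r subSS subn0 big1 ?addr0 //.
by move=> j _; rewrite /= mul0r.
Qed.

Lemma ps_varXM w p i :
  (ps_var K ^+ w * p) i = if (i < w)%N then 0 else p (i - w)%N.
Proof.
elim: w i => [|w IH] [|i]; rewrite ?expr0 ?mul1r ?subn0 //.
  by rewrite exprS -mulrA ps_varM.
by rewrite exprS -mulrA ps_varM IH ltnS subSS.
Qed.

Lemma ps_varX w i : (ps_var K ^+ w) i = (i == w)%:R.
Proof.
rewrite -[_ ^+ _]mulr1 ps_varXM ps1; case: (ltngtP i w) => [//|lt|->].
  by rewrite subn_eq0 leqNgt lt.
by rewrite subnn.
Qed.

Lemma ps_varXM_inj w : injective ( *%R (ps_var K ^+ w)).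
Proof.
move=> p q E; apply: powserP => i.
have := congr1 (fun r : powser K => r (i + w)%N) E.
by rewrite !ps_varXM ltnNge leq_addl /= addnK.
Qed.

(** Congruence modulo the [M]-th power of the variable. *)
Definition eqmod M p q := forall i, (i < M)%N -> p i = q i.

Lemma eqmod_sym M p q : eqmod M p q -> eqmod M q p.
Proof. by move=> e i lt; rewrite e. Qed.
Lemma eqmod_trans M q p r : eqmod M p q -> eqmod M q r -> eqmod M p r.
Proof. by move=> e1 e2 i lt; rewrite e1 ?e2. Qed.
Lemma eqmodW m M p q : (m <= M)%N -> eqmod M p q -> eqmod m p q.
Proof. by move=> le e i lt; apply/e/(leq_trans lt). Qed.
Lemma eqmodD M p q p' q' : eqmod M p p' -> eqmod M q q' ->
  eqmod M (p + q) (p' + q').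
Proof. by move=> e1 e2 i lt; rewrite !psD e1 ?e2. Qed.
Lemma eqmodB M p q p' q' : eqmod M p p' -> eqmod M q q' ->
  eqmod M (p - q) (p' - q').
Proof. by move=> e1 e2 i lt; rewrite !psB e1 ?e2. Qed.
Lemma eqmodM M p q p' q' : eqmod M p p' -> eqmod M q q' ->
  eqmod M (p * q) (p' * q').
Proof.
move=> e1 e2 i lt; rewrite !psM; apply: eq_bigr => -[a /=]; rewrite ltnS => le _.
by rewrite e1 ?e2 // (leq_ltn_trans _ lt) ?leq_subr.
Qed.
Lemma eqmod_sum M I (r : seq I) (P : pred I) (F G : I -> powser K) :
  (forall x, P x -> eqmod M (F x) (G x)) ->
  eqmod M (\sum_(x <- r | P x) F x) (\sum_(x <- r | P x) G x).
Proof.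
move=> e i lt; rewrite !ps_sum; apply: eq_bigr => x Px; exact: e.
Qed.
Lemma eqmodP p q : (forall M, eqmod M p q) -> p = q.
Proof. by move=> e; apply: powserP => i; apply: (e i.+1). Qed.

Lemma eqmod_var M p : eqmod M (ps_var K ^+ M * p) 0.
Proof. by move=> i lt; rewrite ps_varXM lt. Qed.

Lemma ps_factor_var M p : eqmod M p 0 ->
  p = ps_var K ^+ M * Powser (fun i => p (i + M)%N).
Proof.
move=> e; apply: powserP => i; rewrite ps_varXM; case: ltnP => [/e //|le] /=.
by rewrite subnK.
Qed.

Lemma eqmodX0 p n : p 0%N = 0 -> eqmod n (p ^+ n) 0.
Proof.
move=> p0; have {1}-> : p = ps_var K * Powser (fun i => p i.+1).
  by apply: powserP => i; rewrite ps_varM; case: i.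
by rewrite exprMn; apply: eqmod_var.
Qed.

Definition ps_of_poly (P : {poly K}) : powser K := Powser (fun i => P`_i).

Lemma ps_of_poly_zmod_morphism : zmod_morphism ps_of_poly.
Proof. by move=> P Q; apply: powserP => i; rewrite psB /= coefB. Qed.
HB.instance Definition _ := GRing.isZmodMorphism.Build {poly K} (powser K)
  ps_of_poly ps_of_poly_zmod_morphism.

Lemma ps_of_poly_monoid_morphism : monoid_morphism ps_of_poly.
Proof.
split; first by apply: powserP => i; rewrite ps1 /= coef1.
by move=> P Q; apply: powserP => i; rewrite psM /= coefM.
Qed.
HB.instance Definition _ := GRing.isMonoidMorphism.Build {poly K} (powser K)
  ps_of_poly ps_of_poly_monoid_morphism.

Lemma ps_of_polyC c : ps_of_poly c%:P = ps_const c.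
Proof. by apply: powserP => i; rewrite ps_constE /= coefC. Qed.
Lemma ps_of_polyX : ps_of_poly 'X = ps_var K.
Proof. by apply: powserP => i; rewrite /= coefX. Qed.

Lemma eqmod_trunc M p : eqmod M p (ps_of_poly (ps_trunc M p)).
Proof. by move=> i lt /=; rewrite coef_poly lt. Qed.

End PowserBasics.

Lemma ps_coef_neq0 (K : comNzRingType) (p : powser K) i : p i != 0 -> p != 0.
Proof. by apply: contraNneq => ->. Qed.

Lemma ps_neq0P (K : comNzRingType) (p : powser K) : p != 0 ->
  exists w, p w != 0 /\ eqmod w p 0.
Proof.
move=> pn0; have ex : exists i, p i != 0.
  apply: contrapT => /forallNP all0; case/eqP: pn0; apply: powserP => i; rewrite ps0.
  by apply/eqP/negPn/negP/all0.
case: (ex_minnP ex) => w pw wmin; exists w; split=> // i lt.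
by apply/eqP; apply: contraTT lt => /wmin; rewrite -leqNgt.
Qed.

Section PowserDomain.
Variable K : idomainType.

Fact powser_integral (p q : powser K) : p * q = 0 -> (p == 0) || (q == 0).
Proof.
move=> pq0; apply/negPn/negP; rewrite negb_or => /andP[].
move=> /ps_neq0P[v [pv /ps_factor_var Ep]] /ps_neq0P[w [qw /ps_factor_var Eq]].
have := congr1 (fun r : powser K => r (v + w)%N) pq0.
rewrite Ep Eq mulrACA -exprD ps_varXM ltnn subnn psM0 /= !add0n => /eqP.
by rewrite mulf_eq0 (negPf pv) (negPf qw).
Qed.
HB.instance Definition _ :=
  GRing.ComUnitRing_isIntegral.Build (powser K) powser_integral.

End PowserDomain.

Section MapPowser.
Variables (K A : comNzRingType) (phi : {rmorphism K -> A}).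

Definition ps_map (p : powser K) : powser A := Powser (fun i => phi (p i)).

Lemma ps_map_zmod_morphism : zmod_morphism ps_map.
Proof. by move=> p q; apply: powserP => i; rewrite psB /= rmorphB. Qed.
HB.instance Definition _ := GRing.isZmodMorphism.Build (powser K) (powser A)
  ps_map ps_map_zmod_morphism.

Lemma ps_map_monoid_morphism : monoid_morphism ps_map.
Proof.
split; first by apply: powserP => i; rewrite /= -/(phi _) rmorph_nat.
move=> p q; apply: powserP => i; rewrite [RHS]psM /= rmorph_sum.
by apply: eq_bigr => a _; rewrite rmorphM.
Qed.
HB.instance Definition _ := GRing.isMonoidMorphism.Build (powser K) (powser A)
  ps_map ps_map_monoid_morphism.

Lemma ps_map_const c : ps_map (ps_const c) = ps_const (phi c).
Proof.
by apply: powserP => i; rewrite /= -!/(ps_const _ _) raddfMn.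
Qed.
Lemma ps_map_var : ps_map (ps_var K) = ps_var A.
Proof. by apply: powserP => i; rewrite /= rmorph_nat. Qed.

End MapPowser.

(** * Substitution for the second variable *)

Section Subst.
Variables (K A : comNzRingType) (phi : {rmorphism K -> A}).
Implicit Types (eta : powser A) (g h : powser2 K) (M : nat).

Definition ps_tail eta := eta - ps_const (eta 0%N).

Lemma ps_tail0 eta : ps_tail eta 0%N = 0.
Proof. by rewrite psB ps_constE /= subrr. Qed.

Lemma ps_tailE eta : eta 0%N = 0 -> ps_tail eta = eta.
Proof. by rewrite /ps_tail => ->; rewrite raddf0 subr0. Qed.

(** The value at [y := eta] of [g(x, y)], a coefficientwise finite sum when
    [eta] has no constant term; that term is removed beforehand so that
    substitution is a ring morphism for every [eta]. *)
Definition ps_subst eta g : powser A := Powser (fun i =>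
  (\sum_(j < i.+1) ps_map phi (g j) * ps_tail eta ^+ j) i).

Lemma ps_substE eta g i :
  ps_subst eta g i = (\sum_(j < i.+1) ps_map phi (g j) * ps_tail eta ^+ j) i.
Proof. by []. Qed.

Lemma ps_subst_poly eta M (P : {poly powser A}) g :
  (forall j, (j < M)%N -> P`_j = ps_map phi (g j)) ->
  eqmod M P.[ps_tail eta] (ps_subst eta g).
Proof.
move=> EP i ltiM; set n := maxn (size P) i.+1.
rewrite (@horner_coef_wide _ n) ?leq_maxl //= -(big_mkord xpredT
  (fun j => P`_j * ps_tail eta ^+ j)) (@big_cat_nat _ _ _ i.+1) ?leq_maxr //=.
rewrite [X in _ + X]ps_sum [X in _ + X]big_nat_cond [X in _ + X]big1 => [|j].
  rewrite addr0 big_mkord; congr (pcoef _ i); apply: eq_bigr => -[j ltj] _ /=.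
  by rewrite EP // (leq_ltn_trans _ ltiM).
rewrite andbT => /andP[ltij _]; rewrite mulrC.
have /(eqmodW ltij) e := eqmodX0 (n := j) (ps_tail0 eta).
by rewrite (eqmodM e (fun i _ => erefl (P`_j i))) // mul0r.
Qed.

Lemma ps_subst_sum eta M g :
  eqmod M (\sum_(j < M) ps_map phi (g j) * ps_tail eta ^+ j) (ps_subst eta g).
Proof.
rewrite -(@horner_poly _ M (fun j => ps_map phi (g j))).
by apply: ps_subst_poly => j lt; rewrite coef_poly lt.
Qed.

Lemma ps_subst_zmod_morphism eta : zmod_morphism (ps_subst eta).
Proof.
move=> g h; apply: powserP => i; rewrite psB !ps_substE -psB -sumrB.
by congr (pcoef _ i); apply: eq_bigr => j _; rewrite psB raddfB mulrBl.
Qed.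
HB.instance Definition _ eta := GRing.isZmodMorphism.Build (powser2 K)
  (powser A) (ps_subst eta) (ps_subst_zmod_morphism eta).

Lemma ps_subst_const eta c : ps_subst eta (ps_const c) = ps_map phi c.
Proof.
apply: eqmodP => M; apply: eqmod_sym.
apply: (eqmod_trans _ (@ps_subst_poly eta M (ps_map phi c)%:P _ _)).
  by rewrite hornerC.
by move=> j _; rewrite coefC ps_constE; case: eqP; rewrite ?raddf0.
Qed.

Lemma ps_subst_var eta : ps_subst eta (ps_var _) = ps_tail eta.
Proof.
apply: eqmodP => M; apply: eqmod_sym.
apply: (eqmod_trans _ (@ps_subst_poly eta M 'X _ _)); first by rewrite hornerX.
by move=> j _; rewrite coefX /= rmorph_nat.
Qed.

Lemma ps_subst_monoid_morphism eta : monoid_morphism (ps_subst eta).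
Proof.
split.
  rewrite -[1]/(ps_const 1) ps_subst_const; exact: rmorph1.
move=> g h; apply: eqmodP => M.
pose P g := \poly_(j < M) ps_map phi (g j).
have EP g' : eqmod M (P g').[ps_tail eta] (ps_subst eta g').
  by apply: ps_subst_poly => j lt; rewrite coef_poly lt.
apply: (eqmod_trans _ (eqmodM (EP g) (EP h))); rewrite -hornerM.
apply/eqmod_sym/ps_subst_poly => j lt; rewrite coefM psM rmorph_sum.
apply: eq_bigr => -[a /=]; rewrite ltnS => lea _.
by rewrite !coef_poly rmorphM !(leq_ltn_trans _ lt) // leq_subr.
Qed.
HB.instance Definition _ eta := GRing.isMonoidMorphism.Build (powser2 K)
  (powser A) (ps_subst eta) (ps_subst_monoid_morphism eta).

Lemma ps_subst0 eta g : ps_subst eta g 0%N = phi (g 0%N 0%N).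
Proof. by rewrite /= big_ord1 expr0 mulr1. Qed.

End Subst.

Section HomExt.
Variables (K A : comNzRingType).
Implicit Types (g h : powser2 K) (M : nat).

Lemma ps_split (B : comNzRingType) M (h : powser B) :
  h = \sum_(j < M) ps_const (h j) * ps_var B ^+ j +
      ps_var B ^+ M * Powser (fun i => h (i + M)%N).
Proof.
have E : eqmod M (h - \sum_(j < M) ps_const (h j) * ps_var B ^+ j) 0.
  move=> i lt; rewrite psB ps_sum.
  under eq_bigr do rewrite ps_constM ps_varX.
  rewrite (bigD1 (Ordinal lt)) //= eqxx mulr1 big1 ?addr0 ?subrr // => j ne.
  by rewrite eq_sym (negPf (ne : j != i :> nat)) mulr0.
rewrite -[LHS](subrK (\sum_(j < M) ps_const (h j) * ps_var B ^+ j)).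
rewrite (ps_factor_var E) addrC; congr (_ + _ * _); apply: powserP => i.
rewrite [LHS]/pcoef psB ps_sum big1 ?subr0 // => -[j lt] _.
by rewrite ps_constM ps_varX gtn_eqF ?mulr0 //= ltn_addl.
Qed.

(** A ring morphism that maps [y] to a series without constant term is
    continuous, hence known from its values on [x]-series and on [y]. This is
    what proves that substitution commutes with ramification and with the
    Galois action. *)
Lemma ps_hom_ext (th1 th2 : {rmorphism powser2 K -> powser A}) :
    (forall c, th1 (ps_const c) = th2 (ps_const c)) ->
    th1 (ps_var _) = th2 (ps_var _) -> th1 (ps_var _) 0%N = 0 ->
  th1 =1 th2.
Proof.
move=> Ec Ev v0 h; apply: eqmodP => M; rewrite (ps_split M h) !rmorphD.
apply: eqmodD.
  rewrite !rmorph_sum; apply: eqmod_sum => j _.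
  by rewrite !rmorphM !rmorphXn /= Ec Ev.
rewrite !rmorphM !rmorphXn /= -Ev; set v := th1 (ps_var _) in v0 *.
have e0 w : eqmod M (v ^+ M * w) 0.
  have := eqmodM (eqmodX0 (n := M) v0) (fun i _ => erefl (w i)).
  by rewrite mul0r.
exact: eqmod_trans (e0 _) (eqmod_sym (e0 _)).
Qed.

End HomExt.

Section Ramify.
Variable K : comNzRingType.
Implicit Types (p q : powser K) (f g : powser2 K) (N : nat).

Definition ps_ram N p : powser K :=
  Powser (fun i => if (N %| i)%N then p (i %/ N)%N else 0).

Lemma ps_ramE N p i : ps_ram N p i = if (N %| i)%N then p (i %/ N)%N else 0.
Proof. by []. Qed.

Lemma ps_ram_zmod_morphism N : zmod_morphism (ps_ram N).
Proof.
by move=> p q; apply: powserP => i; rewrite psB /=; case: ifP; rewrite ?subr0.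
Qed.
HB.instance Definition _ N := GRing.isZmodMorphism.Build (powser K) (powser K)
  (ps_ram N) (ps_ram_zmod_morphism N).

Lemma ps_ram0 p : ps_ram 0 p = ps_const (p 0%N).
Proof.
apply: powserP => i; rewrite ps_constE /= dvd0n.
by case: eqP => // ->; rewrite div0n.
Qed.

Lemma ps_ram_monoid_morphism N : monoid_morphism (ps_ram N).
Proof.
case: N => [|N].
  split=> [|p q]; rewrite !ps_ram0; first exact: rmorph1.
  by rewrite psM0 rmorphM.
split.
  apply: powserP => i; rewrite !ps1 /=.
  case: ifPn => [/dvdnP[m ->]|nd]; first by rewrite mulnK // muln_eq0 orbF.
  by case: eqP nd => // ->; rewrite dvdn0.
pose R (P : {poly K}) := ps_of_poly (P \Po 'X^(N.+1)).
have E M p : eqmod M (ps_ram N.+1 p) (R (ps_trunc M p)).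
  move=> i lt; rewrite /= coef_comp_poly_Xn //; case: ifP => // _.
  by rewrite coef_poly (leq_ltn_trans _ lt) // leq_div.
have E' P : ps_ram N.+1 (ps_of_poly P) = R P.
  by apply: powserP => i; rewrite /= coef_comp_poly_Xn //; case: ifP.
move=> p q; apply: eqmodP => M.
apply: (eqmod_trans _ (eqmod_sym (eqmodM (E M p) (E M q)))).
have -> P Q : R P * R Q = R (P * Q) by rewrite /R comp_polyM rmorphM.
rewrite -E' => i lt.
rewrite !ps_ramE; case: ifP => // _.
rewrite (eqmodM (@eqmod_trunc _ M p) (@eqmod_trunc _ M q)).
  by rewrite rmorphM.
by rewrite (leq_ltn_trans _ lt) // leq_div.
Qed.
HB.instance Definition _ N := GRing.isMonoidMorphism.Build (powser K) (powser K)
  (ps_ram N) (ps_ram_monoid_morphism N).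

Lemma ramifyE N f : ramify N f = ps_map (ps_ram N) f.
Proof. by []. Qed.

Lemma ramify_zmod_morphism N : zmod_morphism (@ramify K N).
Proof. by move=> f g; rewrite !ramifyE raddfB. Qed.
HB.instance Definition _ N := GRing.isZmodMorphism.Build (powser2 K) (powser2 K)
  (@ramify K N) (ramify_zmod_morphism N).
Lemma ramify_monoid_morphism N : monoid_morphism (@ramify K N).
Proof. by split=> [|f g]; rewrite !ramifyE ?rmorph1 ?rmorphM. Qed.
HB.instance Definition _ N := GRing.isMonoidMorphism.Build (powser2 K)
  (powser2 K) (@ramify K N) (ramify_monoid_morphism N).

Lemma ramify_const N c : ramify N (ps_const c) = ps_const (ps_ram N c).
Proof. by rewrite ramifyE ps_map_const. Qed.
Lemma ramify_var N : ramify N (ps_var (powser K)) = ps_var _.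
Proof. by rewrite ramifyE ps_map_var. Qed.

Lemma ramify_lin N c : ramify N (ps_var _ - ps_const c) =
  ps_var (powser K) - ps_const (ps_ram N c).
Proof. by rewrite rmorphB /= ramify_var ramify_const. Qed.

Lemma ps_ram_coef N p i : (0 < N)%N -> ps_ram N p (i * N)%N = p i.
Proof. by move=> N0; rewrite /= dvdn_mull // mulnK. Qed.

Lemma ps_ram_inj N : (0 < N)%N -> injective (ps_ram N).
Proof.
move=> N0 p q E; apply: powserP => i.
by rewrite -(ps_ram_coef p i N0) E ps_ram_coef.
Qed.

Lemma ramify_inj N : (0 < N)%N -> injective (@ramify K N).
Proof.
move=> N0 f g E; apply: powserP => j; apply: (ps_ram_inj N0).
exact: (congr1 (fun f : powser2 K => f j) E).
Qed.

Lemma ps_ram_ram M N p : (0 < M)%N -> (0 < N)%N ->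
  ps_ram M (ps_ram N p) = ps_ram (N * M) p.
Proof.
move=> M0 N0; apply: powserP => i /=.
case: (boolP (M %| i)%N) => [/dvdnP[m ->]|nd].
  by rewrite mulnK // dvdn_pmul2r // divnMr.
by case: ifP => // /(dvdn_trans (dvdn_mull _ (dvdnn _))); rewrite (negPf nd).
Qed.

Lemma ramify_ramify M N f : (0 < M)%N -> (0 < N)%N ->
  ramify M (ramify N f) = ramify (N * M) f.
Proof. by move=> M0 N0; apply: powserP => j; apply: ps_ram_ram. Qed.

Lemma ps_ram_00 N p : ps_ram N p 0%N = p 0%N.
Proof. by rewrite /= dvdn0 div0n. Qed.

Lemma ps_ram_const N (a : K) : (0 < N)%N -> ps_ram N (ps_const a) = ps_const a.
Proof.
move=> N0; apply: powserP => -[|i]; first exact: ps_ram_00.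
rewrite ps_ramE !ps_constE; case: ifP => // /dvdnP[[//|m] ->].
by rewrite mulnK // muln_eq0 (gtn_eqF N0).
Qed.

Lemma ramify_at0 N f j : ramify N f j 0%N = f j 0%N.
Proof. exact: ps_ram_00. Qed.

Lemma derivY_ramify N f : derivY (ramify N f) = ramify N (derivY f).
Proof. by apply: powserP => j; symmetry; apply: (raddfMn (ps_ram N)). Qed.

Lemma derivYn_ramify N k f :
  iter k derivY (ramify N f) = ramify N (iter k derivY f).
Proof. by elim: k => //= k ->; rewrite derivY_ramify. Qed.

(** The automorphism [t -> z t], for a root of unity [z]. *)
Definition ps_rot (z : K) p : powser K := Powser (fun i => z ^+ i * p i).

Lemma ps_rot_zmod_morphism z : zmod_morphism (ps_rot z).
Proof. by move=> p q; apply: powserP => i; rewrite psB /= mulrBr. Qed.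
HB.instance Definition _ z := GRing.isZmodMorphism.Build (powser K) (powser K)
  (ps_rot z) (ps_rot_zmod_morphism z).
Lemma ps_rot_monoid_morphism z : monoid_morphism (ps_rot z).
Proof.
split=> [|p q]; apply: powserP => i.
  by case: i => [|i]; rewrite /= ?mulr1 ?mulr0n ?mulr0.
rewrite [RHS]psM [LHS]/= mulr_sumr; apply: eq_bigr => -[a /=].
rewrite ltnS => le _; rewrite mulrACA -exprD subnKC //.
Qed.
HB.instance Definition _ z := GRing.isMonoidMorphism.Build (powser K)
  (powser K) (ps_rot z) (ps_rot_monoid_morphism z).

Lemma ps_rot_rot z w p : ps_rot z (ps_rot w p) = ps_rot (z * w) p.
Proof. by apply: powserP => i; rewrite /= mulrA exprMn. Qed.
Lemma ps_rot1 p : ps_rot 1 p = p.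
Proof. by apply: powserP => i; rewrite /= expr1n mul1r. Qed.
Lemma ps_rot_00 z p : ps_rot z p 0%N = p 0%N.
Proof. by rewrite /= mul1r. Qed.

End Ramify.

(** * Roots of power series in two variables *)

Section Eval.
Variable K : comNzRingType.
Implicit Types (c d p : powser K) (f g h : powser2 K) (N M : nat).

Definition ps_eval c g : powser K := ps_subst idfun c g.
HB.instance Definition _ c :=
  GRing.RMorphism.copy (ps_eval c) (ps_subst idfun c).

Lemma ps_map_id p : ps_map idfun p = p.
Proof. exact: powserP. Qed.

Lemma ps_eval_const c p : ps_eval c (ps_const p) = p.
Proof. by rewrite /ps_eval ps_subst_const ps_map_id. Qed.

Lemma ps_eval_var c : c 0%N = 0 -> ps_eval c (ps_var _) = c.
Proof. by rewrite /ps_eval ps_subst_var; apply: ps_tailE. Qed.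

Lemma ps_eval_lin c d : c 0%N = 0 ->
  ps_eval c (ps_var _ - ps_const d) = c - d.
Proof. by move=> c0; rewrite raddfB /= ps_eval_const ps_eval_var. Qed.

Lemma ps_eval_00 c g : ps_eval c g 0%N = g 0%N 0%N.
Proof. exact: ps_subst0. Qed.

(** The quotient of the division of [g] by [y - c]. *)
Definition ps_quo c g : powser2 K :=
  Powser (fun j => ps_eval c (Powser (fun l => g (l + j.+1)%N))).

Lemma ps_eval_step c g : c 0%N = 0 ->
  ps_eval c g = g 0%N + c * ps_eval c (Powser (fun l => g (l + 1)%N)).
Proof.
move=> c0; rewrite {1}(ps_split 1 g) big_ord1 expr0 mulr1 expr1 rmorphD rmorphM.
by rewrite /= ps_eval_const ps_eval_var.
Qed.

Lemma ps_quoP c g : c 0%N = 0 ->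
  g = (ps_var _ - ps_const c) * ps_quo c g + ps_const (ps_eval c g).
Proof.
move=> c0; apply: powserP => j; rewrite psD mulrBl psB ps_varM ps_constM.
rewrite ps_constE /=; case: j => [|j].
  rewrite (ps_eval_step g c0) sub0r addrC addrK //.
rewrite addr0 (ps_eval_step (Powser (fun l => g (l + j.+1)%N)) c0) /=.
rewrite -[in LHS](add0n j.+1) [X in _ = _ + c * X - _](_ : _ =
  ps_eval c (Powser (fun l => g (l + j.+2)%N))) ?addrK //.
by congr (ps_eval c _); apply: powserP => l /=; rewrite addn1 addSnnS.
Qed.

Lemma ps_factor c g : c 0%N = 0 -> ps_eval c g = 0 ->
  g = (ps_var _ - ps_const c) * ps_quo c g.
Proof. by move=> c0 e; rewrite {1}(ps_quoP g c0) e raddf0 addr0. Qed.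

Lemma ps_quo_00 c g : ps_quo c g 0%N 0%N = g 1%N 0%N.
Proof. by rewrite [ps_quo c g 0%N]/= ps_eval_00. Qed.

Lemma eval_ramify N c g : (0 < N)%N -> c 0%N = 0 ->
  ps_eval (ps_ram N c) (ramify N g) = ps_ram N (ps_eval c g).
Proof.
move=> N0 c0; have r0 : ps_ram N c 0%N = 0 by rewrite ps_ram_00.
apply: (@ps_hom_ext _ _ (ps_eval (ps_ram N c) \o @ramify K N)
                        (@ps_ram K N \o ps_eval c)) => [d||] /=.
- by rewrite ramify_const !ps_eval_const.
- by rewrite ramify_var !ps_eval_var.
- by rewrite -[LHS]/(ps_eval (ps_ram N c) (ramify N (ps_var _)) 0%N)
    ramify_var ps_eval_var.
Qed.

Lemma eval_rot z c g : c 0%N = 0 ->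
  ps_eval (ps_rot z c) (ps_map (ps_rot z) g) = ps_rot z (ps_eval c g).
Proof.
move=> c0; have r0 : ps_rot z c 0%N = 0 by rewrite ps_rot_00.
apply: (@ps_hom_ext _ _ (ps_eval (ps_rot z c) \o ps_map (ps_rot z))
                        (ps_rot z \o ps_eval c)) => [d||] /=.
- by rewrite ps_map_const !ps_eval_const.
- by rewrite ps_map_var !ps_eval_var.
- by rewrite -[LHS]/(ps_eval (ps_rot z c) (ps_map _ (ps_var _)) 0%N)
    ps_map_var ps_eval_var.
Qed.

End Eval.

Section Units.
Variable K : comUnitRingType.

Lemma ps_unitE (p : powser K) : (p \is a GRing.unit) = (p 0%N \is a GRing.unit).
Proof.
apply/unitrP/unitrP => [[q [qp pq]]|[u [up pu]]].
  by exists (q 0%N); rewrite -!psM0 qp pq.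
(* the geometric series, evaluated at 1 - u p *)
pose eta := 1 - ps_const u * p; pose ones : powser2 K := Powser (fun=> 1).
have eta0 : eta 0%N = 0 by rewrite psB ps_constM up subrr.
have geom : (1 - ps_var (powser K)) * ones = 1.
  apply: powserP => i; rewrite mulrBl mul1r psB ps_varM ps1.
  by case: i => [|i]; rewrite /= ?subr0 ?subrr.
have := congr1 (ps_eval eta) geom.
rewrite rmorphM rmorphB !rmorph1 /= ps_eval_var // /eta subKr => E.
have {}E : (ps_const u * ps_eval eta ones) * p = 1 by rewrite mulrAC E.
by exists (ps_const u * ps_eval eta ones); rewrite [p * _]mulrC.
Qed.

End Units.

(** * Existence of a Puiseux root *)

Section Leading.
Variable A : comNzRingType.
Implicit Types (p q : powser A) (a b : A) (w v : nat).

(** [p = a t^w + ...]. As [a] may vanish, these expressions multiply over every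
    ring. *)
Definition leads p w a := eqmod w p 0 /\ p w = a.

Lemma leadsP p w a :
  leads p w a <-> exists2 r, p = ps_var A ^+ w * r & r 0%N = a.
Proof.
split=> [[/ps_factor_var e <-]|[r -> <-]].
  by exists (Powser (fun i => p (i + w)%N)); rewrite //= add0n.
by split; [apply: eqmod_var | rewrite ps_varXM ltnn subnn].
Qed.

Lemma leadsM p q w v a b :
  leads p w a -> leads q v b -> leads (p * q) (w + v) (a * b).
Proof.
move=> /leadsP[r -> ra] /leadsP[s -> sb]; apply/leadsP.
by exists (r * s); rewrite ?psM0 ?ra ?sb // mulrACA exprD.
Qed.

Lemma leads_var w p a v : leads p v a -> leads (ps_var A ^+ w * p) (w + v) a.
Proof.
move=> lp; rewrite -[a]mul1r; apply: leadsM => //.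
by split=> [i lt|]; rewrite ps_varX; [rewrite ltn_eqF | rewrite eqxx].
Qed.

Lemma leads_uniq p w v a b : a != 0 -> b != 0 ->
  leads p w a -> leads p v b -> w = v /\ a = b.
Proof.
move=> a0 b0 [ew pw] [ev pv].
case: (ltngtP w v) => [/ev e|/ew e|wv]; last by rewrite -pw -pv wv.
  by rewrite -pw e eqxx in a0.
by rewrite -pv e eqxx in b0.
Qed.

End Leading.

Section OrdY.
Variable K : comNzRingType.
Implicit Types (f g : powser2 K).

Lemma at_x0_monoid_morphism : monoid_morphism (@at_x0 K).
Proof.
split=> [|f g]; apply: powserP => j; first by case: j.
rewrite -[LHS]/((f * g) j 0%N) psM ps_sum psM.
by apply: eq_bigr => i _; rewrite psM0.
Qed.
Lemma at_x0_zmod_morphism : zmod_morphism (@at_x0 K).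
Proof. by move=> f g; apply: powserP => j. Qed.
HB.instance Definition _ := GRing.isZmodMorphism.Build (powser2 K) (powser K)
  (@at_x0 K) at_x0_zmod_morphism.
HB.instance Definition _ := GRing.isMonoidMorphism.Build (powser2 K) (powser K)
  (@at_x0 K) at_x0_monoid_morphism.

(** The order of [f(0, y)] for series regular in [y], stated on coefficients so
    that it can be handled without extended rationals. *)
Definition ordY_is f m := eqmod m (at_x0 f) 0 /\ at_x0 f m != 0.

Lemma ordY_is_ramify N f m : ordY_is (ramify N f) m <-> ordY_is f m.
Proof.
have E : at_x0 (ramify N f) = at_x0 f.
  by apply: powserP => j; apply: ramify_at0.
by rewrite /ordY_is E.
Qed.

Lemma ordY_is_uniq f m n : ordY_is f m -> ordY_is f n -> m = n.
Proof.
move=> [em fm] [en fn].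
by have [] := leads_uniq fm fn (conj em erefl) (conj en erefl).
Qed.

Lemma ordY_is_lin (c : powser K) : c 0%N = 0 ->
  ordY_is (ps_var _ - ps_const c) 1.
Proof.
move=> c0; have E : at_x0 (ps_var _ - ps_const c) = ps_var K.
  apply: powserP => j; rewrite -[LHS]/((ps_var _ - ps_const c) j 0%N) !psB.
  by rewrite ps_constE /=; case: j => [|[|j]]; rewrite /= ?c0 ?subr0.
rewrite /ordY_is E; split; last by rewrite /= oner_eq0.
by case.
Qed.

End OrdY.

Section OrdYDomain.
Variable K : idomainType.
Implicit Types (f g : powser2 K).

Lemma ordY_isM f g m n : ordY_is f m -> ordY_is g n -> ordY_is (f * g) (m + n).
Proof.
move=> [fm fm0] [gn gn0]; rewrite /ordY_is.
have -> : at_x0 (f * g) = at_x0 f * at_x0 g by apply: rmorphM.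
have [e ->] := leadsM (conj fm erefl) (conj gn erefl).
by split; rewrite // mulf_neq0.
Qed.

(** The product of the restrictions to [x = 0] is nonzero, so both of them are
    nonzero and have an order. *)
Lemma ordY_is_factor f g m : ordY_is (f * g) m ->
  exists m1 m2, [/\ ordY_is f m1, ordY_is g m2 & (m1 + m2 = m)%N].
Proof.
move=> fgm; have [_] := fgm; rewrite rmorphM => /ps_coef_neq0.
rewrite mulf_eq0 negb_or => /andP[/ps_neq0P[m1 [f1 e1]] /ps_neq0P[m2 [g2 e2]]].
have o1 : ordY_is f m1 by [].
have o2 : ordY_is g m2 by [].
by exists m1, m2; split=> //; apply: ordY_is_uniq fgm; apply: ordY_isM.
Qed.

End OrdYDomain.

Lemma ordY_is_unit (K : fieldType) (f : powser2 K) :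
  ordY_is f 0 <-> f \is a GRing.unit.
Proof. by rewrite !ps_unitE unitfE; split=> [[]|]. Qed.

Lemma ramify_unit (K : fieldType) N (f : powser2 K) :
  (ramify N f \is a GRing.unit) = (f \is a GRing.unit).
Proof. by rewrite !ps_unitE ramify_at0. Qed.

Section ImplicitFunction.
Variable K : fieldType.
Implicit Types (c d : powser K) (g : powser2 K).

Lemma ps_eval_diff c d g : c 0%N = 0 -> d 0%N = 0 ->
  ps_eval c g - ps_eval d g = (c - d) * ps_eval c (ps_quo d g).
Proof.
move=> c0 d0; rewrite {1}(ps_quoP g d0) rmorphD rmorphM /= ps_eval_lin //.
by rewrite ps_eval_const addrK.
Qed.

Lemma eqmod_eval n c d g : c 0%N = 0 -> d 0%N = 0 -> eqmod n c d ->
  eqmod n (ps_eval c g) (ps_eval d g).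
Proof.
move=> c0 d0 e.
have e' : eqmod n ((c - d) * ps_eval c (ps_quo d g)) (0 * 0 + 0).
  have := eqmodM (eqmodB e (fun i _ => erefl (d i)))
                 (fun i _ => erefl (ps_eval c (ps_quo d g) i)).
  by rewrite subrr !mul0r addr0.
move=> i lt; have := e' i lt.
by rewrite -ps_eval_diff // mul0r addr0 psB => /eqP; rewrite subr_eq0 => /eqP.
Qed.

(** With an invertible [y]-derivative at the origin, the root of [g] is obtained
    one coefficient at a time: the step [n] cancels the coefficient of [x^n] in
    [g(x, c(x))] and does not alter the previous ones. *)
Fixpoint newton_approx g n : powser K :=
  if n is n'.+1 then
    newton_approx g n' - ps_var K ^+ n *
      ps_const (ps_eval (newton_approx g n') g n / g 1%N 0%N)
  else 0.

(** The implicit function theorem: the approximations stabilize coefficientwise,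
    and their limit is a root. *)
Lemma implicit_function g : g 0%N 0%N = 0 -> g 1%N 0%N != 0 ->
  exists2 c : powser K, c 0%N = 0 & ps_eval c g = 0.
Proof.
move=> g0 g1; pose a := newton_approx g.
have aE n : a n.+1 = a n - ps_var K ^+ n.+1 *
      ps_const (ps_eval (a n) g n.+1 / g 1%N 0%N) by [].
have a0 n : a n 0%N = 0.
  by elim: n => // n IH; rewrite aE psB IH ps_varXM subr0.
have aS n : eqmod n.+1 (a n.+1) (a n).
  by move=> i lt; rewrite aE psB ps_varXM lt subr0.
have ale m n : (n <= m)%N -> eqmod n.+1 (a m) (a n).
  move=> /subnK <-; elim: (m - n)%N => [|k IH]; first by [].
  apply: (eqmod_trans _ IH); apply: eqmodW (aS _).
  by rewrite ltnS leq_addl.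
have ag n : eqmod n.+1 (ps_eval (a n) g) 0.
  elim: n => [|n IH]; first by case=> // _; rewrite ps_eval_00.
  move=> i; rewrite ltnS leq_eqVlt => /orP[/eqP->|lt]; last first.
    by rewrite (eqmod_eval g (a0 _) (a0 _) (aS n)) ?IH.
  have := congr1 (fun p : powser K => p n.+1)
                 (ps_eval_diff g (a0 n.+1) (a0 n)).
  have -> : a n.+1 - a n = - (ps_var K ^+ n.+1 *
      ps_const (ps_eval (a n) g n.+1 / g 1%N 0%N)) by rewrite aE addrC addKr.
  rewrite psB mulNr -mulrA psN ps_varXM ltnn subnn.
  rewrite psM0 ps_eval_00 ps_quo_00 /= mulr1n divfK // => /eqP.
  by rewrite subr_eq addNr => /eqP.
pose c := Powser (fun i => a i i); have ca n : eqmod n.+1 c (a n).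
  by move=> i; rewrite ltnS => le; rewrite /= (ale n i).
exists c; first exact: (a0 0%N).
apply: eqmodP => M; apply: (@eqmodW _ _ M.+1) => //.
by apply: (eqmod_trans _ (ag M)); apply: eqmod_eval => //; apply: (a0 0%N).
Qed.

End ImplicitFunction.

Section Blowup.
Variable K : comNzRingType.
Implicit Types (lam c : powser K) (g h : powser2 K) (p q : powser {poly K}).

(** The substitution [y := lam + t^Q z], with values in [K[z][[t]]]. *)
Definition blowup_var lam Q : powser {poly K} :=
  ps_map polyC lam + ps_var _ ^+ Q * ps_const 'X.
Definition blowup lam Q g : powser {poly K} :=
  ps_subst polyC (blowup_var lam Q) g.
HB.instance Definition _ lam Q :=
  GRing.RMorphism.copy (blowup lam Q) (ps_subst polyC (blowup_var lam Q)).

Lemma blowup_var0 lam Q : lam 0%N = 0 -> (0 < Q)%N -> blowup_var lam Q 0%N = 0.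
Proof. by move=> l0 Q0; rewrite psD ps_varXM Q0 /= l0 addr0. Qed.

Lemma blowup_const lam Q c : blowup lam Q (ps_const c) = ps_map polyC c.
Proof. exact: ps_subst_const. Qed.

Lemma blowup_varE lam Q : lam 0%N = 0 -> (0 < Q)%N ->
  blowup lam Q (ps_var _) = blowup_var lam Q.
Proof. by move=> l0 Q0; rewrite /blowup ps_subst_var ps_tailE ?blowup_var0. Qed.

Lemma blowup_lin lam Q c : lam 0%N = 0 -> (0 < Q)%N ->
  blowup lam Q (ps_var _ - ps_const c) =
  ps_map polyC (lam - c) + ps_var _ ^+ Q * ps_const 'X.
Proof.
move=> l0 Q0; rewrite rmorphB /= blowup_const blowup_varE // /blowup_var.
by rewrite rmorphB /= addrAC.
Qed.

Lemma blowup_0 lam Q g : blowup lam Q g 0%N = (g 0%N 0%N)%:P.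
Proof. exact: ps_subst0. Qed.

(** The derivative with respect to [z], coefficientwise in [t] *)
Definition ps_dz p : powser {poly K} := Powser (fun i => (p i)^`()).

Lemma ps_dzM p q : ps_dz (p * q) = ps_dz p * q + p * ps_dz q.
Proof.
apply: powserP => i; rewrite psD !psM /= raddf_sum -big_split /=.
by apply: eq_bigr => a _; rewrite derivM.
Qed.
Lemma ps_dzD p q : ps_dz (p + q) = ps_dz p + ps_dz q.
Proof. by apply: powserP => i; rewrite /= derivD. Qed.
Lemma ps_dz0 : ps_dz 0 = 0.
Proof. by apply: powserP => i; rewrite /= deriv0. Qed.
Lemma ps_dz_sum I (s : seq I) (F : I -> powser {poly K}) :
  ps_dz (\sum_(i <- s) F i) = \sum_(i <- s) ps_dz (F i).
Proof. by rewrite (big_morph _ ps_dzD ps_dz0). Qed.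
Lemma ps_dz_map c : ps_dz (ps_map polyC c) = 0.
Proof. by apply: powserP => i; rewrite /= derivC. Qed.
Lemma ps_dz_varM w p : ps_dz (ps_var _ ^+ w * p) = ps_var _ ^+ w * ps_dz p.
Proof.
apply: powserP => i; rewrite ps_varXM -[LHS]/((ps_var _ ^+ w * p) i)^`().
by rewrite ps_varXM; case: ifP; rewrite ?deriv0.
Qed.
Lemma ps_dzX p n : ps_dz (p ^+ n) = p ^+ n.-1 * ps_dz p *+ n.
Proof.
elim: n => [|n IH].
  by apply: powserP => i; rewrite expr0 mulr0n /= -polyC1 derivMn derivC mul0rn.
rewrite exprS ps_dzM IH mulrnAr mulrA -exprS [n.+1.-1]/= mulrS mulrC.
by case: n {IH} => // n.
Qed.

Lemma ps_dz_blowup_var lam Q : ps_dz (blowup_var lam Q) = ps_var _ ^+ Q.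
Proof.
rewrite ps_dzD ps_dz_map add0r ps_dz_varM -[RHS]mulr1; congr (_ * _).
by apply: powserP => i; rewrite /= derivMn derivX.
Qed.

(** The chain rule for [y = lam + t^Q z] *)
Lemma blowup_derivY lam Q g : lam 0%N = 0 -> (0 < Q)%N ->
  ps_dz (blowup lam Q g) = ps_var _ ^+ Q * blowup lam Q (derivY g).
Proof.
move=> l0 Q0; have v0 := blowup_var0 l0 Q0; apply: eqmodP => M.
have e1 := @ps_subst_sum _ _ polyC (blowup_var lam Q) M.+1 g.
have e2 := @ps_subst_sum _ _ polyC (blowup_var lam Q) M (derivY g).
rewrite !(ps_tailE v0) in e1 e2.
apply: (@eqmod_trans _ _ (ps_dz (\sum_(j < M.+1)
   ps_map polyC (g j) * blowup_var lam Q ^+ j))).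
  by move=> i lt /=; rewrite e1 // leqW.
apply: eqmod_trans (eqmodM (fun i _ => erefl) e2).
suff -> : ps_dz (\sum_(j < M.+1) ps_map polyC (g j) * blowup_var lam Q ^+ j) =
  ps_var _ ^+ Q * \sum_(j < M) ps_map polyC (derivY g j) * blowup_var lam Q ^+ j.
  by [].
rewrite ps_dz_sum big_ord_recl expr0 mulr1 ps_dz_map add0r mulr_sumr.
apply: eq_bigr => j _; rewrite ps_dzM ps_dz_map mul0r add0r ps_dzX.
rewrite ps_dz_blowup_var [_.-1]/= -[ps_map polyC (derivY g j)]
  /(ps_map polyC (g j.+1 *+ j.+1)) raddfMn.
rewrite mulrnAr mulrnAl mulrnAr; congr (_ *+ _).
by rewrite mulrA mulrC.
Qed.

Lemma blowup_derivYn k lam Q g : lam 0%N = 0 -> (0 < Q)%N ->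
  iter k ps_dz (blowup lam Q g) =
  ps_var _ ^+ (Q * k) * blowup lam Q (iter k derivY g).
Proof.
move=> l0 Q0; elim: k => [|k IH]; first by rewrite muln0 mul1r.
by rewrite /= IH ps_dz_varM blowup_derivY // mulrA -exprD mulnSr.
Qed.

Lemma ps_dzn_varM k w p :
  iter k ps_dz (ps_var _ ^+ w * p) = ps_var _ ^+ w * iter k ps_dz p.
Proof. by elim: k => //= k ->; rewrite ps_dz_varM. Qed.

Lemma ps_dzn_coef k p i : iter k ps_dz p i = (p i)^`(k).
Proof. by elim: k => // k IH; rewrite derivnS -IH. Qed.

End Blowup.

Lemma derivYn_coef (K : comNzRingType) k (g : powser2 K) j :
  iter k derivY g j = g (j + k)%N *+ ((j + k) ^_ k).
Proof.
elim: k j => [|k IH] j; first by rewrite addn0 ffactn0.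
rewrite -[LHS]/(iter k derivY g j.+1 *+ j.+1) IH -mulrnA addSnnS.
by rewrite ffactnSr -addSnnS addnK addSnnS.
Qed.

Section Swap.
Variable K : comNzRingType.
Implicit Types (p q : powser2 K) (c : powser K).

(** The change of variable [y = lam + t^Q z] yields series in [t] with
    polynomial coefficients in [z]; to search again for a root, they must be read
    as series in [z] whose coefficients are series in [t]. *)
Definition ps_swap p : powser2 K := Powser (fun j => Powser (fun i => p i j)).

Lemma ps_swapE p i j : ps_swap p j i = p i j. Proof. by []. Qed.

Lemma ps_swap_zmod_morphism : zmod_morphism ps_swap.
Proof. by move=> p q; apply: powserP => j; apply: powserP. Qed.
HB.instance Definition _ := GRing.isZmodMorphism.Build (powser2 K) (powser2 K)
  ps_swap ps_swap_zmod_morphism.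

Lemma ps_swap_monoid_morphism : monoid_morphism ps_swap.
Proof.
split=> [|p q]; apply: powserP => j; apply: powserP => i.
  by case: i j => [|i] [|j].
rewrite ps_swapE !psM !ps_sum.
under eq_bigr do rewrite psM; under [RHS]eq_bigr do rewrite psM.
exact: exchange_big.
Qed.
HB.instance Definition _ := GRing.isMonoidMorphism.Build (powser2 K)
  (powser2 K) ps_swap ps_swap_monoid_morphism.

Lemma ps_swap_var : ps_swap (ps_var _) = ps_const (ps_var K).
Proof.
apply: powserP => j; apply: powserP => i; rewrite ps_swapE ps_constE /=.
by case: i j => [|[|i]] [|j].
Qed.

Lemma ps_swap_const c : ps_swap (ps_const c) = ps_map (@ps_const K) c.
Proof.
apply: powserP => j; apply: powserP => i; rewrite ps_swapE.
by rewrite ps_constE /=; case: eqP.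
Qed.

Lemma ps_swap_map c : ps_swap (ps_map (@ps_const K) c) = ps_const c.
Proof.
apply: powserP => j; apply: powserP => i; rewrite ps_swapE [LHS]ps_constE [in RHS]ps_constE.
by case: eqP.
Qed.

End Swap.

Section Taylor.
Variable K : comNzRingType.
Implicit Types (c : powser K) (g : powser2 K).

(** The Taylor expansion of [g] at [y = c], obtained by repeated division by
    [y - c]. As [c] vanishes at the origin, the coefficients have at [x = 0] the
    same values as those of [g]. *)
Lemma taylor_expansion c g m : c 0%N = 0 ->
  exists (h : nat -> powser K) (g' : powser2 K),
    [/\ g = \sum_(j < m) ps_const (h j) * (ps_var _ - ps_const c) ^+ j +
            (ps_var _ - ps_const c) ^+ m * g',
        (forall j, (j < m)%N -> h j 0%N = g j 0%N),
        (forall l, g' l 0%N = g (m + l)%N 0%N) &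
        (0 < m)%N -> h 0%N = ps_eval c g].
Proof.
move=> c0; elim: m => [|m [h [g' [Eg Eh Eg' h0]]]].
  by exists (fun=> 0), g; split=> //; rewrite big_ord0 add0r mul1r.
exists (fun j => if (j < m)%N then h j else ps_eval c g'), (ps_quo c g'); split.
- rewrite big_ord_recr /= ltnn {1}Eg -addrA; congr (_ + _).
    by apply: eq_bigr => j _; rewrite /= ltn_ord.
  rewrite {1}(ps_quoP g' c0) mulrDr addrC mulrA -exprSr [_ * ps_const _]mulrC.
  by [].
- move=> j; rewrite ltnS leq_eqVlt => /orP[/eqP->|lt]; last by rewrite lt Eh.
  by rewrite ltnn ps_eval_00 Eg' addn0.
- by move=> l; rewrite [ps_quo c g' l]/= ps_eval_00 /= Eg' add0n addnS addSn.
- move=> _; case: ifPn => [m0|]; first by rewrite h0.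
  by rewrite -eqn0Ngt => /eqP m0; rewrite Eg m0 big_ord0 add0r mul1r.
Qed.

End Taylor.

Section RootExistence.
Variable K : numClosedFieldType.
Implicit Types (lam c d p : powser K) (g h : powser2 K).

(** Translation brings a root [z0] of an initial form to the origin. *)
Definition recentre (z0 : K) (P : {poly K}) : powser K :=
  ps_of_poly (P \Po ('X + z0%:P)).
HB.instance Definition _ z0 := GRing.RMorphism.copy (recentre z0)
  (@ps_of_poly K \o comp_poly ('X + z0%:P)).

Lemma recentreC z0 a : recentre z0 a%:P = ps_const a.
Proof. by rewrite /recentre comp_polyC ps_of_polyC. Qed.
Lemma recentreX z0 : recentre z0 'X = ps_var K + ps_const z0.
Proof. by rewrite /recentre comp_polyX rmorphD /= ps_of_polyX ps_of_polyC. Qed.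

Definition blowup_at (z0 : K) (p : powser {poly K}) : powser2 K :=
  ps_swap (ps_map (recentre z0) p).
HB.instance Definition _ z0 := GRing.RMorphism.copy (blowup_at z0)
  (@ps_swap K \o ps_map (recentre z0)).

Lemma blowup_at_map z0 c : blowup_at z0 (ps_map polyC c) = ps_const c.
Proof.
rewrite -(ps_swap_map c); congr ps_swap; apply: powserP => i.
by rewrite /= recentreC.
Qed.

Lemma blowup_at_var z0 : blowup_at z0 (ps_var _) = ps_const (ps_var K).
Proof. by rewrite /blowup_at ps_map_var ps_swap_var. Qed.

Lemma blowup_at_X z0 :
  blowup_at z0 (ps_const 'X) = ps_var _ + ps_const (ps_const z0).
Proof.
rewrite /blowup_at ps_map_const /= recentreX ps_swap_const rmorphD /=.
by rewrite ps_map_var ps_map_const.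
Qed.

(** Roots go back through the transformation [y = lam + t^Q (z0 + y')]: the two
    sides, as functions of [g], are ring morphisms that agree on [x]-series and on
    [y]. *)
Lemma blowup_at_root lam Q z0 N c g : lam 0%N = 0 -> (0 < Q)%N -> (0 < N)%N ->
    c 0%N = 0 ->
  exists2 d : powser K, d 0%N = 0 &
    ps_eval c (ramify N (blowup_at z0 (blowup lam Q g))) =
    ps_eval d (ramify N g).
Proof.
move=> l0 Q0 N0 c0.
pose d := ps_ram N lam + ps_ram N (ps_var K ^+ Q) * (c + ps_const z0).
have d0 : d 0%N = 0.
  by rewrite psD psM0 !ps_ram_00 l0 ps_varX eq_sym gtn_eqF // mul0r addr0.
exists d; first exact: d0.
pose th1 := ps_eval c \o @ramify K N \o blowup_at z0 \o blowup lam Q.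
pose th2 := ps_eval d \o @ramify K N.
have E2 : th2 (ps_var _) = d by rewrite /th2 /= ramify_var ps_eval_var.
have E1 : th1 (ps_var _) = d.
  rewrite /th1 /= (blowup_varE l0 Q0) /blowup_var.
  rewrite (rmorphD (blowup_at z0)) (rmorphM (blowup_at z0)) !rmorphXn /= blowup_at_map.
  rewrite blowup_at_var blowup_at_X 2!rmorphD !rmorphM !rmorphXn /=.
  rewrite !rmorphD /= !ramify_const ramify_var !ps_eval_const ps_eval_var //.
  rewrite /d rmorphXn /=; by rewrite ps_ram_const.
have v0 : th1 (ps_var _) 0%N = 0 by rewrite E1.
apply: (@ps_hom_ext _ _ th1 th2 _ (etrans E1 (esym E2)) v0) => e.
by rewrite /th1 /th2 /= blowup_const blowup_at_map ramify_const !ps_eval_const.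
Qed.

(** A polynomial of degree [m] with a single root is [a (X - z0)^m]; if its
    coefficient of degree [m - 1] vanishes then [z0 = 0], so that it is a
    monomial. *)
Lemma poly_mid_root (P : {poly K}) m j : (0 < m)%N -> size P = m.+1 ->
    P`_m.-1 = 0 -> (j < m)%N -> P`_j != 0 ->
  exists z0 mu P1, [/\ (0 < mu < m)%N, P = P1 * ('X - z0%:P) ^+ mu &
                       ~~ root P1 z0].
Proof.
move=> m0 sP Pm1 jm Pj.
have P0 : P != 0 by rewrite -size_poly_eq0 sP.
have [z0 rz] : exists z0, root P z0 by apply/closed_rootP; rewrite sP eqSS -lt0n.
have [mu [P1]] := multiplicity_XsubC P z0; rewrite P0 /= => nr EP.
exists z0, mu, P1; split=> //.
have P10 : P1 != 0 by apply: contraNneq nr => ->; rewrite root0.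
have sz : (size P1 + mu = m.+1)%N.
  by rewrite -sP EP size_Mmonic ?monic_exp ?monicXsubC // size_exp_XsubC addnS.
have sP1 : (0 < size P1)%N by rewrite size_poly_gt0.
apply/andP; split.
  by rewrite lt0n; apply: contraNneq nr => mu0; rewrite EP mu0 expr0 mulr1 in rz.
rewrite ltnNge; apply/negP => le.
have mum : mu = m by lia.
have [a a0 EP1] : exists2 a, a != 0 & P1 = a%:P.
  by apply/size_poly1P/eqP; lia.
have Epr : ('X - z0%:P) ^+ m = \prod_(x <- nseq m z0) ('X - x%:P).
  by elim: (m) => [|n IH]; rewrite ?big_nil // exprS big_cons IH.
have := Pm1; rewrite EP EP1 mum Epr coefCM => /eqP; rewrite mulf_eq0 (negPf a0).
rewrite -{2}(size_nseq m z0) coefPn_prod_XsubC ?size_nseq -?lt0n //=.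
have -> : \sum_(x <- nseq m z0) x = z0 *+ m.
  by elim: (m) => [|n IH]; rewrite ?big_nil // big_cons IH mulrS.
rewrite oppr_eq0 mulrn_eq0 -leqn0 leqNgt m0 /= => /eqP z00.
move/negP: Pj; apply; rewrite EP EP1 mum z00 subr0 coefCM coefXn.
by rewrite ltn_eqF // mulr0.
Qed.

(** Newton-Puiseux: one root.  Expand [g] at a root [b] of its derivative of
    order [m - 1]: the subprincipal coefficient vanishes, so that after
    [y = b + t^Q z], where [t = x^(1/N)] and [Q / N] is the slope of the Newton
    polygon, the initial form in [z] is not a pure [m]-th power; recentre at a
    root of it, of multiplicity less than [m]. *)
Lemma puiseux_root_exists m g : (0 < m)%N -> ordY_is g m ->
  exists N c, [/\ (0 < N)%N, c 0%N = 0 & ps_eval c (ramify N g) = 0].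
Proof.
elim/ltn_ind: m g => m IH g m0 [gm gmm].
have gj j : (j < m)%N -> g j 0%N = 0 by apply: gm.
have [||b b0 root_b] := @implicit_function _ (iter m.-1 derivY g).
- by rewrite derivYn_coef psMn add0n gj ?mul0rn // prednK.
- rewrite derivYn_coef psMn add1n prednK // mulrn_eq0 negb_or gmm andbT.
  by rewrite -lt0n ffact_gt0 leq_pred.
have [h [g' [Eg Eh Eg' h0]]] := taylor_expansion g m b0.
have [hb0|hb0] := eqVneq (h 0%N) 0.
  exists 1%N, b; split=> //; rewrite -[RHS]hb0 h0 //; congr ps_eval.
  by apply: powserP => j; apply: powserP => i; rewrite /= dvd1n divn1.
have o_ex j : exists w, h j = 0 \/ (h j w != 0 /\ eqmod w (h j) 0).
  have [->|/ps_neq0P[w ?]] := eqVneq (h j) 0; first by exists 0%N; left.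
  by exists w; right.
have [o oP] := choice o_ex.
(* the first side of the Newton polygon *)
pose slope (j : 'I_m) : rat := (o j)%:R / (m - j)%:R.
case: (@arg_minP _ _ _ (Ordinal m0) (fun j : 'I_m => h j != 0) slope) => //.
move=> j0 hj0 jmin; pose N := (m - j0)%N; pose Q := o j0.
have N0 : (0 < N)%N by rewrite subn_gt0.
have [hjQ ejQ] : h j0 Q != 0 /\ eqmod Q (h j0) 0.
  by case: (oP j0) => // hE; rewrite hE eqxx in hj0.
have Q0 : (0 < Q)%N.
  by rewrite lt0n; apply: contraNneq hjQ => ->; rewrite Eh ?gj.
have kP j : (j < m)%N -> exists k : powser K, ps_ram N (h j) = ps_var K ^+ (Q * (m - j)) * k.
  move=> jm; have e : eqmod (Q * (m - j)) (ps_ram N (h j)) 0.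
    have [->|hj] := eqVneq (h j) 0; first by rewrite rmorph0.
    have [hjE|[_ ej]] := oP j; first by rewrite hjE eqxx in hj.
    have := jmin (Ordinal jm) hj.
    rewrite /slope /= ler_pdivrMr ?ltr0n ?subn_gt0 // mulrAC.
    rewrite ler_pdivlMr ?ltr0n ?subn_gt0 // -!natrM ler_nat => le i lt.
    rewrite ps_ramE; case: ifP => // /dvdnP[l El]; rewrite El mulnK //.
    apply: ej; rewrite -(ltn_pmul2r N0) -El; exact: leq_trans lt le.
  by exists (Powser (fun i => ps_ram N (h j) (i + Q * (m - j))%N)); apply: ps_factor_var.
have [k kE] : exists k : nat -> powser K, forall j, (j < m)%N ->
    ps_ram N (h j) = ps_var K ^+ (Q * (m - j)) * k j.
  have ex j : exists kj : powser K, (j < m)%N ->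
      ps_ram N (h j) = ps_var K ^+ (Q * (m - j)) * kj.
    by case: (ltnP j m) => [/kP[kj ?]|_]; [exists kj | exists 0].
  by have [k ?] := choice ex; exists k.
pose b1 := ps_ram N b; have b10 : b1 0%N = 0 by rewrite ps_ram_00.
pose G := \sum_(j < m) ps_map polyC (k j) * ps_const 'X ^+ j +
          ps_const 'X ^+ m * blowup b1 Q (ramify N g').
have S_lin : blowup b1 Q (ramify N (ps_var _ - ps_const b)) =
    ps_var _ ^+ Q * ps_const 'X.
  by rewrite ramify_lin blowup_lin // subrr rmorph0 add0r.
have SG : blowup b1 Q (ramify N g) = ps_var _ ^+ (Q * m) * G.
  rewrite {1}Eg 2!rmorphD 2!rmorph_sum 2!rmorphM 2!rmorphXn /= S_lin.
  rewrite exprMn -exprM mulrDr mulrA mulr_sumr; congr (_ + _).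
  apply: eq_bigr => -[j jm] _ /=.
  rewrite 2!rmorphM 2!rmorphXn /= S_lin.
  rewrite ramify_const blowup_const kE // rmorphM rmorphXn /= ps_map_var.
  by rewrite exprMn -exprM mulrACA -exprD -mulnDr subnK // ltnW.
pose P := G 0%N.
have PE : P = \sum_(j < m) (k j 0%N) *: 'X^j + (g m 0%N) *: 'X^m.
  have X0 : ps_const 'X 0%N = 'X :> {poly K} by rewrite ps_constE.
  rewrite /P psD ps_sum psM0 psX0 X0 blowup_0 ramify_at0 Eg' addn0.
  rewrite mulrC mul_polyC; congr (_ + _); apply: eq_bigr => j _.
  by rewrite psM0 psX0 X0 -mul_polyC.
have Pcoef j : (j < m)%N -> P`_j = k j 0%N.
  move=> jm; rewrite PE coefD coef_sum coefZ coefXn ltn_eqF // mulr0 addr0.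
  rewrite (bigD1 (Ordinal jm)) //= coefZ coefXn eqxx mulr1 big1 ?addr0 // => i ne.
  by rewrite coefZ coefXn eq_sym (negPf (ne : i != j :> nat)) mulr0.
have sP : size P = m.+1.
  rewrite PE addrC size_polyDl ?size_scale // size_polyXn // ltnS.
  apply: (leq_trans (size_sum _ _ _)); apply/bigmax_leqP => j _.
  by rewrite (leq_trans (size_scale_leq _ _)) // size_polyXn.
have Pj0 : P`_j0 != 0.
  have := congr1 (fun p : powser K => p (Q * N)%N) (kE j0 (ltn_ord j0)).
  rewrite ps_ram_coef // ps_varXM ltnn subnn => E.
  by rewrite Pcoef // -E.
(* [b] is a root of the derivative of order [m - 1], hence so is [0] for [P] *)
have Pm1 : P`_m.-1 = 0.
  have m1m : (m.-1 < m)%N by rewrite prednK.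
  have S1 := ps_factor b0 root_b.
  have := blowup_derivYn m.-1 (ramify N g) b10 Q0.
  rewrite SG ps_dzn_varM derivYn_ramify S1 2!rmorphM /= S_lin !mulrA -exprD -mulnSr prednK //.
  rewrite -mulrA => /ps_varXM_inj E.
  have := congr1 (fun p : powser {poly K} => p 0%N) E.
  rewrite ps_dzn_coef -/P psM0 ps_constE eqxx.
  move=> /(congr1 (fun q : {poly K} => q`_0)).
  rewrite coefXM eqxx coef_derivn addn0 => /eqP.
  by rewrite mulrn_eq0 -leqn0 leqNgt ffact_gt0 leqnn /= => /eqP.
have [z0 [mu [P1 [mu_m EP nr]]]] := poly_mid_root m0 sP Pm1 (ltn_ord j0) Pj0.
case/andP: mu_m => mu0 mum.
have oG : ordY_is (blowup_at z0 G) mu.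
  have E : at_x0 (blowup_at z0 G) = ps_var _ ^+ mu * recentre z0 P1.
    have -> : at_x0 (blowup_at z0 G) = recentre z0 P by apply: powserP.
    rewrite EP rmorphM rmorphXn rmorphB /= recentreX recentreC addrK mulrC //.
  split; rewrite E; first exact: eqmod_var.
  rewrite ps_varXM ltnn subnn /= -horner_coef0 horner_comp !hornerE.
  exact: nr.
have [N' [c [N'0 c0 Ec]]] := IH mu mum (blowup_at z0 G) mu0 oG.
have [d d0 Ed] := blowup_at_root z0 (ramify N g) b10 Q0 N'0 c0.
exists (N * N')%N, d; split; [by rewrite muln_gt0 N0|exact: d0|].
by rewrite -(ramify_ramify _ N'0 N0) -Ed SG !rmorphM /= Ec mulr0.
Qed.

End RootExistence.

(** * Newton-Puiseux factorization and irreducible series *)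

Section Linprod.
Variable K : fieldType.
Implicit Types (c d : powser K) (s : seq (powser K)) (f g : powser2 K).

Definition linprod s : powser2 K := \prod_(c <- s) (ps_var _ - ps_const c).

Definition positive s := forall c, c \in s -> c 0%N = 0.

Lemma linprod_cons c s : linprod (c :: s) = (ps_var _ - ps_const c) * linprod s.
Proof. exact: big_cons. Qed.
Lemma linprod_nil : linprod [::] = 1. Proof. exact: big_nil. Qed.

Lemma linprod_flatten (ss : seq (seq (powser K))) :
  linprod (flatten ss) = \prod_(s <- ss) linprod s.
Proof.
elim: ss => [|s ss IH]; first by rewrite linprod_nil big_nil.
by rewrite big_cons -IH /linprod -big_cat.
Qed.

Lemma perm_linprod s1 s2 : perm_eq s1 s2 -> linprod s1 = linprod s2.
Proof. exact: perm_big. Qed.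

Lemma eval_linprod c s : c 0%N = 0 -> (ps_eval c (linprod s) == 0) = (c \in s).
Proof.
move=> c0; elim: s => [|d s IH].
  by rewrite linprod_nil rmorph1 oner_eq0.
by rewrite linprod_cons rmorphM /= ps_eval_lin // mulf_eq0 subr_eq0 IH in_cons.
Qed.

Lemma ordY_linprod s : positive s -> ordY_is (linprod s) (size s).
Proof.
elim: s => [|c s IH] s0.
  by rewrite linprod_nil; apply/ordY_is_unit/unitr1.
rewrite linprod_cons -[size _]add1n; apply: ordY_isM.
  by apply: ordY_is_lin; apply: s0; rewrite mem_head.
by apply: IH => d ds; apply: s0; rewrite in_cons ds orbT.
Qed.

Lemma ramify_linprod M s :
  ramify M (linprod s) = linprod [seq ps_ram M c | c <- s].
Proof.
elim: s => [|c s IH]; first by rewrite !linprod_nil rmorph1.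
by rewrite map_cons !linprod_cons rmorphM /= ramify_lin IH.
Qed.

Lemma linprod_dvd g s : uniq s -> positive s ->
    (forall c, c \in s -> ps_eval c g = 0) ->
  exists h, g = h * linprod s.
Proof.
elim: s g => [|c s IH] g /=; first by exists g; rewrite linprod_nil mulr1.
case/andP=> cs us s0 rg; have c0 : c 0%N = 0 by apply: s0; rewrite mem_head.
have Eg := ps_factor c0 (rg c (mem_head _ _)).
have [d ds|d ds|h Eh] := IH (ps_quo c g) us.
- by apply: s0; rewrite in_cons ds orbT.
- have d0 : d 0%N = 0 by apply: s0; rewrite in_cons ds orbT.
  have /eqP : ps_eval d g = 0 by apply: rg; rewrite in_cons ds orbT.
  rewrite {1}Eg rmorphM /= ps_eval_lin // mulf_eq0 subr_eq0.
  by case/orP=> [/eqP dc|/eqP//]; move: cs; rewrite -dc ds.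
by exists h; rewrite Eg Eh linprod_cons mulrCA.
Qed.

(** Each [y - c] is prime, as the kernel of the evaluation at [c], whose values
    are in a domain; so the linear factors can be cancelled one by one from [f]
    or from [g]. *)
Lemma linprod_factor f g U s : U \is a GRing.unit -> positive s ->
    f * g = U * linprod s ->
  exists U1 s1, [/\ U1 \is a GRing.unit, {subset s1 <= s} &
                    f = U1 * linprod s1].
Proof.
move=> Uu; elim: s f g => [|c s IH] f g s0.
  rewrite linprod_nil mulr1 => E; exists f, [::]; split=> //.
    by move: Uu; rewrite -E unitrM => /andP[].
  by rewrite linprod_nil mulr1.
have c0 : c 0%N = 0 by apply: s0; rewrite mem_head.
have s0' : positive s by move=> d ds; apply: s0; rewrite in_cons ds orbT.
have lin_inj : injective ( *%R (ps_var _ - ps_const c)).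
  apply: mulfI; apply/eqP => E; have [_] := ordY_is_lin c0.
  by rewrite E eqxx.
rewrite linprod_cons => E.
have /eqP : ps_eval c (f * g) = 0.
  by rewrite E !rmorphM /= ps_eval_lin // subrr mul0r mulr0.
rewrite rmorphM mulf_eq0 => /orP[] /eqP r.
  have Ef := ps_factor c0 r.
  have [|U1 [s1 [U1u s1s E1]]] := IH (ps_quo c f) g s0'.
    by apply: lin_inj; rewrite [LHS]mulrA -Ef E [LHS]mulrCA.
  exists U1, (c :: s1); split; [exact: U1u| |by rewrite Ef E1 linprod_cons [LHS]mulrCA].
  move=> d; rewrite !in_cons => /orP[->|/s1s ->] //; exact: orbT.
have Eg := ps_factor c0 r.
have [|U1 [s1 [U1u s1s E1]]] := IH f (ps_quo c g) s0'.
  by apply: lin_inj; rewrite [LHS]mulrCA -Eg E [LHS]mulrCA.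
exists U1, s1; split=> // d /s1s ds; by rewrite in_cons ds orbT.
Qed.

End Linprod.

Section Splitting.
Variable K : numClosedFieldType.
Implicit Types (c d : powser K) (s : seq (powser K)) (f g h : powser2 K).

(** [g] has all its Newton-Puiseux roots in [K[[x^(1/N)]]]. *)
Definition splits N g := exists U s,
  [/\ U \is a GRing.unit, positive s & ramify N g = U * linprod s].

Lemma splits_ramify M N g : (0 < M)%N -> (0 < N)%N ->
  splits N g -> splits (N * M) g.
Proof.
move=> M0 N0 [U [s [Uu s0 E]]].
exists (ramify M U), [seq ps_ram M c | c <- s]; split.
- by rewrite ramify_unit.
- by move=> c /mapP[d /s0 d0 ->]; rewrite ps_ram_00.
- by rewrite -(ramify_ramify _ M0 N0) E rmorphM /= ramify_linprod.
Qed.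

(** The Newton-Puiseux theorem: roots are divided out one at a time, each at the
    cost of a ramification. *)
Lemma splits_exists g m : ordY_is g m -> exists2 N, (0 < N)%N & splits N g.
Proof.
elim: m g => [|m IH] g gm.
  exists 1%N => //; exists (ramify 1 g), [::]; split=> //.
    by rewrite ramify_unit; apply/ordY_is_unit.
  by rewrite linprod_nil mulr1.
have [N [c [N0 c0 r]]] := puiseux_root_exists (ltn0Sn m) gm.
have Eg := ps_factor c0 r; set q := ps_quo c _ in Eg.
have qm : ordY_is q m.
  have := iffRL (ordY_is_ramify N g _) gm; rewrite Eg => o.
  have [m1 [m2 [o1 o2 E]]] := ordY_is_factor o.
  have m11 := ordY_is_uniq o1 (ordY_is_lin c0); rewrite m11 in E.
  by case: E => <-.
have [M M0 [U [s [Uu s0 E]]]] := IH q qm.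
exists (N * M)%N; first by rewrite muln_gt0 N0.
exists U, (ps_ram M c :: s); split; first exact: Uu.
  by move=> d; rewrite in_cons => /orP[/eqP->|/s0//]; rewrite ps_ram_00.
by rewrite -(ramify_ramify _ M0 N0) Eg rmorphM /= ramify_lin E linprod_cons mulrCA.
Qed.

End Splitting.

Lemma prim_root_exists (K : numClosedFieldType) n : (0 < n)%N ->
  exists z : K, n.-primitive_root z.
Proof.
move=> n_gt0; pose p : {poly K} := 'X^n - 1.
have [r Dp] := closed_field_poly_normal p.
rewrite (monicP _) ?monicXnsubC // scale1r in Dp.
have rn1 : all n.-unity_root r by apply/allP=> z; rewrite -root_prod_XsubC -Dp.
have sz_r : (n < (size r).+1)%N.
  by rewrite -(size_prod_XsubC r id) -Dp size_XnsubC.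
have [|z] := hasP (has_prim_root n_gt0 rn1 _ sz_r); last by exists z.
by rewrite -separable_prod_XsubC -Dp separable_Xn_sub_1 // pnatr_eq0 -lt0n.
Qed.

Lemma prim_root_neq0 (K : fieldType) n (z : K) : n.-primitive_root z -> z != 0.
Proof.
move=> zP; apply: contra_eq_neq (prim_expr_order zP) => ->.
by rewrite expr0n (gtn_eqF (prim_order_gt0 zP)) eq_sym oner_eq0.
Qed.

Section Conjugates.
Variables (K : numClosedFieldType) (N : nat) (z : K).
Hypothesis zP : N.-primitive_root z.
Implicit Types (c d : powser K) (s : seq (powser K)) (f g h : powser2 K).

Let N0 : (0 < N)%N := prim_order_gt0 zP.

Definition galconj j c : powser K := ps_rot (z ^+ j) c.

Lemma conjE j c i : galconj j c i = z ^+ (j * i) * c i.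
Proof. by rewrite exprM. Qed.
Lemma conj_conj i j c : galconj i (galconj j c) = galconj (i + j) c.
Proof. by rewrite /galconj ps_rot_rot -exprD. Qed.
Lemma conj0 c : galconj 0 c = c.
Proof. by rewrite /galconj expr0 ps_rot1. Qed.
Lemma conj_mod j c : galconj (j %% N) c = galconj j c.
Proof. by rewrite /galconj (prim_expr_mod zP). Qed.
Lemma conj_00 j c : galconj j c 0%N = c 0%N.
Proof. exact: ps_rot_00. Qed.
Lemma conj_inv j c : exists i, galconj i (galconj j c) = c.
Proof.
exists (N - j %% N)%N; rewrite conj_conj -conj_mod -modnDmr subnK.
  by rewrite modnn conj0.
exact/ltnW/ltn_pmod.
Qed.
Lemma conj_inj j : injective (galconj j).
Proof.
move=> c d E; apply: powserP => i; have := congr1 (fun p : powser K => p i) E.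
by rewrite !conjE => /mulfI; apply; rewrite expf_neq0 // (prim_root_neq0 zP).
Qed.

(** The conjugates of [c] over [K[[x]]], where [x = t^N]: the Galois group is
    generated by [t -> z t]. *)
Definition orbit c := undup [seq galconj j c | j <- iota 0 N].

Lemma orbitP c d : reflect (exists j, d = galconj j c) (d \in orbit c).
Proof.
rewrite mem_undup; apply: (iffP mapP) => [[j _ ->]|[j ->]]; first by exists j.
exists (j %% N)%N; last by rewrite conj_mod.
by rewrite mem_iota ltn_pmod.
Qed.

Lemma orbit_uniq c : uniq (orbit c). Proof. exact: undup_uniq. Qed.

Lemma mem_orbit c : c \in orbit c.
Proof. by apply/orbitP; exists 0%N; rewrite conj0. Qed.

Lemma conj_orbit j c d : (galconj j d \in orbit c) = (d \in orbit c).
Proof.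
apply/orbitP/orbitP => [[i E]|[i ->]]; last by exists (j + i)%N; rewrite conj_conj.
by have [l El] := conj_inv j d; exists (l + i)%N; rewrite -El E conj_conj.
Qed.

Lemma orbit_perm c d : d \in orbit c -> perm_eq (orbit d) (orbit c).
Proof.
move=> dc; apply: uniq_perm; rewrite ?orbit_uniq // => e.
apply/idP/idP => /orbitP[j ->]; first by rewrite conj_orbit.
have /orbitP[i Ei] := dc; have [l El] := conj_inv i c.
by rewrite conj_orbit -El -Ei conj_orbit mem_orbit.
Qed.

Lemma size_orbit_gt0 c : (0 < size (orbit c))%N.
Proof. by have := mem_orbit c; case: (orbit c). Qed.

Lemma orbit_positive c : c 0%N = 0 -> positive (orbit c).
Proof. by move=> c0 d /orbitP[j ->]; rewrite conj_00. Qed.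

Lemma rot_linprod s : ps_map (ps_rot z) (linprod s) =
  linprod [seq galconj 1 c | c <- s].
Proof.
elim: s => [|c s IH]; first by rewrite !linprod_nil rmorph1.
rewrite map_cons !linprod_cons rmorphM rmorphB /= IH ps_map_var ps_map_const.
by rewrite /galconj expr1.
Qed.

(** Galois descent from [K[[t]]] to [K[[x]]], where [x = t^N] *)
Lemma ramify_descent h : ps_map (ps_rot z) h = h -> exists h', h = ramify N h'.
Proof.
move=> E; exists (Powser (fun j => Powser (fun i => h j (i * N)%N))).
apply: powserP => j; apply: powserP => i /=.
case: ifPn => [/divnK -> //|nd].
have := congr1 (fun g : powser2 K => g j i) E; rewrite /= => /eqP.
rewrite -subr_eq0 -{2}[h j i]mul1r -mulrBl mulf_eq0 subr_eq0.
by rewrite -(prim_order_dvd zP) (negPf nd) => /eqP.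
Qed.

Lemma rot_ramify g : ps_map (ps_rot z) (ramify N g) = ramify N g.
Proof.
apply: powserP => j; apply: powserP => i /=; case: ifP => [|_]; last exact: mulr0.
by rewrite (prim_order_dvd zP) => /eqP ->; rewrite mul1r.
Qed.

(** The minimal polynomial over [K[[x]]] of the Puiseux series [c(x^(1/N))] *)
Definition minpol c : powser2 K :=
  Powser (fun j => Powser (fun i => linprod (orbit c) j (i * N)%N)).

Lemma ramify_minpol c : ramify N (minpol c) = linprod (orbit c).
Proof.
have [|h' Eh] := @ramify_descent (linprod (orbit c)).
  rewrite rot_linprod; apply: perm_linprod; apply: uniq_perm.
  - by rewrite map_inj_uniq ?orbit_uniq //; apply: conj_inj.
  - exact: orbit_uniq.
  - move=> d; apply/mapP/idP => [[e ec ->]|dc]; first by rewrite conj_orbit.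
    have [i E] := conj_inv 1 d; exists (galconj i d); first by rewrite conj_orbit.
    by rewrite conj_conj addnC -conj_conj E.
rewrite Eh; congr (ramify N _); apply: powserP => j; apply: powserP => i.
by rewrite /minpol Eh; apply: ps_ram_coef.
Qed.

Lemma minpol_orbit c d : d \in orbit c -> minpol d = minpol c.
Proof.
move=> dc; apply: (ramify_inj N0); rewrite !ramify_minpol.
exact/perm_linprod/orbit_perm.
Qed.

Lemma ordY_minpol c : c 0%N = 0 -> ordY_is (minpol c) (size (orbit c)).
Proof.
move=> c0; apply/(ordY_is_ramify N); rewrite ramify_minpol.
exact/ordY_linprod/orbit_positive.
Qed.

(** All the conjugates of a root of [g] are roots, so [linprod (orbit c)] divides
    [g] over [K[[t]]]; the quotient is fixed by the Galois group and descends. *)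
Lemma minpol_dvd c g : c 0%N = 0 -> ps_eval c (ramify N g) = 0 ->
  exists h, g = h * minpol c.
Proof.
move=> c0 r; have ne0 : linprod (orbit c) != 0.
  have [_] := ordY_linprod (orbit_positive c0).
  by apply: contraNneq => ->.
have [||h Eh] := linprod_dvd (g := ramify N g) (orbit_uniq c).
- exact: orbit_positive.
- move=> _ /orbitP[j ->]; elim: j => [|j IH]; first by rewrite conj0.
  rewrite -add1n -conj_conj -(rot_ramify g) /galconj expr1 eval_rot ?conj_00 //.
  by rewrite IH rmorph0.
have [|h' Eh'] := @ramify_descent h.
  apply: (mulIf ne0); rewrite -{1}ramify_minpol -(rot_ramify (minpol c)).
  by rewrite -rmorphM ramify_minpol -Eh /= rot_ramify.
exists h'; apply: (ramify_inj N0).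
by rewrite rmorphM /= ramify_minpol Eh Eh'.
Qed.

Lemma irreducible_root g c : irreducible_elt g -> c 0%N = 0 ->
    ps_eval c (ramify N g) = 0 ->
  exists2 u, u \is a GRing.unit & g = u * minpol c.
Proof.
move=> [_ _ irr] c0 /(minpol_dvd c0)[h Eh]; exists h => //.
case: (irr _ _ Eh) => [//|/ordY_is_unit o].
have := ordY_is_uniq o (ordY_minpol c0).
by move=> /esym/eqP; rewrite -leqn0 leqNgt size_orbit_gt0.
Qed.

(** A proper factor has one of the conjugates as a root, hence is divisible by
    the minimal polynomial; compare the orders at [x = 0]. *)
Lemma minpol_irreducible c : c 0%N = 0 -> irreducible_elt (minpol c).
Proof.
move=> c0; have o := ordY_minpol c0; have s0 := size_orbit_gt0 c.
have [_ ne0] := o.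
split.
- by apply: contraNneq ne0 => ->.
- by apply/negP => /ordY_is_unit /(ordY_is_uniq o) E; rewrite E in s0.
move=> a b E; rewrite E in o; have [m1 [m2 [o1 o2 Em]]] := ordY_is_factor o.
case: m1 => [|m1] in o1 Em; first by left; apply/ordY_is_unit.
right; apply/ordY_is_unit.
have Er : ramify N a * ramify N b = 1 * linprod (orbit c).
  by rewrite mul1r -ramify_minpol E rmorphM.
have [U1 [s1 [U1u s1s Ea]]] :=
  linprod_factor (unitr1 _) (orbit_positive c0) Er.
have s1_0 : positive s1 by move=> d /s1s; apply: orbit_positive.
case: s1 => [|d s1] in Ea s1s s1_0.
  have : ordY_is (ramify N a) 0.
    by apply/ordY_is_unit; rewrite Ea linprod_nil mulr1.
  by move/ordY_is_ramify/(ordY_is_uniq o1).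
have dc : d \in orbit c by apply: s1s; rewrite mem_head.
have d0 : d 0%N = 0 by apply: orbit_positive dc.
have [|h Eh] := @minpol_dvd d a d0.
  by rewrite Ea rmorphM /= (eqP (_ : ps_eval d (linprod _) == 0)) ?mulr0 //
             eval_linprod ?mem_head.
rewrite Eh in o1; have [m3 [m4 [o3 o4 Em1]]] := ordY_is_factor o1.
have := ordY_is_uniq o4 (ordY_minpol d0).
rewrite (perm_size (orbit_perm dc)) => E4.
by have -> : 0%N = m2 by lia.
Qed.

(** By induction on the number of roots: the minimal polynomial of a root divides
    [g], and the quotient still splits. *)
Lemma minpol_factorization g : splits N g ->
  exists u C, [/\ u \is a GRing.unit, positive C &
                  g = u * \prod_(c <- C) minpol c].
Proof.
move=> [U [s [Uu s0 E]]].
elim: {s}(size s).+1 {-2}s (ltnSn (size s)) g U Uu s0 E => // n IH.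
case=> [|c s] lt g U Uu s0 E.
  exists g, [::]; split; [|by []|by rewrite big_nil mulr1].
  by rewrite -(ramify_unit N) E linprod_nil mulr1.
have c0 : c 0%N = 0 by apply: s0; rewrite mem_head.
have [|h Eh] := @minpol_dvd c g c0.
  by rewrite E rmorphM /= linprod_cons rmorphM /= ps_eval_lin // subrr mul0r mulr0.
have E' : ramify N h * ramify N (minpol c) = U * linprod (c :: s).
  by rewrite -E Eh rmorphM.
have [U1 [s1 [U1u s1s E1]]] := linprod_factor Uu s0 E'.
have s1_0 : positive s1 by move=> d /s1s /s0.
have sz : (size s1 + size (orbit c) = size (c :: s))%N.
  have o1 : ordY_is (ramify N h * ramify N (minpol c)) (size s1 + size (orbit c)).
    apply: ordY_isM; last by apply/ordY_is_ramify/ordY_minpol.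
    rewrite E1 -[size s1]add0n; apply: ordY_isM; first exact/ordY_is_unit.
    exact: ordY_linprod.
  rewrite E' in o1; apply: (ordY_is_uniq o1); rewrite -[size _]add0n.
  apply: ordY_isM (ordY_linprod s0); exact/ordY_is_unit.
have := size_orbit_gt0 c; rewrite /= in sz lt => so.
have [|u [C [uu C0 Eh']]] := IH s1 _ h U1 U1u s1_0 E1.
  by apply: leq_trans (lt : (size s).+1 <= n)%N; rewrite -sz -addn1 leq_add2l.
exists u, (c :: C); split; first exact: uu.
  by move=> d; rewrite in_cons => /orP[/eqP->|/C0].
by rewrite Eh Eh' big_cons -mulrA [minpol c * _]mulrC.
Qed.

Lemma ramify_prod_minpol u C : ramify N (u * \prod_(c <- C) minpol c) =
  ramify N u * linprod (flatten [seq orbit c | c <- C]).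
Proof.
rewrite rmorphM rmorph_prod linprod_flatten big_map /=; congr (_ * _).
by apply: eq_bigr => c _; apply: ramify_minpol.
Qed.

Lemma positive_orbits C : positive C ->
  positive (flatten [seq orbit c | c <- C]).
Proof.
by move=> C0 d /flattenP[s /mapP[c /C0 c0 ->] ds]; apply: orbit_positive ds.
Qed.

(** A branch has a root, which is a conjugate of some [c] in [C], and a branch is
    the minimal polynomial of each of its roots. *)
Lemma irreducible_factor_minpol u C g : u \is a GRing.unit -> positive C ->
    irreducible_factor g (u * \prod_(c <- C) minpol c) ->
  exists c, [/\ c \in C & exists2 v, v \is a GRing.unit & g = v * minpol c].
Proof.
move=> uu C0 [irr [q Eq]]; have Uu : ramify N u \is a GRing.unit.
  by rewrite ramify_unit.
have [|U1 [s1 [U1u s1s E1]]] := linprod_factor (f := ramify N g)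
  (g := ramify N q) Uu (positive_orbits C0).
  by rewrite -ramify_prod_minpol Eq mulrC rmorphM.
case: s1 => [|d s1] in s1s E1.
  have [_ + _] := irr; rewrite -(ramify_unit N) E1 linprod_nil mulr1.
  by rewrite U1u.
have /flattenP[s /mapP[c cC ->] dc] : d \in flatten [seq orbit c | c <- C].
  by apply: s1s; rewrite mem_head.
have d0 : d 0%N = 0 by apply: orbit_positive dc; apply: C0.
exists c; split=> //; rewrite -(minpol_orbit dc); apply: irreducible_root => //.
by rewrite E1 rmorphM /= (eqP (_ : ps_eval d (linprod _) == 0)) ?mulr0 //
           eval_linprod ?mem_head.
Qed.

End Conjugates.

(** * Higher derivatives of a power of a binomial *)

Section Rolle.
Variable R : rcfType.
Implicit Types (p : {poly R}) (x : R) (s : seq R).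

(** The new roots avoid the given ones, so that a multiple root of [p] is not
    counted among them. *)
Lemma rolle_path p x s : path <%R x s -> all (root p) (x :: s) ->
  exists s', [/\ size s' = size s, sorted <%R s', all (root p^`()) s' &
    all (fun c => (x < c) && (c < last x s) && (c \notin x :: s)) s'].
Proof.
elim: s x => [|y s IH] x; first by exists [::].
rewrite [path _ _ _]/= => /andP[xy ys] /andP[rx rys].
have [s' [ss' so r' inter]] := IH y ys rys.
have [|c cxy rc] := @poly_rolle _ x y p xy.
  by have /andP[/rootP -> _] := rys; apply/rootP.
have /andP[xc cy] : (x < c) && (c < y) by rewrite in_itv /= in cxy.
have yle : all (<=%R y) (y :: s).
  rewrite /= lexx /=; apply/allP => w ws; apply: ltW.
  exact: (allP (order_path_min lt_trans ys) w ws).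
have yl : y <= last y s by apply: (allP yle); apply: mem_last.
exists (c :: s'); split; rewrite /= ?ss' //.
- rewrite path_sortedE ?so ?andbT; last exact: lt_trans.
  by apply/allP => w /(allP inter) /andP[/andP[yw _] _]; apply: lt_trans yw.
- by rewrite r' andbT; apply/rootP.
rewrite xc (lt_le_trans cy yl) /= !inE negb_or (gt_eqF xc) /=; apply/andP; split.
  by apply/negP => /(allP yle) /(lt_le_trans cy); rewrite ltxx.
apply/allP => w /(allP inter) /andP[/andP[yw wl] nw].
by rewrite (lt_trans xy yw) wl /= inE negb_or nw andbT gt_eqF // (lt_trans xy).
Qed.

End Rolle.

Section BinomialPower.
Variables (R : rcfType) (n e : nat).
Hypothesis n0 : (0 < n)%N.

Let u : {poly R} := 'X - 1%:P.
Let rprod (L : seq R) : {poly R} := \prod_(x <- L) ('X - x%:P).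

Lemma size_binomial_power k :
  size ((('X^n - 1%:P : {poly R}) ^+ e)^`(k)) = ((n * e).+1 - k)%N.
Proof.
have /monic_neq0 nz : ('X^n - 1%:P : {poly R}) ^+ e \is monic.
  by rewrite monic_exp ?monicXnsubC.
have := size_exp ('X^n - 1%:P : {poly R}) e; rewrite size_XnsubC //= => E.
by rewrite size_derivn -E prednK // lt0n size_poly_eq0.
Qed.

Let Lp k (L : seq R) := if (k < e)%N then rcons L 1 else L.

Lemma rprod_Lp k L : rprod L * u ^+ (e - k) = rprod (Lp k L) * u ^+ (e - k.+1).
Proof.
rewrite /Lp; case: ltnP => [lt|le]; last first.
  by congr (_ * _ ^+ _); lia.
by rewrite /rprod big_rcons /= mulrAC -mulrA -exprSr subnSK // mulrC.
Qed.

(** The derivative of order [k] of [(X^n - 1)^e] is, up to a power of [X], a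
    polynomial in [X^n] whose roots are, besides [1], simple and in [(0, 1)].
    Write the derivative as [X^r G(w)] with [w = X^n]. The next one is then
    [X^(r - 1)] times [r G + n w G'], which is up to a factor the derivative of
    [w^r G^n]. Rolle, applied to that function between consecutive roots with
    [0 <= w <= 1] ([0] being one of them when [r > 0]), provides as many new roots as
    the degree permits, so there is no other root and these are simple. *)
Lemma deriv_binomial_power_real k : (k < n * e)%N ->
  exists r c (a : R) (L : seq R), [/\ (r < n)%N /\ (n * c = k + r)%N, a != 0,
    (size L + c = minn e k)%N,
    sorted <%R L /\ all (fun x => (0 < x) && (x < 1)) L &
    (('X^n - 1%:P : {poly R}) ^+ e)^`(k) =
      a *: ('X^r * ((rprod L * u ^+ (e - k)) \Po 'X^n))].
Proof.
elim: k => [|k IH] ltk.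
  exists 0%N, 0%N, 1, [::]; split; rewrite ?oner_eq0 ?muln0 ?minn0 //.
  rewrite derivn0 scale1r mul1r /rprod big_nil mul1r subn0.
  by rewrite (rmorphXn (comp_poly 'X^n)) /= /u comp_polyB comp_polyX comp_polyC.
have [r [c [a [L [[rn Ec] a0 sL [soL L01] EF]]]]] := IH (ltnW ltk).
rewrite rprod_Lp in EF; set P := rprod (Lp k L) in EF.
set d := (e - k.+1)%N in EF.
have sLp : size (Lp k L) = (size L + (k < e))%N.
  by rewrite /Lp; case: ifP; rewrite ?size_rcons ?addn1 ?addn0.
have soLp : sorted <%R (Lp k L).
  rewrite /Lp; case: ifP => // _; rewrite -cats1 -(revK (L ++ [:: 1])) rev_sorted.
  rewrite rev_cat /= path_sortedE; last by move=> x y w /= yx wy; apply: lt_trans yx.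
  rewrite rev_sorted soL andbT all_rev.
  by apply/allP => x /(allP L01) /andP[].
have Lp01 x : x \in Lp k L -> 0 < x <= 1.
  rewrite /Lp; case: ifP => _; last by move/(allP L01) => /andP[-> /ltW].
  rewrite mem_rcons inE => /orP[/eqP->|]; first by rewrite ltr01 lexx.
  by move/(allP L01) => /andP[-> /ltW].
pose Q := rprod L *+ d.
have dP : P^`() * u ^+ d + P * (u ^+ d)^`() = u ^+ d * (P^`() + Q).
  rewrite mulrDr mulrC; congr (_ + _); rewrite /Q deriv_exp derivB derivX derivC.
  rewrite subr0 mul1r; case: (posnP d) => [->|d0]; first by rewrite !mulr0n !mulr0.
  have ke : (k < e)%N by move: d0; rewrite subn_gt0 => /ltnW.
  rewrite /P /Lp ke /rprod big_rcons /= -/u !mulrnAr; congr (_ *+ _).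
  by rewrite -mulrA -exprS prednK // mulrC.
pose H1 := P *+ r + ('X * (P^`() + Q)) *+ n.
have dG : (P * u ^+ d) *+ r + ('X * (P * u ^+ d)^`()) *+ n = u ^+ d * H1.
  rewrite derivM dP /H1 [RHS]mulrDr !mulrnAr [P * _]mulrC.
  by congr (_ + _ *+ _); rewrite mulrCA.
have sH1 : (size H1 <= (size (Lp k L)).+1)%N.
  have sP : size P = (size (Lp k L)).+1 by rewrite /P /rprod size_prod_XsubC.
  have sQ : (size (P^`() + Q)%R <= size (Lp k L))%N.
    rewrite (leq_trans (size_polyD _ _)) // geq_max size_deriv sP leqnn /=.
    rewrite /Q; case: (posnP d) => [->|d0]; first by rewrite mulr0n size_poly0.
    have ke : (k < e)%N by move: d0; rewrite subn_gt0 => /ltnW.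
    rewrite -scaler_nat (leq_trans (size_scale_leq _ _)) //.
    by rewrite /rprod size_prod_XsubC sLp ke addn1.
  rewrite (leq_trans (size_polyD _ _)) // geq_max; apply/andP; split.
    by rewrite -scaler_nat (leq_trans (size_scale_leq _ _)) // sP.
  rewrite -scaler_nat (leq_trans (size_scale_leq _ _)) //.
  by rewrite (leq_trans (size_polyMleq _ _)) // size_polyX.
(* the function to which Rolle is applied; its critical points in (0, 1) that are
   not roots of it are roots of H1 *)
pose Psi : {poly R} := 'X^r * (P * u ^+ d) ^+ n.
have XdPsi : 'X * Psi^`() = 'X^r * (P * u ^+ d) ^+ n.-1 * (u ^+ d * H1).
  rewrite -dG /Psi; set W := P * u ^+ d.
  have En : W ^+ n = W ^+ n.-1 * W by rewrite -exprSr prednK.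
  rewrite derivM derivXn deriv_exp mulrDr [RHS]mulrDr; congr (_ + _).
    rewrite En mulrnAl !mulrnAr; case: (r) => [|r']; first by rewrite !mulr0n.
    by rewrite exprS !mulrA.
  rewrite !mulrnAr mulrCA -[in RHS]mulrA; congr (_ * _ *+ _).
  by rewrite [W^`() * _]mulrC mulrCA.
have rootPsi x : x \in Lp k L -> root Psi x.
  move=> xL; have /rootP Px : root P x by rewrite /P /rprod root_prod_XsubC.
  by apply/rootP; rewrite /Psi hornerM !horner_exp hornerM Px mul0r expr0n gtn_eqF ?mulr0.
have rolled x : 0 < x < 1 -> x \notin Lp k L -> root Psi^`() x -> root H1 x.
  move=> /andP[x0 x1] xL /rootP rx.
  have := congr1 (fun p => p.[x]) XdPsi; rewrite hornerM rx mulr0 => /esym/eqP.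
  rewrite !hornerM !horner_exp hornerM horner_exp hornerX hornerXsubC !mulf_eq0.
  have -> : (x ^+ r == 0) = false by rewrite expf_eq0 (gt_eqF x0) andbF.
  have u0 : (x - 1 == 0) = false by rewrite subr_eq0 lt_eqF.
  have P0 : (P.[x] == 0) = false.
    by rewrite -[_ == _]/(root P x) /P /rprod root_prod_XsubC (negPf xL).
  by rewrite !expf_eq0 mulf_eq0 P0 !expf_eq0 u0 !andbF.
(* enough roots determine the polynomial *)
have conclude r2 c2 H2 (L2 : seq R) : (r2 < n)%N -> (n * c2 = k.+1 + r2)%N ->
    (size L2 + c2 = minn e k.+1)%N -> sorted <%R L2 ->
    all (fun x => (0 < x) && (x < 1)) L2 -> all (root H2) L2 ->
    (size H2 <= (size L2).+1)%N ->
    (('X^n - 1%:P : {poly R}) ^+ e)^`(k.+1) =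
      a *: ('X^r2 * ((u ^+ d * H2) \Po 'X^n)) ->
  exists r c (a : R) (L : seq R), [/\ (r < n)%N /\ (n * c = k.+1 + r)%N, a != 0,
    (size L + c = minn e k.+1)%N,
    sorted <%R L /\ all (fun x => (0 < x) && (x < 1)) L &
    (('X^n - 1%:P : {poly R}) ^+ e)^`(k.+1) =
      a *: ('X^r * ((rprod L * u ^+ (e - k.+1)) \Po 'X^n))].
  move=> rn2 Ec2 sL2 so2 L201 rL2 sH2 EF2.
  have H20 : H2 != 0.
    have : (('X^n - 1%:P : {poly R}) ^+ e)^`(k.+1) != 0.
      by rewrite -size_poly_eq0 size_binomial_power -lt0n subn_gt0 ltnS ltnW.
    by apply: contraNneq => H20; rewrite EF2 H20 mulr0 comp_poly0 mulr0 scaler0.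
  have uL2 : uniq L2 by apply: sorted_uniq so2; [apply: lt_trans | apply: ltxx].
  have sH : size H2 = (size L2).+1.
    by apply/eqP; rewrite eqn_leq sH2 max_poly_roots.
  have EH := all_roots_prod_XsubC sH rL2; rewrite uniq_rootsE in EH.
  exists r2, c2, (a * lead_coef H2), L2; split=> //.
    by rewrite mulf_neq0 // lead_coef_eq0.
  rewrite EF2 {1}(EH uL2) -scalerAr comp_polyZ -scalerAr scalerA.
  by rewrite [u ^+ d * _]mulrC.
have n1 : (n.-1 < n)%N by rewrite prednK.
have DF : (('X^n - 1%:P : {poly R}) ^+ e)^`(k.+1) =
   a *: ('X^(r.-1) *+ r * ((P * u ^+ d) \Po 'X^n) +
         'X^r * (((P * u ^+ d)^`() \Po 'X^n) * 'X^(n.-1) *+ n)).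
  rewrite derivnS EF derivZ derivM derivXn deriv_comp derivXn.
  by rewrite mulrnAr.
(* if [r = 0] then [0] is not a root of [Psi], and a factor [w] can be taken out *)
case: r => [|r] in rn Ec EF H1 dG sH1 Psi XdPsi rootPsi rolled DF *.
  have dG' : (P * u ^+ d)^`() *+ n = u ^+ d * ((P^`() + Q) *+ n).
    by rewrite derivM dP mulrnAr.
  rewrite expr0 mulr0n mul0r add0r mul1r in DF.
  have c_lt : (c < e)%N by rewrite -(ltn_pmul2l n0) Ec addn0; apply: ltn_trans ltk.
  have : (0 < size (Lp k L))%N by rewrite sLp; move: sL; lia.
  case EL : (Lp k L) => [//|x s] _.
  have [||L' [sL' soL' rL' inL']] := @rolle_path R Psi x s.
  - by rewrite EL in soLp.
  - by apply/allP => y; rewrite -EL; apply: rootPsi.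
  have L'01 : all (fun x => (0 < x) && (x < 1)) L'.
    apply/allP => y /(allP inL') /andP[/andP[xy yl] _].
    have /andP[x0 _] : 0 < x <= 1 by apply: Lp01; rewrite EL mem_head.
    have /andP[_ l1] : 0 < last x s <= 1 by apply: Lp01; rewrite EL mem_last.
    by rewrite (lt_trans x0 xy) (lt_le_trans yl l1).
  apply: (conclude n.-1 c.+1 ((P^`() + Q) *+ n) L') => //.
  - by rewrite mulnSr Ec; lia.
  - by rewrite sL'; have := sLp; rewrite EL /=; move: sL; lia.
  - apply/allP => y yL'; have /andP[y0 y1] := allP L'01 y yL'.
    have : root H1 y.
      apply: rolled; rewrite ?y0 ?y1 //; last exact: (allP rL').
      by have /andP[_] := allP inL' y yL'; rewrite EL.
    rewrite /H1 mulr0n add0r -mulrnAr rootM => /orP[|//].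
    by rewrite rootX (gt_eqF y0).
  - rewrite sL' -scaler_nat (leq_trans (size_scale_leq _ _)) //.
    have sP : size P = (size (Lp k L)).+1 by rewrite /P /rprod size_prod_XsubC.
    rewrite (leq_trans (size_polyD _ _)) // geq_max size_deriv sP EL leqnn /=.
    rewrite /Q; case: (posnP d) => [->|d0]; first by rewrite mulr0n size_poly0.
    have ke : (k < e)%N by move: d0; rewrite subn_gt0 => /ltnW.
    rewrite -scaler_nat (leq_trans (size_scale_leq _ _)) //.
    rewrite /rprod size_prod_XsubC; have := sLp; rewrite EL ke addn1 /=; lia.
  - by rewrite DF -dG' (raddfMn (comp_poly 'X^n)) /= mulrnAr
      [X in _ *: (X *+ n) = _]mulrC.
have x0L : path <%R 0 (Lp k L).
  rewrite path_sortedE ?soLp ?andbT; last exact: lt_trans.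
  by apply/allP => y /Lp01 /andP[].
have [|L' [sL' soL' rL' inL']] := @rolle_path R Psi 0 (Lp k L) x0L.
  rewrite /=; apply/andP; split; last by apply/allP => y; apply: rootPsi.
  by rewrite /Psi exprS -mulrA rootM rootX eqxx.
have L'01 : all (fun x => (0 < x) && (x < 1)) L'.
  apply/allP => y /(allP inL') /andP[/andP[-> yl] _] /=.
  apply: (lt_le_trans yl); have := mem_last 0 (Lp k L).
  by rewrite inE => /orP[/eqP->|/Lp01/andP[]].
apply: (conclude r c H1 L') => //.
- exact: ltnW.
- by rewrite Ec; lia.
- by rewrite sL' sLp; move: sL; lia.
- apply/allP => y yL'; have /andP[y0 y1] := allP L'01 y yL'.
  apply: rolled; rewrite ?y0 ?y1 //; last exact: (allP rL').
  by have /andP[_] := allP inL' y yL'; rewrite inE negb_or => /andP[].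
- by rewrite sL'.
rewrite DF -dG comp_polyD !(raddfMn (comp_poly 'X^n)) /=.
rewrite [('X * _) \Po _]comp_polyM comp_polyX; congr (_ *: _).
rewrite mulrDr !mulrnAr mulrnAl; congr (_ + _ *+ _).
set D := _ \Po _; rewrite exprSr -mulrA; congr (_ * _).
by rewrite mulrCA mulrC -exprS prednK.
Qed.

End BinomialPower.

Lemma nth_roots (K : numClosedFieldType) n (B : K) : (0 < n)%N -> B != 0 ->
  exists s, [/\ uniq s, size s = n & 'X^n - B%:P = \prod_(w <- s) ('X - w%:P)].
Proof.
move=> n0 B0; have [w wP] := prim_root_exists K n0.
have [rho /rootP] : exists rho, root ('X^n - B%:P) rho.
  by apply/closed_rootP; rewrite size_XnsubC // eqSS -lt0n.
rewrite !hornerE => /eqP; rewrite subr_eq0 => /eqP rhoB.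
have rho0 : rho != 0.
  by apply: contraNneq B0 => r0; rewrite -rhoB r0 expr0n gtn_eqF.
pose s := [seq rho * w ^+ i | i <- iota 0 n].
have us : uniq s.
  rewrite map_inj_in_uniq ?iota_uniq // => i j; rewrite !mem_iota /= !add0n.
  move=> li lj /(mulfI rho0)/eqP; rewrite (eq_prim_root_expr wP).
  by rewrite !modn_small // => /eqP.
have ss : size s = n by rewrite size_map size_iota.
exists s; split=> //.
rewrite [LHS](@all_roots_prod_XsubC _ _ s) ?uniq_rootsE ?ss ?size_XnsubC //.
  by rewrite (monicP (monicXnsubC _ n0)) scale1r.
apply/allP => _ /mapP[i _ ->]; apply/rootP; rewrite !hornerE exprMn rhoB.
by rewrite exprAC (prim_expr_order wP) expr1n mulr1 subrr.
Qed.

Lemma derivn_comp_scale (K : comNzRingType) (p : {poly K}) (b : K) k :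
  (p \Po (b *: 'X))^`(k) = b ^+ k *: (p^`(k) \Po (b *: 'X)).
Proof.
elim: k => [|k IH]; first by rewrite scale1r !derivn0.
rewrite derivnS IH derivZ deriv_comp derivZ derivX alg_polyC mulrC mul_polyC.
by rewrite scalerA -exprSr -derivnS.
Qed.

(** The shape of the derivatives of the powers of a binomial over [K]: the roots
    that are neither zero nor roots of the binomial are simple, and their number
    is prescribed. It is a property of [K] because its proof goes through the
    order of a real subfield, while its consequences are purely algebraic. *)
Definition binomial_derivs_split (K : numClosedFieldType) : Prop :=
  forall n e k (a : K), (0 < n)%N -> a != 0 -> (k < n * e)%N ->
  exists r c (b : K) (W Z : seq K),
    [/\ [/\ (r < n)%N, (n * c = k + r)%N & b != 0],
        uniq W /\ (size W + n * c = n * minn e k)%N,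
        {in W, forall w, w != 0 /\ w ^+ n != a ^+ n},
        {in Z, forall w, w ^+ n = a ^+ n} /\ ((e <= k)%N -> Z = [::]) &
        (('X^n - (a ^+ n)%:P) ^+ e)^`(k) =
          b *: \prod_(w <- nseq r 0 ++ W ++ Z) ('X - w%:P)].

Section ComplexBinomialPower.
Variable R : rcfType.
Local Notation C := R[i].

(** The scaling [z -> z / a] reduces to [X^n - 1], whose derivatives have real
    coefficients; a root [x] of the polynomial in [w = z^n] then yields the [n]
    roots of [z^n = x a^n]. *)
Lemma complex_binomial_derivs_split : binomial_derivs_split C.
Proof.
move=> n e k a n0 a0 ltk.
have [r [c [b [L [[rn Ec] b0 sL [soL L01] EF]]]]] :=
  deriv_binomial_power_real R n0 ltk.
pose A := a ^+ n; have A0 : A != 0 by rewrite expf_neq0.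
pose phi := real_complex R.
have uL : uniq L by apply: sorted_uniq soL; [apply: lt_trans | apply: ltxx].
(* the n-th roots of x A, for x in L *)
have rt_ex (x : R) : exists s : seq C, x != 0 ->
   [/\ uniq s, size s = n & 'X^n - (phi x * A)%:P = \prod_(w <- s) ('X - w%:P)].
  have [->|x0] := eqVneq x 0; first by exists [::].
  have [|s ?] := @nth_roots C n (phi x * A) n0; last by exists s.
  by rewrite mulf_neq0 // fmorph_eq0.
have [rt rtP] := choice rt_ex.
have L0 x : x \in L -> x != 0 by move/(allP L01) => /andP[/gt_eqF ->].
have rt_pow x w : x \in L -> w \in rt x -> w ^+ n = phi x * A.
  move=> /L0/rtP[_ _ E]; rewrite -root_prod_XsubC -E => /rootP.
  by rewrite !hornerE => /eqP; rewrite subr_eq0 => /eqP.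
pose W := flatten [seq rt x | x <- L].
have WP w : w \in W -> exists2 x, x \in L & w \in rt x.
  by move/flattenP => [s /mapP[x xL ->] ws]; exists x.
have [z1 [uz1 sz1 Ez1]] := nth_roots n0 A0.
pose Z := flatten (nseq (e - k) z1).
have ZP w : w \in Z -> w ^+ n = A.
  move/flattenP => [s /nseqP[-> _]]; rewrite -root_prod_XsubC -Ez1 => /rootP.
  by rewrite !hornerE => /eqP; rewrite subr_eq0 => /eqP.
have prodW : \prod_(w <- W) ('X - w%:P) = \prod_(x <- L) ('X^n - (phi x * A)%:P).
  rewrite /W big_flatten big_map /=; apply: eq_big_seq => x xL.
  by have [_ _ ->] := rtP x (L0 x xL).
have prodZ : \prod_(w <- Z) ('X - w%:P) = ('X^n - A%:P) ^+ (e - k).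
  rewrite /Z; elim: (e - k)%N => [|m IH]; first by rewrite big_nil.
  by rewrite /= big_cat IH -Ez1 exprS.
pose B := a^-1; have B0 : B != 0 by rewrite invr_eq0.
pose T p := (map_poly phi p \Po 'X^n) \Po (B *: 'X).
have TM p q : T (p * q) = T p * T q by rewrite /T rmorphM /= !comp_polyM.
have T1 : T 1 = 1 by rewrite /T rmorph1 !comp_polyC.
have TX x : T ('X - x%:P) = B ^+ n *: ('X^n - (phi x * A)%:P).
  rewrite /T map_polyXsubC !(comp_polyB, comp_polyX, comp_polyC, comp_Xn_poly).
  rewrite exprZn scalerBr; congr (_ - _); rewrite -mul_polyC -polyCM mulrCA.
  by rewrite -exprMn mulVf // expr1n mulr1.
have TXp x : T ('X - x%:P) %= 'X^n - (phi x * A)%:P.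
  by rewrite TX eqp_scale // expf_neq0.
have Tprod : T ((\prod_(x <- L) ('X - x%:P)) * ('X - 1%:P) ^+ (e - k))
    %= \prod_(w <- W ++ Z) ('X - w%:P).
  rewrite big_cat /= prodW prodZ TM.
  have e1 : T (\prod_(x <- L) ('X - x%:P)) %=
            \prod_(x <- L) ('X^n - (phi x * A)%:P).
    elim: (L) => [|x s IH]; first by rewrite !big_nil T1 eqpxx.
    rewrite !big_cons TM; exact: eqp_trans (eqp_mulr _ (TXp x)) (eqp_mull _ IH).
  have e2 : T (('X - 1%:P) ^+ (e - k)) %= ('X^n - A%:P) ^+ (e - k).
    have := TXp 1; rewrite rmorph1 mul1r => /(eqp_exp (e - k)).
    suff -> : T (('X - 1%:P) ^+ (e - k)) = T ('X - 1%:P) ^+ (e - k) by [].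
    by elim: (e - k)%N => [|m IH]; rewrite ?T1 // !exprS TM IH.
  exact: eqp_trans (eqp_mulr _ e1) (eqp_mull _ e2).
have eqF : ('X^n - A%:P) ^+ e = (A ^+ e) *:
   (map_poly phi (('X^n - 1%:P) ^+ e) \Po (B *: 'X)).
  rewrite (rmorphXn (map_poly phi)) /= rmorphB /= map_polyXn map_polyC /= rmorph1.
  rewrite (rmorphXn (comp_poly (B *: 'X))) /= -exprZn; congr (_ ^+ _).
  rewrite comp_polyB comp_Xn_poly comp_polyC exprZn scalerBr scalerA.
  by rewrite -exprMn mulfV // expr1n scale1r alg_polyC.
have [b' b'0 EF'] : exists2 b' : C, b' != 0 & (('X^n - A%:P) ^+ e)^`(k) =
    b' *: \prod_(w <- nseq r 0 ++ W ++ Z) ('X - w%:P).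
  have /eqpf_eq[b1 b10 E1] := Tprod.
  exists (A ^+ e * B ^+ k * (phi b * B ^+ r * b1)).
    by rewrite !mulf_neq0 ?expf_neq0 // fmorph_eq0.
  rewrite eqF derivnZ derivn_comp_scale derivn_map EF.
  rewrite map_polyZ comp_polyZ rmorphM /= comp_polyM map_polyXn comp_Xn_poly.
  rewrite map_comp_poly map_polyXn -/(T _) E1 exprZn -scalerAl -scalerAr !scalerA.
  rewrite [in RHS]big_cat /=; congr (_ *: (_ * _)); first by rewrite !mulrA.
  by elim: (r) => [|m IH]; rewrite ?big_nil // exprS IH /= big_cons subr0.
exists r, c, b', W, Z; split=> //.
- split.
    suff uflat s : uniq s -> {subset s <= L} ->
        uniq (flatten [seq rt x | x <- s]) by apply: uflat.
    elim: s => //= x s IH /andP[xs us] sub; rewrite cat_uniq IH ?andbT //.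
      have xL : x \in L by apply: sub; rewrite mem_head.
      have [-> _ _] := rtP x (L0 x xL).
      apply/hasPn => w /flattenP[t /mapP[y ys ->] wy].
      have yL : y \in L by apply: sub; rewrite inE ys orbT.
      apply/negP => /(rt_pow x w xL); rewrite (rt_pow y w yL wy) => /(mulIf A0).
      by move=> /fmorph_inj yx; rewrite -yx ys in xs.
    by move=> y ys; apply: sub; rewrite inE ys orbT.
  rewrite -sL mulnDr; congr (_ + _)%N; rewrite /W size_flatten /shape -map_comp.
  rewrite sumnE big_map (eq_big_seq (fun=> n)) => [|x xL].
    by rewrite big_const_seq count_predT iter_addn_0.
  by have [_ /= -> _] := rtP x (L0 x xL).
- move=> w /WP[x xL wx]; have Ew := rt_pow x w xL wx; split.
    apply: contraNneq (L0 x xL) => w0; move: Ew; rewrite w0 expr0n gtn_eqF // => /esym/eqP.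
    by rewrite mulf_eq0 (negPf A0) orbF fmorph_eq0.
  rewrite Ew -[a ^+ n]mul1r (inj_eq (mulIf A0)) -(rmorph1 phi).
  by rewrite (inj_eq (@fmorph_inj _ _ phi)) lt_eqF //; have /andP[] := allP L01 x xL.
- split; first exact: ZP.
  by rewrite -subn_eq0 /Z => /eqP ->.
Qed.

End ComplexBinomialPower.

(** * Roots of a higher derivative in a ball *)

Section Ball.
Variable K : numClosedFieldType.
Implicit Types (c d lam : powser K) (s : seq (powser K)) (Q : nat).

Definition agree Q c d : bool := [forall i : 'I_Q, c i == d i].

Lemma agreeP Q c d : reflect (eqmod Q c d) (agree Q c d).
Proof.
apply: (iffP forallP) => [h i lt|h i]; last by apply/eqP/h.
exact/eqP/(h (Ordinal lt)).
Qed.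

Lemma agreeS Q c d : agree Q.+1 c d = agree Q c d && (c Q == d Q).
Proof.
apply/agreeP/andP => [h|[/agreeP h /eqP hQ] i].
  by split; [apply/agreeP => i lt; apply: h; apply: leqW | apply/eqP/h].
by rewrite ltnS leq_eqVlt => /orP[/eqP->|/h].
Qed.

Lemma agree_sym Q c d : agree Q c d = agree Q d c.
Proof. by apply/agreeP/agreeP => h i /h. Qed.

Lemma agree_trans Q c d e : agree Q c d -> agree Q d e -> agree Q c e.
Proof. by move=> /agreeP h1 /agreeP h2; apply/agreeP/(eqmod_trans h1). Qed.

Lemma agreeW P Q c d : (P <= Q)%N -> agree Q c d -> agree P c d.
Proof. by move=> le /agreeP h; apply/agreeP/(eqmodW le h). Qed.

(** The initial form of [linprod s], up to a constant, on the ball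
    [y = lam + t^Q z] *)
Definition ballpoly Q lam s : {poly K} :=
  \prod_(c <- s | agree Q lam c) ('X - (c Q)%:P).

Lemma ballpolyE Q lam s : ballpoly Q lam s =
  \prod_(x <- [seq c Q | c : powser K <- s & agree Q lam c]) ('X - x%:P).
Proof. by rewrite big_map big_filter. Qed.

Definition ps_cut Q c : powser K := Powser (fun i => if (i < Q)%N then c i else 0).

(** A root inside the ball contributes a linear factor to the initial form, a
    root outside it a constant. *)
Lemma leads_blowup_lin Q lam c : (0 < Q)%N -> lam 0%N = 0 ->
  exists w a, a != 0 /\
    leads (blowup (ps_cut Q lam) Q (ps_var _ - ps_const c)) w
          (if agree Q lam c then 'X - (c Q)%:P else a%:P).
Proof.
move=> Q0 l0; have c0 : ps_cut Q lam 0%N = 0 by rewrite /= Q0.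
have E i : blowup (ps_cut Q lam) Q (ps_var _ - ps_const c) i =
   ((if (i < Q)%N then lam i else 0) - c i)%:P + (if i == Q then 'X else 0).
  rewrite blowup_lin // psD ps_varXM ps_constE; congr (_ + _).
  case: (ltngtP i Q) => [//|lt|->]; last by rewrite subnn.
  by rewrite subn_eq0 leqNgt lt.
case: (boolP (agree Q lam c)) => [/agreeP h|].
  exists Q, 1; split; rewrite ?oner_eq0 //; split=> [i lt|].
    by rewrite E lt h // subrr ltn_eqF // addr0.
  by rewrite E ltnn eqxx sub0r polyCN addrC.
rewrite negb_forall => /existsP/=[i0 ni0].
have ex : exists i, (i < Q)%N && (lam i != c i) by exists i0; rewrite ltn_ord.
case: (ex_minnP ex) => w /andP[wQ nw] wmin.
exists w, (lam w - c w); split; first by rewrite subr_eq0.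
split=> [i lt|].
  have iQ := ltn_trans lt wQ; rewrite E iQ ltn_eqF // addr0.
  suff -> : lam i = c i by rewrite subrr.
  apply/eqP; apply: contraTT lt => ni; rewrite -leqNgt; apply: wmin.
  by rewrite iQ.
by rewrite E wQ ltn_eqF // addr0.
Qed.

Lemma leads_blowup_linprod Q lam s (U : powser2 K) : (0 < Q)%N ->
    lam 0%N = 0 -> U \is a GRing.unit ->
  exists w a, a != 0 /\
    leads (blowup (ps_cut Q lam) Q (U * linprod s)) w (a *: ballpoly Q lam s).
Proof.
move=> Q0 l0 Uu; elim: s => [|c s [w [a [a0 IH]]]].
  exists 0%N, (U 0%N 0%N); split.
    by move: Uu; rewrite !ps_unitE unitfE.
  by rewrite linprod_nil mulr1 /ballpoly big_nil alg_polyC; split; rewrite ?blowup_0.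
have [v [a' [a'0 lc]]] := leads_blowup_lin c Q0 l0.
rewrite linprod_cons mulrCA rmorphM /ballpoly big_cons -/(ballpoly Q lam s) /=.
have := leadsM lc IH; case: ifP => _ h.
  by exists (v + w)%N, a; split=> //; rewrite scalerAr.
by exists (v + w)%N, (a' * a); split; rewrite ?mulf_neq0 // -scalerA -mul_polyC.
Qed.

(** By the chain rule, differentiation in [y] becomes differentiation in [z] of
    the initial form as long as the latter does not vanish. Hence the initial
    form of a series determines, with multiplicities, the coefficients of [t^Q] of
    the roots of its derivatives in the ball. *)
Lemma ballpoly_deriv k Q lam (U V : powser2 K) s s' : (0 < Q)%N ->
    lam 0%N = 0 -> U \is a GRing.unit -> V \is a GRing.unit ->
    iter k derivY (U * linprod s) = V * linprod s' ->
    (ballpoly Q lam s)^`(k) != 0 ->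
  exists2 a, a != 0 & (ballpoly Q lam s)^`(k) = a *: ballpoly Q lam s'.
Proof.
move=> Q0 l0 Uu Vu E F0.
have [w [a [a0 [ew aw]]]] := leads_blowup_linprod s Q0 l0 Uu.
have [v [a' [a'0 lv]]] := leads_blowup_linprod s' Q0 l0 Vu.
have c0 : ps_cut Q lam 0%N = 0 by rewrite /= Q0.
have := blowup_derivYn k (U * linprod s) c0 Q0; rewrite E.
set p := blowup _ _ (U * _) in ew aw *; move=> Ek.
have l1 : leads (iter k (@ps_dz K) p) w (a *: (ballpoly Q lam s)^`(k)).
  split=> [i lt|]; rewrite ps_dzn_coef; first by rewrite ew // linear0.
  by rewrite aw derivnZ.
have := leads_var (Q * k) lv; rewrite -Ek => l2.
have b0 : a' *: ballpoly Q lam s' != 0.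
  by rewrite scaler_eq0 (negPf a'0) monic_neq0 // monic_prod_XsubC.
have b1 : a *: (ballpoly Q lam s)^`(k) != 0 by rewrite scaler_eq0 negb_or a0.
have [_ Ea] := leads_uniq b1 b0 l1 l2.
exists (a^-1 * a'); first by rewrite mulf_neq0 ?invr_eq0.
by rewrite -scalerA -Ea scalerA mulVf // scale1r.
Qed.

Lemma derivn_XsubC_exp (a : K) E k :
  (('X - a%:P) ^+ E)^`(k) = ('X - a%:P) ^+ (E - k) *+ (E ^_ k).
Proof.
elim: k => [|k IH]; first by rewrite subn0 ffactn0.
rewrite derivnS IH derivMn deriv_exp derivXsubC mul1r -mulrnA.
by rewrite subnS ffactnSr mulnC.
Qed.

End Ball.

(** * The arithmetic of a characteristic *)

Section Gcds.
Variable b : seq nat.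
Hypothesis b0_gt0 : (0 < nth 0 b 0)%N.
Let e := egcd_upto b.
Let b0 := nth 0%N b 0.

Lemma egcd_upto0 : e 0 = b0.
Proof. by rewrite /e /egcd_upto big_ord1. Qed.

Lemma egcd_uptoS i : e i.+1 = gcdn (e i) (nth 0%N b i.+1).
Proof. by rewrite /e /egcd_upto big_ord_recr. Qed.

Lemma egcd_upto_dvdS i : (e i.+1 %| e i)%N.
Proof. by rewrite egcd_uptoS dvdn_gcdl. Qed.

Lemma egcd_upto_dvd i j : (i <= j)%N -> (e j %| e i)%N.
Proof.
move=> /subnK <-; elim: (j - i)%N => [|k IH] //.
exact: dvdn_trans (egcd_upto_dvdS _) IH.
Qed.

Lemma egcd_upto_dvd_nth i j : (i <= j)%N -> (e j %| nth 0%N b i)%N.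
Proof.
move=> le; apply: dvdn_trans (egcd_upto_dvd le) _.
by case: i {le} => [|i]; rewrite ?egcd_upto0 // egcd_uptoS dvdn_gcdr.
Qed.

Lemma egcd_upto_dvd0 i : (e i %| b0)%N.
Proof. by rewrite -egcd_upto0 egcd_upto_dvd. Qed.

Lemma egcd_upto_gt0 i : (0 < e i)%N.
Proof.
by apply: dvdn_gt0 (egcd_upto_dvd (leq0n i)); rewrite egcd_upto0.
Qed.

Lemma egcd_upto_divK i : (b0 %/ e i * e i)%N = b0.
Proof. by rewrite divnK // egcd_upto_dvd0. Qed.

Lemma egcd_index_gt0 i : (0 < b0 %/ e i)%N.
Proof. by rewrite divn_gt0 ?egcd_upto_gt0 // dvdn_leq ?egcd_upto_dvd0. Qed.

Lemma egcd_ratioK i : (0 < i)%N -> ((e i.-1 %/ e i) * e i = e i.-1)%N.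
Proof. by case: i => // i _; rewrite divnK // egcd_upto_dvdS. Qed.

Lemma egcd_ratio_gt0 i : (0 < i)%N -> (0 < e i.-1 %/ e i)%N.
Proof.
move=> i0; have := egcd_upto_gt0 i.-1; rewrite -{1}(egcd_ratioK i0) muln_gt0.
by case/andP.
Qed.

Lemma egcd_index_ratio i : (0 < i)%N ->
  (b0 %/ e i = b0 %/ e i.-1 * (e i.-1 %/ e i))%N.
Proof.
move=> i0; apply/eqP; rewrite -(eqn_pmul2r (egcd_upto_gt0 i)).
by rewrite egcd_upto_divK -mulnA egcd_ratioK // egcd_upto_divK.
Qed.

(** By induction on [i], as [e_i] is the greatest common divisor of [e_(i-1)] and
    [b_i]. *)
Lemma eqmod_egcd i (x y : nat) :
    (forall l, (0 < l <= i)%N -> x * nth 0 b l = y * nth 0 b l %[mod b0])%N ->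
  x = y %[mod b0 %/ e i].
Proof.
wlog le : x y / (y <= x)%N.
  move=> IH h; case: (leqP y x) => [/IH|/ltnW/IH h']; first exact.
  by apply/esym/h' => l /h ->.
move=> h; apply/eqP; rewrite eqn_mod_dvd //.
suff : (b0 %| (x - y) * e i)%N.
  by rewrite -{1}(egcd_upto_divK i) dvdn_pmul2r // egcd_upto_gt0.
elim: i h => [|i IH] h; first by rewrite egcd_upto0 dvdn_mull.
rewrite egcd_uptoS muln_gcdr dvdn_gcd IH => [|l /andP[l0 li]].
  have /eqP := h i.+1 (leqnn _); rewrite eqn_mod_dvd ?leq_mul2r ?le ?orbT //.
  by rewrite mulnBl.
by apply: h; rewrite l0 leqW.
Qed.

End Gcds.

(** The residue of [- k] modulo [n], within the natural numbers *)
Definition negmod (k n : nat) := ((n - k %% n) %% n)%N.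

Lemma negmodP k n r c : (r < n)%N -> (n * c = k + r)%N -> r = negmod k n.
Proof.
move=> rn E; have n0 := leq_ltn_trans (leq0n _) rn.
have : ((k %% n + r) %% n = 0)%N by rewrite modnDml -E modnMr.
have kn := ltn_pmod k n0; rewrite /negmod.
case: (posnP (k %% n)%N) => [->|s0].
  by rewrite add0n subn0 modnn modn_small.
case: (ltnP (k %% n + r)%N n) => [lt|le].
  by rewrite modn_small // => /eqP; rewrite addn_eq0 -leqn0 leqNgt s0.
rewrite -{1}(subnK le) modnDr modn_small; last by lia.
by move=> E'; rewrite modn_small; lia.
Qed.

Lemma prod_nth_roots (K : fieldType) n (w a : K) : n.-primitive_root w ->
  a != 0 -> \prod_(0 <= l < n) ('X - (w ^+ l * a)%:P) = 'X^n - (a ^+ n)%:P.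
Proof.
move=> wP a0; have n0 := prim_order_gt0 wP.
pose s := [seq w ^+ l * a | l <- index_iota 0 n].
have ss : size s = n by rewrite size_map size_iota subn0.
have us : uniq s.
  rewrite map_inj_in_uniq ?iota_uniq // => i j; rewrite !mem_iota /= !add0n subn0.
  move=> li lj /(mulIf a0)/eqP; rewrite (eq_prim_root_expr wP).
  by rewrite !modn_small // => /eqP.
rewrite [RHS](@all_roots_prod_XsubC _ _ s) ?uniq_rootsE ?ss ?size_XnsubC //.
  by rewrite (monicP (monicXnsubC _ n0)) scale1r big_map.
apply/allP => _ /mapP[i _ ->]; apply/rootP; rewrite !hornerE exprMn.
by rewrite exprAC (prim_expr_order wP) expr1n mul1r subrr.
Qed.

(** * Polar roots of a series of given characteristic *)

Lemma prod_residue (A : comNzRingType) (G : nat -> A) d x l : (0 < d)%N ->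
  \prod_(l * d <= j < l.+1 * d) (if x == j %[mod d] then G j else 1) =
  G (l * d + x %% d)%N.
Proof.
move=> d0; have rd := ltn_pmod x d0.
rewrite (bigD1_seq (l * d + x %% d)%N) ?iota_uniq //=; last first.
  by rewrite mem_index_iota leq_addr mulSn addnC ltn_add2r.
rewrite modnMDl modn_mod eqxx big_nat_cond big1 ?mulr1 // => j.
move=> /andP[/andP[lj jl] nj]; case: eqP => // E; case/eqP: nj.
rewrite E {1}(divn_eq j d); congr (_ * d + _)%N; apply/eqP.
by rewrite eqn_leq -ltnS ltn_divLR // jl leq_divRL.
Qed.

Lemma sum_count (T : Type) (a : pred T) s : (\sum_(x <- s) a x)%N = count a s.
Proof. by elim: s => [|x s IH]; rewrite ?big_nil // big_cons IH. Qed.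

Section OrbitSize.
Variables (K : numClosedFieldType) (N : nat) (z : K).
Hypothesis zP : N.-primitive_root z.
Implicit Types c : powser K.

Lemma orbit_period c D : (0 < D)%N ->
    (forall i j, (galconj z i c == galconj z j c) = (i == j %[mod D])) ->
  perm_eq (orbit N z c) [seq galconj z j c | j <- iota 0 D].
Proof.
move=> D0 per; apply: uniq_perm; first exact: orbit_uniq.
  rewrite map_inj_in_uniq ?iota_uniq // => i j; rewrite !mem_iota /= !add0n.
  by move=> li lj /eqP; rewrite per !modn_small // => /eqP.
move=> d; apply/(orbitP zP)/mapP => [[j ->]|[j _ ->]]; last by exists j.
exists (j %% D)%N; first by rewrite mem_iota ltn_pmod.
by apply/eqP; rewrite per modn_mod.
Qed.

Lemma size_orbit_period c D : (0 < D)%N ->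
    (forall i j, (galconj z i c == galconj z j c) = (i == j %[mod D])) ->
  size (orbit N z c) = D.
Proof.
by move=> D0 /(orbit_period D0)/perm_size ->; rewrite size_map size_iota.
Qed.

End OrbitSize.

Section Characteristic.
Variable K : numClosedFieldType.
Variables (b : seq nat) (M : nat) (z : K) (alpha : powser K).
Let b0 := nth 0%N b 0.
Let e := egcd_upto b.
Let Q i := (M * nth 0 b i)%N.
Hypothesis zP : (b0 * M).-primitive_root z.
Hypothesis sb : (0 < size b)%N.
Hypothesis supp : forall m, alpha m != 0 -> (M %| m)%N.
Hypothesis jump : forall i, (i.+1 < size b)%N ->
  [/\ ~~ (e i %| nth 0%N b i.+1)%N, alpha (Q i.+1) != 0 &
   forall m, alpha (M * m)%N != 0 -> ~~ (e i %| m)%N -> (nth 0%N b i.+1 <= m)%N].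
Hypothesis elast : e (size b).-1 = 1%N.
Local Notation conj := (galconj z).

Let b0_gt0 : (0 < b0)%N.
Proof. by have := prim_order_gt0 zP; rewrite muln_gt0 => /andP[]. Qed.
Let M_gt0 : (0 < M)%N.
Proof. by have := prim_order_gt0 zP; rewrite muln_gt0 => /andP[]. Qed.

(** The coefficients of a series at the first [i] characteristic exponents tell
    its conjugates apart up to a subgroup of index [b0 / e_i] of the Galois
    group. *)
Lemma eqmod_jumps (c : powser K) i x y :
    (forall l, (0 < l <= i)%N -> c (Q l) != 0) ->
    (forall l, (0 < l <= i)%N -> conj x c (Q l) = conj y c (Q l)) ->
  x = y %[mod b0 %/ e i].
Proof.
move=> c0 exy; apply: eqmod_egcd => // l li; have := exy l li.
rewrite !conjE => /(mulIf (c0 l li))/eqP; rewrite (eq_prim_root_expr zP) /Q.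
rewrite ![(_ * (M * _))%N]mulnCA [(b0 * M)%N]mulnC -!muln_modr eqn_pmul2l //.
by move/eqP.
Qed.

(** Conversely, that subgroup fixes the powers of [t] with exponents divisible by
    [M e_i]. *)
Lemma conj_dvd i (x y : nat) m : (M * e i %| m)%N -> x = y %[mod b0 %/ e i] ->
  z ^+ (x * m) = z ^+ (y * m).
Proof.
move=> /dvdnP[l ->] exy; apply/eqP; rewrite (eq_prim_root_expr zP).
rewrite -[b0 in (b0 * M)%N](egcd_upto_divK b i) -/e.
have E (w : nat) : (w * (l * (M * e i)) = l * (w * (M * e i)))%N by rewrite mulnCA.
rewrite !E -modnMmr -[X in _ == X]modnMmr -mulnA [(e i * M)%N]mulnC.
by rewrite -!muln_modl exy.
Qed.

Lemma jump_incr i : (0 < i)%N -> (i.+1 < size b)%N ->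
  (nth 0 b i < nth 0 b i.+1)%N.
Proof.
case: i => // i _ lt; have [n1 a1 _] := jump lt; have [_ _ min] := jump (ltnW lt).
have n2 : ~~ (e i %| nth 0%N b i.+2)%N.
  by apply: contra n1; apply: dvdn_trans; apply: egcd_upto_dvdS.
rewrite ltn_neqAle (min _ a1 n2) andbT; apply: contraNneq n1 => <-.
exact: egcd_upto_dvd_nth.
Qed.

Lemma jump_mono i j : (0 < i)%N -> (i <= j < size b)%N ->
  (nth 0 b i <= nth 0 b j)%N.
Proof.
move=> i0 /andP[ij]; rewrite -(subnK ij); elim: (j - i)%N => [|l IH] // lt.
apply: leq_trans (IH (ltnW lt)) (ltnW _); apply: jump_incr => //.
by rewrite addn_gt0 i0 orbT.
Qed.

Lemma jump_smono i j : (0 < i)%N -> (i < j < size b)%N ->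
  (nth 0 b i < nth 0 b j)%N.
Proof.
move=> i0 /andP[ij jb]; apply: leq_trans (jump_mono _ (_ : i.+1 <= j < _)%N) => //.
  by apply: jump_incr => //; apply: leq_ltn_trans ij jb.
by rewrite ij.
Qed.

Lemma jump_gt0 i : (0 < i < size b)%N -> (0 < nth 0 b i)%N.
Proof.
case: i => // i /andP[_ lt]; have [n1 _ _] := jump lt.
by rewrite lt0n; apply: contraNneq n1 => ->.
Qed.

Lemma alpha_jump i : (0 < i < size b)%N -> alpha (Q i) != 0.
Proof. by case: i => // i /andP[_ /jump[]]. Qed.

Lemma supp_lt i m : (0 < i < size b)%N -> alpha m != 0 -> (m < Q i)%N ->
  (M * e i.-1 %| m)%N.
Proof.
case: i => // i /andP[_ lt] am; have [_ _ min] := jump lt.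
have /dvdnP[l El] := supp am; rewrite El mulnC in am *.
rewrite /Q ltn_pmul2l // => lt'; rewrite dvdn_pmul2l //.
by apply: contraTT lt' => /(min _ am); rewrite -leqNgt.
Qed.

Lemma supp_le i m : (0 < i < size b)%N -> alpha m != 0 -> (m <= Q i)%N ->
  (M * e i %| m)%N.
Proof.
move=> ib am; rewrite leq_eqVlt => /orP[/eqP->|lt].
  by rewrite /Q dvdn_pmul2l // egcd_upto_dvd_nth.
apply: dvdn_trans (supp_lt ib am lt); rewrite dvdn_pmul2l //.
by apply: egcd_upto_dvd; apply: leq_pred.
Qed.

Lemma supp_last m : alpha m != 0 -> (M * e (size b).-1 %| m)%N.
Proof. by move=> /supp; rewrite elast muln1. Qed.

(** Two conjugates of [alpha] that agree beyond the exponent [b_(i-1) / b0] agree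
    up to [b_i / b0]. *)
Lemma agree_conj i V x y : (0 < i < size b)%N ->
    (forall l, (0 < l < i)%N -> (Q l < V)%N) -> (V <= Q i)%N ->
  agree V (conj x alpha) (conj y alpha) = (x == y %[mod b0 %/ e i.-1]).
Proof.
move=> ib lo hi; apply/agreeP/eqP => [h|h m mV].
  apply: (@eqmod_jumps alpha) => l /andP[l0 li].
    by apply: alpha_jump; lia.
  by apply: h; apply: lo; lia.
rewrite !conjE; have [->|am] := eqVneq (alpha m) 0; first by rewrite !mulr0.
congr (_ * _); apply: conj_dvd h; apply: supp_lt am _ => //.
exact: leq_trans mV hi.
Qed.

Lemma orbit_alpha :
  perm_eq (orbit (b0 * M) z alpha) [seq conj j alpha | j <- iota 0 b0].
Proof.
apply: orbit_period => // x y; apply/eqP/eqP => [E|exy].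
  have -> : b0 = (b0 %/ e (size b).-1)%N by rewrite elast divn1.
  apply: (@eqmod_jumps alpha) => l /andP[l0 li]; last by rewrite E.
  by apply: alpha_jump; rewrite l0; move: li sb; lia.
apply: powserP => m; rewrite !conjE.
have [->|am] := eqVneq (alpha m) 0; first by rewrite !mulr0.
congr (_ * _); apply: conj_dvd (supp_last am) _.
by rewrite elast divn1.
Qed.


Let orb := orbit (b0 * M) z alpha.
Let n i := (e i.-1 %/ e i)%N.

Lemma jump_prim_root i : (0 < i < size b)%N ->
  (n i).-primitive_root (z ^+ (b0 %/ e i.-1 * Q i)).
Proof.
case: i => // i /andP[_ ib]; have := exp_prim_root zP (b0 %/ e i * Q i.+1).
have Eb : (b0 * M = (b0 %/ e i * M) * e i)%N.
  by rewrite mulnAC egcd_upto_divK.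
have -> : (gcdn (b0 %/ e i * Q i.+1) (b0 * M) = (b0 %/ e i * M) * e i.+1)%N.
  by rewrite Eb mulnA -muln_gcdr gcdnC -egcd_uptoS.
by rewrite Eb divnMl // muln_gt0 M_gt0 andbT egcd_index_gt0.
Qed.

(** The roots of [f] in a ball at the level [b_i / b0] are [e_(i-1)] in number.
    Their coefficients of [t^(Q i)] differ by [n_i]-th roots of unity, each of
    which is attained [e_i] times. *)
Lemma ballpoly_alpha i x : (0 < i < size b)%N ->
  ballpoly (Q i) (conj x alpha) orb =
  ('X^(n i) - (conj x alpha (Q i) ^+ n i)%:P) ^+ e i.
Proof.
move=> ib; have [i0 _] := andP ib; set d := (b0 %/ e i.-1)%N.
have d0 : (0 < d)%N by apply: egcd_index_gt0.
have etaP := jump_prim_root ib; rewrite -/d in etaP; set eta := z ^+ _ in etaP.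
pose r := (x %% d)%N; pose a := conj r alpha (Q i).
have a0 : a != 0.
  by rewrite /a conjE mulf_neq0 ?alpha_jump // expf_neq0 // (prim_root_neq0 zP).
have conjQ l : conj (l * d + r) alpha (Q i) = eta ^+ l * a.
  rewrite /a !conjE mulnDl exprD mulrA; congr (_ * _ * _).
  by rewrite -mulnA mulnC exprM.
have -> : conj x alpha (Q i) ^+ n i = a ^+ n i.
  rewrite (divn_eq x d) conjQ exprMn exprAC (prim_expr_order etaP) expr1n.
  exact: mul1r.
rewrite /ballpoly (perm_big _ (orbit_alpha)) big_map.
under eq_bigl => j.
  rewrite (agree_conj _ _ ib) //; last first.
    by move=> l /andP[l0 li]; rewrite /Q ltn_pmul2l // jump_smono // li; case/andP: ib.
  over.
have Ed : b0 = (e i.-1 * d)%N by rewrite mulnC egcd_upto_divK.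
have Ee : e i.-1 = (e i * n i)%N by rewrite mulnC egcd_ratioK.
rewrite -/d -[b0 in iota _ b0]subn0 -/(index_iota 0 b0) Ed big_mkcond big_nat_mul.
have inner l : \prod_(l * d <= j < l.+1 * d)
    (if x == j %[mod d] then 'X - (conj j alpha (Q i))%:P else 1) =
    'X - (eta ^+ l * a)%:P.
  by rewrite -conjQ (prod_residue (fun j => 'X - (conj j alpha (Q i))%:P)).
under eq_bigr do rewrite inner.
rewrite Ee big_nat_mul.
have block l : \prod_(l * n i <= j < l.+1 * n i) ('X - (eta ^+ j * a)%:P) =
    'X^(n i) - (a ^+ n i)%:P.
  rewrite -(prod_nth_roots etaP a0) -{1}[(l * n i)%N]add0n big_addn.
  rewrite mulSn addnK; apply: eq_bigr => j _; rewrite exprD mulnC exprM.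
  by rewrite (prim_expr_order etaP) expr1n mulr1.
under eq_bigr do rewrite block.
by rewrite prodr_const_nat subn0.
Qed.

Section Polar.
Variables (k : nat) (U V : powser2 K) (sg : seq (powser K)).
Hypothesis splitK : binomial_derivs_split K.
Hypothesis alpha0 : alpha 0%N = 0.
Hypotheses (Uu : U \is a GRing.unit) (Vu : V \is a GRing.unit).
Hypothesis polar : iter k derivY (U * linprod orb) = V * linprod sg.
Hypothesis sg0 : positive sg.
Implicit Types c : powser K.

Let conj0 x : conj x alpha 0%N = 0. Proof. by rewrite conj_00. Qed.

Let Q_gt0 i : (0 < i < size b)%N -> (0 < Q i)%N.
Proof. by move=> ib; rewrite muln_gt0 M_gt0 jump_gt0. Qed.

Lemma mem_orb x : conj x alpha \in orb.
Proof. by apply/(orbitP zP); exists x. Qed.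

(** Hence the roots of the derivative in such a ball are described by the
    derivative of a power of a binomial. *)
Lemma polar_ball i x (a := conj x alpha (Q i)) : (0 < i < size b)%N ->
    (k < e i.-1)%N ->
  exists l (W Z : seq K),
    [/\ (n i * l = k + negmod k (n i))%N,
        uniq W /\ (size W + n i * l = n i * minn (e i) k)%N,
        {in W, forall w, w != 0 /\ w ^+ n i != a ^+ n i},
        {in Z, forall w, w ^+ n i = a ^+ n i} /\ ((e i <= k)%N -> Z = [::]) &
        perm_eq [seq c (Q i) | c : powser K <- sg & agree (Q i) (conj x alpha) c]
                (nseq (negmod k (n i)) 0 ++ W ++ Z)].
Proof.
move=> ib ki; have [i0 _] := andP ib.
have a0 : a != 0.
  by rewrite /a conjE mulf_neq0 ?alpha_jump // expf_neq0 // (prim_root_neq0 zP).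
have ni : (0 < n i)%N by apply: egcd_ratio_gt0.
have kn : (k < n i * e i)%N by rewrite egcd_ratioK.
have [r [l [a1 [W [Z [[rn El a10] HW W0 HZ EF]]]]]] :=
  splitK ni a0 kn.
have Er := negmodP rn El; rewrite Er in El EF.
exists l, W, Z; split=> //.
rewrite -ballpoly_alpha // in EF.
have F0 : (ballpoly (Q i) (conj x alpha) orb)^`(k) != 0.
  by rewrite EF scaler_eq0 (negPf a10) monic_neq0 // monic_prod_XsubC.
have [a2 a20 E2] :=
  ballpoly_deriv (Q_gt0 ib) (conj0 x) Uu Vu polar F0.
apply: prod_XsubC_eq; rewrite -ballpolyE.
have Elead : a1 = a2.
  have := congr1 lead_coef EF; rewrite E2 !lead_coefZ.
  by rewrite !(monicP (monic_prod_XsubC _ _ _)) !mulr1 => ->.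
by apply: (scalerI a10); rewrite -EF E2 Elead.
Qed.

(** [Q i] is the largest order of the differences between [c] and the conjugates
    of [alpha]. *)
Definition contact_at i c :=
  has (fun d => agree (Q i) d c) orb && ~~ has (fun d => agree (Q i).+1 d c) orb.

Lemma root_ballpoly_orb i x c : agree (Q i) (conj x alpha) c ->
  root (ballpoly (Q i) (conj x alpha) orb) (c (Q i)) =
  has (fun d => agree (Q i).+1 d c) orb.
Proof.
move=> ag; rewrite ballpolyE root_prod_XsubC; apply/mapP/hasP.
  move=> [d]; rewrite mem_filter => /andP[agd dorb] E; exists d => //.
  by rewrite agreeS -E eqxx andbT (agree_trans _ ag) // agree_sym.
move=> [d dorb]; rewrite agreeS => /andP[agd /eqP E]; exists d => //.
by rewrite mem_filter dorb andbT (agree_trans ag) // agree_sym.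
Qed.

Lemma contact_ball i x c : (0 < i < size b)%N ->
    agree (Q i) (conj x alpha) c ->
  contact_at i c = (c (Q i) ^+ n i != conj x alpha (Q i) ^+ n i).
Proof.
move=> ib ag; have -> : contact_at i c = ~~ has (fun d => agree (Q i).+1 d c) orb.
  rewrite /contact_at; case: hasP => // -[]; exists (conj x alpha) => //.
  exact: mem_orb.
rewrite -(root_ballpoly_orb ag) ballpoly_alpha // rootE horner_exp !hornerE.
by rewrite expf_eq0 egcd_upto_gt0 //= subr_eq0.
Qed.

(** Strictly between two characteristic exponents all the [e_(i-1)] roots of [f] in
    a ball have the same coefficient. The initial form is the power of a linear
    form, with exponent greater than [k]; so is its derivative, up to the exponent,
    and the roots of the derivative of [f] in the ball have that coefficient
    too. *)
Lemma agree_step i v x c : c \in sg -> (0 < i < size b)%N -> (k < e i.-1)%N ->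
    (forall l, (0 < l < i)%N -> (Q l < v)%N) -> (0 < v < Q i)%N ->
  agree v (conj x alpha) c -> agree v.+1 (conj x alpha) c.
Proof.
move=> csg ib ki lo /andP[v0 vQ] ag; have [i0 _] := andP ib.
pose lam := conj x alpha.
have balls d : d \in orb -> agree v lam d = agree (Q i) lam d.
  move=> /(orbitP zP)[j ->]; rewrite /lam !(agree_conj _ _ ib) //; last exact: ltnW.
  by move=> l /lo lt; apply: ltn_trans lt vQ.
have F1 : ballpoly v lam orb =
    ('X - (lam v)%:P) ^+ size [seq d <- orb | agree (Q i) lam d].
  rewrite /ballpoly -big_filter (eq_in_filter balls).
  have h d : d \in [seq d <- orb | agree (Q i) lam d] -> d v = lam v.
    by rewrite mem_filter => /andP[/agreeP h _]; rewrite h.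
  elim: [seq d <- _ | _] h => [|d s IH] h; first by rewrite big_nil.
  rewrite big_cons IH ?exprS => [|d' d's]; first by rewrite h ?mem_head.
  by apply: h; rewrite inE d's orbT.
have sE : size [seq d <- orb | agree (Q i) lam d] = e i.-1.
  have := congr1 (size : {poly K} -> nat) (ballpoly_alpha x ib).
  rewrite ballpolyE size_prod_XsubC size_map => E.
  have := size_exp ('X^(n i) - (lam (Q i) ^+ n i)%:P) (e i).
  rewrite -E size_XnsubC ?egcd_ratio_gt0 //= => ->.
  by rewrite egcd_ratioK.
rewrite sE in F1.
have EF : (ballpoly v lam orb)^`(k) = ('X - (lam v)%:P) ^+ (e i.-1 - k) *+ (e i.-1 ^_ k).
  by rewrite F1 derivn_XsubC_exp.
have F0 : (ballpoly v lam orb)^`(k) != 0.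
  rewrite EF -scaler_nat scaler_eq0 negb_or pnatr_eq0 -lt0n ffact_gt0 (ltnW ki).
  by rewrite monic_neq0 // monic_exp // monicXsubC.
have [a a0 E2] := ballpoly_deriv v0 (conj0 x) Uu Vu polar F0.
have : root (ballpoly v lam orb)^`(k) (c v).
  rewrite E2 rootZ // ballpolyE root_prod_XsubC; apply/mapP; exists c => //.
  by rewrite mem_filter ag.
rewrite EF -scaler_nat rootZ ?pnatr_eq0 -?lt0n ?ffact_gt0 ?(ltnW ki) //.
rewrite -(subnSK ki) root_exp_XsubC => /eqP E.
by rewrite agreeS ag E eqxx.
Qed.

Lemma agree_steps i v x c : c \in sg -> (0 < i < size b)%N -> (k < e i.-1)%N ->
    (forall l, (0 < l < i)%N -> (Q l < v)%N) -> (0 < v <= Q i)%N ->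
  agree v (conj x alpha) c -> agree (Q i) (conj x alpha) c.
Proof.
move=> csg ib ki lo /andP[v0 vQ] ag; rewrite -(subnKC vQ).
have : (Q i - v <= Q i - v)%N by [].
elim: {1 3}(Q i - v)%N => [|m IH] le; first by rewrite addn0.
rewrite addnS; apply: (agree_step csg ib ki) (IH (ltnW le)) => [l /lo lt|].
  exact: ltn_addr.
by rewrite ltn_addr //=; lia.
Qed.

(** A root of the derivative can leave the roots of [f] only at a characteristic
    exponent, and does so at the [ik]-th at the latest: as [e_ik <= k], no root of
    the initial form of [f] remains a root of its derivative of order [k]. *)
Lemma contact_exists ik c : (0 < ik < size b)%N -> (e ik <= k < e ik.-1)%N ->
  c \in sg -> exists2 i, (0 < i <= ik)%N & contact_at i c.
Proof.
move=> ikb /andP[kl ku] csg.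
have ke i : (0 < i <= ik)%N -> (k < e i.-1)%N.
  move=> i_ik; apply: leq_trans ku _; apply: dvdn_leq; first exact: egcd_upto_gt0.
  by apply: egcd_upto_dvd; lia.
have steps i : (0 < i <= ik)%N -> (exists2 j, (0 < j <= i)%N & contact_at j c) \/
    exists x, agree (Q i).+1 (conj x alpha) c.
  have close j x : (0 < j <= ik)%N -> agree (Q j) (conj x alpha) c ->
      contact_at j c \/ exists y, agree (Q j).+1 (conj y alpha) c.
    move=> j_ik ag; case: (boolP (contact_at j c)) => h; [by left | right].
    move: h; rewrite /contact_at negb_and negbK => /orP[/hasPn/(_ _ (mem_orb x))|].
      by rewrite ag.
    by move=> /hasP[d /(orbitP zP)[y ->] h]; exists y.
  elim: i => // -[_|i IH] i_ik.
    have [||h|h] := close 1%N 0%N.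
    - lia.
    - apply: (@agree_steps 1 1); rewrite ?ke //.
      + by lia.
      + by move=> l; lia.
      + by rewrite /= (Q_gt0) //; lia.
      + by apply/agreeP => -[|//] _; rewrite conj_00 alpha0 sg0.
    - by left; exists 1%N.
    - by right.
  have [|[j ji cj]|[x ag]] := IH; first by lia.
    by left; exists j => //; lia.
  have ib : (0 < i.+2 < size b)%N by lia.
  have Qlt : (Q i.+1 < Q i.+2)%N by rewrite ltn_pmul2l // jump_incr.
  have ag' : agree (Q i.+2) (conj x alpha) c.
    apply: (@agree_steps _ (Q i.+1).+1); rewrite ?ke ?Qlt //.
    move=> l l_i; rewrite ltnS leq_pmul2l // jump_mono //; lia.
  have [h|h] := close _ _ i_ik ag'; first by left; exists i.+2; rewrite ?leqnn.
  by right.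
have [|h|[x ag]] := steps ik; first by lia.
  by case: h => i h1 h2; exists i.
have [l [W [Z [El _ WP [_ Z0] pe]]]] := polar_ball x ikb ku.
have := perm_mem pe (conj x alpha (Q ik)); rewrite Z0 // cats0 mem_cat.
have -> : conj x alpha (Q ik) \in
    [seq c (Q ik) | c : powser K <- sg & agree (Q ik) (conj x alpha) c].
  apply/mapP; exists c.
    by rewrite mem_filter csg andbT; apply: agreeW ag.
  by move: ag; rewrite agreeS => /andP[_ /eqP].
move=> /esym/orP[/nseqP[E _]|/WP[_]]; last by rewrite eqxx.
have : conj x alpha (Q ik) != 0.
  by rewrite conjE mulf_neq0 ?alpha_jump // expf_neq0 // (prim_root_neq0 zP).
by rewrite E eqxx.
Qed.

(** There are [b0 / e_(i-1)] balls at the level [b_i / b0], which are disjoint and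
    all alike. *)
Lemma count_contact (P : pred K) i m : (0 < i < size b)%N ->
    (forall x, count (fun w => P w && (w ^+ n i != conj x alpha (Q i) ^+ n i))
       [seq c (Q i) | c : powser K <- sg & agree (Q i) (conj x alpha) c] = m) ->
  count (fun c : powser K => contact_at i c && P (c (Q i))) sg =
    (b0 %/ e i.-1 * m)%N.
Proof.
move=> ib cm; have [i0 il] := andP ib; set d := (b0 %/ e i.-1)%N.
have d0 : (0 < d)%N by apply: egcd_index_gt0.
have lo l : (0 < l < i)%N -> (Q l < Q i)%N.
  by move=> /andP[l0 li]; rewrite ltn_pmul2l // jump_smono // li.
have one c : (contact_at i c && P (c (Q i)) =
    \sum_(0 <= j < d) (agree (Q i) (conj j alpha) c &&
       (P (c (Q i)) && (c (Q i) ^+ n i != conj j alpha (Q i) ^+ n i))) :> nat)%N.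
  case: (boolP (has (fun d => agree (Q i) d c) orb)) => [|no]; last first.
    rewrite /contact_at (negPf no) /= big1 // => j _.
    by have /negPf -> := hasPn no _ (mem_orb j).
  move=> /hasP[_ /(orbitP zP)[x ->] ag].
  have agj j : agree (Q i) (conj j alpha) c = (x == j %[mod d]).
    rewrite -(agree_conj x j ib lo (leqnn _)).
    apply/idP/idP => h; first by apply: agree_trans ag _; rewrite agree_sym.
    by apply: agree_trans ag; rewrite agree_sym.
  have xd : (x %% d < d)%N by rewrite ltn_pmod.
  rewrite (bigD1_seq (x %% d)%N) ?iota_uniq ?mem_index_iota //=.
  rewrite big_nat_cond big1 ?addn0 => [|j /andP[/andP[_ jd] nj]].
    have agx : agree (Q i) (conj (x %% d) alpha) c by rewrite agj modn_mod.
    by rewrite agx (contact_ball ib agx) andbC.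
  by rewrite agj (modn_small jd) eq_sym (negPf nj).
rewrite -sum_count; under eq_bigr => c _ do rewrite one.
rewrite exchange_big /= -[RHS](subn0) -[d in RHS]subn0 -sum_nat_const_nat subn0.
apply: eq_bigr => j _; rewrite -(cm j) count_map count_filter.
rewrite -sum_count; apply: eq_bigr => c _ /=.
by congr nat_of_bool; rewrite [RHS]andbC.
Qed.

Lemma count_contact_zero i : (0 < i < size b)%N -> (k < e i.-1)%N ->
  count (fun c : powser K => contact_at i c && (c (Q i) == 0)) sg =
    (b0 %/ e i.-1 * negmod k (n i))%N.
Proof.
move=> ib ki; apply: (count_contact (P := pred1 0)) => // x.
have [l [W [Z [El _ WP [ZP _] /permP ->]]]] := polar_ball x ib ki.
have a0 : conj x alpha (Q i) != 0.
  by rewrite conjE mulf_neq0 ?alpha_jump // expf_neq0 // (prim_root_neq0 zP).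
have ni : (0 < n i)%N by apply: egcd_ratio_gt0; case/andP: ib.
rewrite !count_cat count_nseq /= eqxx expr0n (gtn_eqF ni) eq_sym expf_neq0 //.
rewrite mul1n (eq_in_count (a2 := pred0)) ?count_pred0; last first.
  by move=> w /WP[/negPf /= ->].
rewrite (eq_in_count (a2 := pred0)) ?count_pred0 ?addn0 // => w /ZP /= ->.
by rewrite eqxx andbF.
Qed.

Lemma count_contact_nonzero i l : (0 < i < size b)%N -> (k < e i.-1)%N ->
    (n i * l = k + negmod k (n i))%N ->
  (l <= minn (e i) k)%N /\
  count (fun c : powser K => contact_at i c && (c (Q i) != 0)) sg =
    (b0 %/ e i.-1 * (n i * (minn (e i) k - l)))%N.
Proof.
move=> ib ki El; have ni : (0 < n i)%N by apply: egcd_ratio_gt0; case/andP: ib.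
split.
  have [l' [W [Z [El' [_ sW] _ _ _]]]] := polar_ball 0 ib ki.
  rewrite -(leq_pmul2l ni) El -El' -sW; exact: leq_addl.
apply: (count_contact (P := predC1 0)) => // x.
have [l' [W [Z [El' [_ sW] WP [ZP _] /permP ->]]]] := polar_ball x ib ki.
rewrite !count_cat count_nseq /= eqxx mul0n add0n.
rewrite (eq_in_count (a2 := predT)) ?count_predT; last first.
  by move=> w /WP[/= -> ->].
rewrite (eq_in_count (a2 := pred0)) ?count_pred0 => [|w /ZP /= ->]; last first.
  by rewrite eqxx andbF.
by rewrite addn0 mulnBr El -El' -sW addnK.
Qed.

(** The nonzero roots of the initial form being simple, such a root of the
    derivative is determined by its terms up to the exponent [Q i], hence is
    fixed by the Galois group over the field that they generate. *)
Lemma contact_nonzero_fixed i c : (0 < i < size b)%N -> (k < e i.-1)%N ->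
    (forall x, conj x c \in sg) -> c \in sg -> contact_at i c -> c (Q i) != 0 ->
  conj (b0 %/ e i) c = c.
Proof.
move=> ib ki cj csg ct cQ0; set D := (b0 %/ e i)%N.
have /hasP[_ /(orbitP zP)[x ->] ag] : has (fun d => agree (Q i) d c) orb.
  by case/andP: ct.
have fix_coef m : (M * e i %| m)%N -> conj D c m = c m.
  move=> h; rewrite conjE (conj_dvd h (y := 0%N)) ?mul1r //.
  by rewrite modnn mod0n.
have agD : agree (Q i) (conj x alpha) (conj D c).
  apply/agreeP => m mQ; have Em := agreeP _ _ _ ag m mQ.
  have [am|am] := eqVneq (alpha m) 0.
    by move: Em; rewrite !conjE am mulr0 => <-; rewrite mulr0.
  by rewrite fix_coef // (supp_le ib am) // ltnW.
have cQ : conj D c (Q i) = c (Q i).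
  by apply: fix_coef; rewrite dvdn_pmul2l // egcd_upto_dvd_nth.
have [l [W [Z [El [uW _] WP [ZP _] pe]]]] := polar_ball x ib ki.
have c1 : count_mem (c (Q i))
    [seq d (Q i) | d : powser K <- sg & agree (Q i) (conj x alpha) d] = 1%N.
  rewrite (permP pe) !count_cat count_nseq /= eq_sym (negPf cQ0) mul0n add0n.
  have nn : c (Q i) ^+ n i != conj x alpha (Q i) ^+ n i by rewrite -contact_ball.
  have nZ : c (Q i) \notin Z by apply/negP => /ZP E; rewrite E eqxx in nn.
  rewrite (count_memPn nZ) addn0 count_uniq_mem //.
  have : c (Q i) \in [seq d (Q i) | d : powser K <- sg & agree (Q i) (conj x alpha) d].
    by apply/mapP; exists c; rewrite // mem_filter ag.
  rewrite (perm_mem pe) !mem_cat (negPf nZ) orbF => /orP[/nseqP[E]|->] //.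
  by rewrite E eqxx in cQ0.
rewrite count_map in c1; set s := [seq d <- sg | _] in c1.
have ins d : d \in sg -> agree (Q i) (conj x alpha) d -> d (Q i) = c (Q i) ->
    d \in [seq d <- s | preim (fun d : powser K => d (Q i)) (pred1 (c (Q i))) d].
  by move=> dsg agd Ed; rewrite mem_filter /= Ed eqxx mem_filter agd.
have := ins _ (cj D) agD cQ; have := ins _ csg ag erefl.
have : size [seq d <- s | preim (fun d : powser K => d (Q i)) (pred1 (c (Q i))) d] = 1%N.
  by rewrite size_filter.
case: [seq _ <- s | _] => [|d [|]] // _; rewrite !mem_seq1 => /eqP -> /eqP ->.
by [].
Qed.

End Polar.

End Characteristic.

(** * Puiseux series as power series in a root of the variable *)

Lemma least_exponentE (S : set rat) q : S q -> (forall r, S r -> q <= r) ->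
  least_exponent S = q%:E.
Proof.
move=> Sq qmin; apply: xget_unique; first by exists q.
move=> _ [r [Sr rmin] <-]; congr (_%:E); apply/eqP.
by rewrite eq_le rmin // qmin.
Qed.

Lemma ordY_isE (K : comNzRingType) (f : powser2 K) m :
  ordY_is f m -> ordY f = m%:R%:E.
Proof.
move=> [fm fm0]; apply: least_exponentE; first by exists m.
move=> _ [j nj <-]; rewrite ler_nat leqNgt; apply/negP => /fm E.
by case/eqP: nj; rewrite E.
Qed.

Lemma natr_neq0 (N : nat) : (0 < N)%N -> N%:R != 0 :> rat.
Proof. by rewrite pnatr_eq0 lt0n. Qed.

Lemma natr_fracE (i j m n : nat) : (0 < m)%N -> (0 < n)%N ->
  (i%:R / m%:R == j%:R / n%:R :> rat) = (i * n == j * m)%N.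
Proof.
by move=> m0 n0; rewrite eqr_div ?natr_neq0 // -!natrM eqr_nat.
Qed.

Section PuiseuxPowser.
Variable K : comNzRingType.
Implicit Types (a : puiseux K) (p : powser K) (N M : nat).

Definition of_t_coef N p (q : rat) : K :=
  if q * N%:R \is a Num.nat then p (Num.truncn (q * N%:R)) else 0.

Lemma of_t_coefE N p m : (0 < N)%N -> of_t_coef N p (m%:R / N%:R) = p m.
Proof.
by move=> N0; rewrite /of_t_coef divfK ?natr_neq0 // natr_nat natrK.
Qed.

Lemma of_t_coef_root N p : (0 < N)%N -> in_root N (of_t_coef N p).
Proof.
move=> N0; split=> // q; rewrite /of_t_coef.
case: ifP => [/natrP[m Em] _|]; last by rewrite eqxx.
by exists m; rewrite -Em mulfK ?natr_neq0.
Qed.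

Fact of_t_subproof N p : of_t_coef N.+1 p \in @puiseux_pred K.
Proof. by apply/asboolP; exists N.+1; apply: of_t_coef_root. Qed.

(** The Puiseux series [p(x^(1/N))], for [N > 0] *)
Definition of_t N p : puiseux K := Puiseux (of_t_subproof N.-1 p).

Lemma of_tE N p m : (0 < N)%N -> of_t N p (m%:R / N%:R) = p m.
Proof. by case: N => // N N0; apply: of_t_coefE. Qed.

Lemma in_root_of_t N p : (0 < N)%N -> in_root N (of_t N p).
Proof. by case: N => // N N0; apply: of_t_coef_root. Qed.

Lemma of_tK N p : (0 < N)%N -> in_t N (of_t N p) = p.
Proof. by move=> N0; apply: powserP => i; apply: of_tE. Qed.

Lemma in_tE N a i : in_t N a i = a (i%:R / N%:R). Proof. by []. Qed.

Lemma in_root_mul N M a : (0 < M)%N -> in_root N a -> in_root (N * M) a.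
Proof.
move=> M0 [N0 aN]; split=> [|q /aN[i ->]]; first by rewrite muln_gt0 N0.
by exists (i * M)%N; apply/eqP; rewrite natr_fracE ?muln_gt0 ?N0 // mulnAC mulnA.
Qed.

Lemma in_t_mul N M a : (0 < M)%N -> in_root N a ->
  in_t (N * M) a = ps_ram M (in_t N a).
Proof.
move=> M0 [N0 aN]; apply: powserP => i; rewrite ps_ramE !in_tE.
have NM : (0 < N * M)%N by rewrite muln_gt0 N0.
case: ifPn => [/dvdnP[m ->]|nd].
  rewrite mulnK //; congr (puiseux_coef a _); apply/eqP.
  by rewrite natr_fracE // mulnA mulnAC.
apply/eqP; apply: contraNT nd => /aN[j /eqP]; rewrite natr_fracE //.
by rewrite mulnCA mulnC eqn_pmul2l // => /eqP ->; rewrite dvdn_mull.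
Qed.

Lemma in_t_neq0 N a q : in_root N a -> a q != 0 ->
  exists m, q = m%:R / N%:R /\ in_t N a m != 0.
Proof. by move=> [N0 aN] aq; have [m Em] := aN _ aq; exists m; rewrite in_tE -Em. Qed.

Lemma puiseux_order_in_t N a w : in_root N a -> eqmod w (in_t N a) 0 ->
  in_t N a w != 0 -> puiseux_order a = (w%:R / N%:R)%:E.
Proof.
move=> aN e nw; have [N0 _] := aN; apply: least_exponentE => // q /= aq.
have [m [-> nm]] := in_t_neq0 aN aq.
rewrite ler_pM2r ?invr_gt0 ?ltr0n // ler_nat leqNgt; apply/negP => /e E.
by rewrite E eqxx in nm.
Qed.

Lemma puiseux_order_gt0 N a : in_root N a ->
  (0 < puiseux_order a)%E <-> in_t N a 0%N = 0.
Proof.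
move=> aN; have [N0 _] := aN.
have [a0|/ps_neq0P[w [nw ew]]] := eqVneq (in_t N a) 0.
  split=> _; first by rewrite a0.
  suff -> : puiseux_order a = +oo%E by [].
  apply: xgetPN => _ [q [/= aq _] _].
  by have [m [_]] := in_t_neq0 aN aq; rewrite a0 eqxx.
rewrite (puiseux_order_in_t aN ew nw) lte_fin; split=> [|a00].
  by case: w nw ew => [|w] nw ew; rewrite ?mul0r ?ltxx // ew.
by case: w nw ew => [|w] nw _; rewrite ?a00 ?eqxx // in nw *; rewrite divr_gt0 ?ltr0n.
Qed.

Lemma in_root_sub N a1 a2 : in_root N a1 -> in_root N a2 -> in_root N (a1 - a2).
Proof.
move=> [N0 h1] [_ h2]; split=> // q; rewrite -[(a1 - a2) q]/(a1 q - a2 q) => nq.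
have [/eqP E|/h1] := boolP (a1 q == 0); last by [].
by apply: h2; apply: contraNneq nq => E'; rewrite E E' subrr.
Qed.

Lemma in_t_sub N a1 a2 : in_t N (a1 - a2) = in_t N a1 - in_t N a2.
Proof. exact: powserP. Qed.

End PuiseuxPowser.

Section Coincidence.
Variable K : numClosedFieldType.
Implicit Types (a : puiseux K).

Lemma coincidenceE N Q a1 a2 : in_root N a1 -> in_root N a2 ->
    agree Q (in_t N a1) (in_t N a2) -> ~~ agree Q.+1 (in_t N a1) (in_t N a2) ->
  coincidence a1 a2 = (Q%:R / N%:R)%:E.
Proof.
move=> h1 h2 /agreeP ag; rewrite agreeS => nag.
apply: puiseux_order_in_t; rewrite ?in_t_sub; first exact: in_root_sub.
  by move=> i lt; rewrite psB ag // subrr.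
rewrite psB subr_eq0; apply: contra nag => ->; rewrite andbT; exact/agreeP.
Qed.

Lemma coincidence_le N Q a1 a2 : in_root N a1 -> in_root N a2 ->
    ~~ agree Q.+1 (in_t N a1) (in_t N a2) ->
  (coincidence a1 a2 <= (Q%:R / N%:R)%:E)%E.
Proof.
move=> h1 h2 nag; have [N0 _] := h1.
have [[|m] nm mmin] := @ex_minnP (fun m => ~~ agree m (in_t N a1) (in_t N a2))
  (ex_intro _ Q.+1 nag).
  by move: nm; rewrite (introT (agreeP _ _ _)).
have mag : agree m (in_t N a1) (in_t N a2).
  by apply: contraT => /mmin; rewrite ltnn.
rewrite (coincidenceE h1 h2 mag nm) lee_fin ler_pM2r ?invr_gt0 ?ltr0n //.
by rewrite ler_nat -ltnS mmin.
Qed.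

End Coincidence.

Section Zeros.
Variable K : numClosedFieldType.
Implicit Types (a : puiseux K) (g u : powser2 K).

Lemma eval_unit (c : powser K) g : g \is a GRing.unit -> ps_eval c g != 0.
Proof.
move=> gu; apply/eqP => E; have := congr1 (ps_eval c) (mulrV gu).
by rewrite rmorphM rmorph1 /= E mul0r => /esym/eqP; rewrite oner_eq0.
Qed.

Lemma Zer_root g a : Zer g a -> exists N, [/\ in_root N a, in_t N a 0%N = 0 &
  ps_eval (in_t N a) (ramify N g) = 0].
Proof.
move=> [s [N [u [N0 uu sP E]]] as_]; have [aN /(puiseux_order_gt0 aN) a0] := sP a as_.
exists N; split=> //; rewrite E rmorphM rmorph_prod (big_rem a as_) /=.
by rewrite ps_eval_lin // subrr mul0r mulr0.
Qed.

Lemma Zer_root_mul g a N M : (0 < M)%N -> in_root N a -> in_t N a 0%N = 0 ->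
    ps_eval (in_t N a) (ramify N g) = 0 ->
  ps_eval (in_t (N * M) a) (ramify (N * M) g) = 0.
Proof.
move=> M0 aN a0 E; have [N0 _] := aN.
by rewrite in_t_mul // -(ramify_ramify _ M0 N0) eval_ramify // E rmorph0.
Qed.

Variables (N : nat) (z : K).
Hypothesis zP : N.-primitive_root z.
Let N0 : (0 < N)%N := prim_order_gt0 zP.

(** The roots of a branch may a priori be given in a field [K((x^(1/N')))] with
    another [N']; comparison in [K[[x^(1/(N N'))]]] brings them back to the
    level [N]. *)
Lemma Zer_minpol u (c : powser K) a : u \is a GRing.unit -> c 0%N = 0 ->
  Zer (u * minpol N z c) a <-> in_root N a /\ in_t N a \in orbit N z c.
Proof.
move=> uu c0; split=> [|[aN aorb]].
  move=> /Zer_root[N' [aN' a0 r]]; have [N'0 _] := aN'.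
  have := Zer_root_mul N0 aN' a0 r.
  rewrite mulnC -(ramify_ramify _ N'0 N0) rmorphM /= ramify_minpol //.
  rewrite (rmorphM (@ramify K N')) /= ramify_linprod rmorphM /= => /eqP.
  rewrite mulf_eq0 (negPf (eval_unit _ _)) ?ramify_unit //= eval_linprod; last first.
    by rewrite mulnC in_t_mul // ps_ram_00.
  move=> /mapP[d dc Ed].
  have supp i : a (i%:R / (N * N')%:R) != 0 -> (N' %| i)%N.
    rewrite -in_tE Ed ps_ramE; case: ifP => //; by rewrite eqxx.
  have aN : in_root N a.
    split=> // q aq; have [i [Eq ni]] := in_t_neq0 (in_root_mul N0 aN') aq.
    rewrite mulnC in Eq; rewrite Eq in aq.
    have /dvdnP[j Ej] := supp i aq; exists j; rewrite Eq; apply/eqP.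
    by rewrite natr_fracE ?muln_gt0 ?N0 // Ej mulnAC mulnA.
  split=> //; suff -> : in_t N a = d by [].
  by apply: (ps_ram_inj N'0); rewrite -Ed in_t_mul.
have pos := orbit_positive zP c0.
exists [seq of_t N d | d <- orbit N z c]; last first.
  apply/mapP; exists (in_t N a) => //; apply: val_inj; apply/funext => q /=.
  have [aq|aq] := eqVneq (a q) 0; last first.
    by have [m [-> nm]] := in_t_neq0 aN aq; rewrite -[RHS]/(of_t N _ _) of_tE.
  rewrite aq; apply/esym/eqP; rewrite -[_ == _]negbK; apply/negP => nq.
  have [m [Em]] := in_t_neq0 (in_root_of_t (in_t N a) N0) nq.
  by rewrite of_tK // in_tE -Em aq eqxx.
exists N, u; split=> // [d /mapP[d' /pos d'0 ->]|].
  have dN := in_root_of_t d' N0; split=> //.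
  by apply/(puiseux_order_gt0 dN); rewrite of_tK.
rewrite rmorphM /= ramify_minpol // big_map; congr (_ * _).
by apply: eq_bigr => d _; rewrite of_tK.
Qed.

End Zeros.

(** * Existence of the characteristic *)

Section CharacExists.
Variables (K : nzRingType) (N : nat) (c : powser K).
Hypothesis N0 : (0 < N)%N.

(** [D] is the greatest common divisor of [N] and of the exponents of [c];
    [N %/ D] is the index of [c(x^(1/N))]. *)
Definition support_gcd D := [/\ (D %| N)%N, (forall m, c m != 0 -> (D %| m)%N) &
  forall D', (D' %| N)%N -> (forall m, c m != 0 -> (D' %| m)%N) -> (D' %| D)%N].

(** By maximality of a common divisor: the least common multiple of two common
    divisors is again one. *)
Lemma support_gcd_exists : exists D, support_gcd D.
Proof.
pose P D := (D %| N)%N && `[< forall m, c m != 0 -> (D %| m)%N >].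
have P1 : P 1%N by rewrite /P dvd1n; apply/asboolP.
have Pmax D : P D -> (D <= N)%N by case/andP => /(dvdn_leq N0).
have Pex : exists D, P D by exists 1%N.
have [D /andP[DN /asboolP Ds] Dmax] := ex_maxnP Pex Pmax.
exists D; split=> // D' D'N D's.
have PL : P (lcmn D D').
  rewrite /P dvdn_lcm DN D'N; apply/asboolP => m cm.
  by rewrite dvdn_lcm Ds ?D's.
have L0 : (0 < lcmn D D')%N.
  by rewrite lcmn_gt0 !(dvdn_gt0 N0).
have -> : D = lcmn D D'; last exact: dvdn_lcmr.
by apply/eqP; rewrite eqn_leq Dmax // andbT dvdn_leq // dvdn_lcml.
Qed.

(** [cs] satisfies the recursive definition of the characteristic of
    [c(x^(1/N))] as far as it goes. *)
Definition jumps_ok D (cs : seq nat) := forall k, (k.+1 < size cs)%N ->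
  [/\ egcd_upto cs k != 1%N, ~~ (egcd_upto cs k %| nth 0%N cs k.+1)%N,
      c (nth 0 cs k.+1 * D)%N != 0 &
      forall j, ~~ (egcd_upto cs k %| j)%N -> c (j * D)%N != 0 ->
        (nth 0%N cs k.+1 <= j)%N].

Lemma egcd_upto_cat cs cs' k : (k < size cs)%N ->
  egcd_upto (cs ++ cs') k = egcd_upto cs k.
Proof.
move=> lt; apply: eq_bigr => -[i /=]; rewrite ltnS => le _.
by rewrite nth_cat (leq_ltn_trans le lt).
Qed.

(** As long as the greatest common divisor of the entries is not [1], an exponent
    that it does not divide occurs, for otherwise [D] would not be the greatest
    common divisor; the next jump strictly decreases it. *)
Lemma charac_extend D cs : support_gcd D -> (0 < size cs)%N ->
    nth 0%N cs 0 = (N %/ D)%N -> jumps_ok D cs ->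
  exists cs', jumps_ok D (cs ++ cs') /\
              egcd_upto (cs ++ cs') (size (cs ++ cs')).-1 = 1%N.
Proof.
move=> [DN Ds Dmax]; have D0 := dvdn_gt0 N0 DN.
have n0 : (0 < N %/ D)%N by rewrite divn_gt0 // dvdn_leq.
have [E leE] := ubnP (egcd_upto cs (size cs).-1).
elim: E cs leE => // E IH cs leE s0 cs0 ok.
have b0 : (0 < nth 0 cs 0)%N by rewrite cs0.
set e := egcd_upto cs (size cs).-1 in leE.
have [e1|e1] := eqVneq e 1%N; first by exists [::]; rewrite cats0.
have e0 : (0 < e)%N by apply: egcd_upto_gt0.
have ex : exists j, ~~ (e %| j)%N && (c (j * D)%N != 0).
  apply: contrapT => /forallNP no; case/eqP: e1.
  apply/eqP; rewrite -dvdn1 -(dvdn_pmul2r D0) mul1n; apply: Dmax.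
    rewrite -(divnK DN) dvdn_pmul2r // -cs0 -(egcd_upto0 cs).
    exact: egcd_upto_dvd.
  move=> m cm; have /dvdnP[j Ej] := Ds m cm; rewrite Ej in cm *.
  rewrite dvdn_pmul2r //; apply: contrapT => /negP nj; apply: (no j).
  by rewrite nj.
case: (ex_minnP ex) => j /andP[nj cj] jmin.
have sE : size (cs ++ [:: j]) = (size cs).+1 by rewrite size_cat addn1.
have eE : egcd_upto (cs ++ [:: j]) (size cs) = gcdn e j.
  rewrite -{1}(prednK s0) egcd_uptoS egcd_upto_cat prednK //.
  by rewrite nth_cat ltnn subnn.
have [|||k|cs' [ok' E']] := IH (cs ++ [:: j]).
- rewrite sE [_.+1.-1]/= eE; apply: leq_trans (leE : e <= E)%N; rewrite ltn_neqAle dvdn_leq ?dvdn_gcdl //.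
  by rewrite andbT; apply: contra nj => /eqP <-; apply: dvdn_gcdr.
- by rewrite sE.
- by rewrite nth_cat s0.
- rewrite sE ltnS leq_eqVlt => /orP[/eqP Ek|lt]; last first.
    by rewrite egcd_upto_cat 1?ltnW // nth_cat lt; apply: ok.
  have Ek' : k = (size cs).-1 by rewrite -Ek.
  rewrite egcd_upto_cat Ek' ?prednK // -/e nth_cat ltnn subnn.
  by split=> // j' nj' cj'; apply: jmin; rewrite nj'.
by exists (j :: cs'); rewrite -cat_rcons -cats1.
Qed.

End CharacExists.

(** The characteristic depends on the support of a series only, hence conjugates
    share it. *)
Lemma puiseux_characI (K : comNzRingType) N (c : powser K) D cs (a : puiseux K) :
    (0 < N)%N -> support_gcd N c D -> (0 < size cs)%N ->
    nth 0%N cs 0 = (N %/ D)%N -> jumps_ok c D cs ->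
    egcd_upto cs (size cs).-1 = 1%N -> in_root N a ->
    (forall m, (in_t N a m == 0) = (c m == 0)) ->
  puiseux_charac a cs.
Proof.
move=> N0 [DN Ds Dmax] s0 E0 ok elast aN supp; have D0 := dvdn_gt0 N0 DN.
have n0 : (0 < N %/ D)%N by rewrite divn_gt0 // dvdn_leq.
have aE j : (a (j%:R / (N %/ D)%:R) == 0) = (c (j * D)%N == 0).
  rewrite -supp in_tE; congr (_ == _); congr (puiseux_coef a _); apply/eqP.
  by rewrite natr_fracE // mulnAC -mulnA divnK.
split=> //; rewrite E0.
- split=> [|m [m0 am]].
    split=> // q aq; have [m [Em]] := in_t_neq0 aN aq; rewrite supp => /Ds Dm.
    exists (m %/ D)%N; rewrite Em; apply/eqP; rewrite natr_fracE //.
    by rewrite -{1}(divnK Dm) -mulnA [(D * _)%N]mulnC divnK.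
  set g := gcdn N m; have g0 : (0 < g)%N by rewrite gcdn_gt0 N0.
  have gN : (g %| N)%N by apply: dvdn_gcdl.
  have DD : (N %/ g %| D)%N.
    apply: Dmax; first by rewrite -{2}(divnK gN) dvdn_mulr.
    move=> l; rewrite -supp => al; have [i /eqP] := am _ al.
    rewrite natr_fracE // => /eqP El.
    have gm : (g %| m)%N by apply: dvdn_gcdr.
    have : (N %/ g %| l * (m %/ g))%N.
      rewrite -(dvdn_pmul2r g0) -mulnA !divnK // El; exact: dvdn_mull.
    rewrite Gauss_dvdl // /coprime -(eqn_pmul2r g0) mul1n muln_gcdl !divnK //.
  apply: (@leq_trans g); last by apply: dvdn_leq => //; apply: dvdn_gcdr.
  rewrite -(leq_pmul2r D0) divnK // -{1}(divnK gN) mulnC leq_pmul2l //.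
  exact: dvdn_leq.
move=> k lt; have [e1 nd cn min] := ok k lt; split=> //.
  by split; rewrite // aE.
by move=> i [ni ai]; apply: min; rewrite // -aE.
Qed.

Section Prefix.
Variable K : numClosedFieldType.
Variables (b : seq nat) (M : nat) (z : K) (alpha : powser K).
Let b0 := nth 0%N b 0.
Let e := egcd_upto b.
Let Q i := (M * nth 0 b i)%N.
Hypothesis zP : (b0 * M).-primitive_root z.
Hypothesis supp : forall m, alpha m != 0 -> (M %| m)%N.
Hypothesis jump : forall i, (i.+1 < size b)%N ->
  [/\ ~~ (e i %| nth 0%N b i.+1)%N, alpha (Q i.+1) != 0 &
   forall m, alpha (M * m)%N != 0 -> ~~ (e i %| m)%N -> (nth 0%N b i.+1 <= m)%N].

Let b0_gt0 : (0 < b0)%N.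
Proof. by have := prim_order_gt0 zP; rewrite muln_gt0 => /andP[]. Qed.
Let M_gt0 : (0 < M)%N.
Proof. by have := prim_order_gt0 zP; rewrite muln_gt0 => /andP[]. Qed.

Variables (c : powser K) (s x : nat).
Hypothesis sb : (s < size b)%N.
Hypothesis close : agree (Q s) (galconj z x alpha) c || (s == 0)%N.
Hypothesis cQ : forall l, (0 < l <= s)%N -> c (Q l) != 0.
Variable D : nat.
Hypothesis DP : support_gcd (b0 * M) c D.

(** The characteristic of a series that agrees with [alpha] begins like that of
    [alpha], up to a common factor. *)
Definition charac_prefix := [seq (M * nth 0 b l %/ D)%N | l <- iota 0 s.+1].

Lemma size_charac_prefix : size charac_prefix = s.+1.
Proof. by rewrite size_map size_iota. Qed.

Lemma nth_charac_prefix l : (l <= s)%N ->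
  (nth 0 charac_prefix l * D = M * nth 0 b l)%N.
Proof.
move=> ls; rewrite (nth_map 0%N) ?size_iota // nth_iota // add0n divnK //.
have [DN Ds _] := DP; case: l ls => [|l] ls; first by rewrite mulnC.
by apply/Ds/cQ.
Qed.

Lemma egcd_charac_prefix l : (l <= s)%N ->
  (egcd_upto charac_prefix l * D = M * e l)%N.
Proof.
rewrite /e; elim: l => [|l IH] ls; first by rewrite !egcd_upto0 nth_charac_prefix.
by rewrite !egcd_uptoS muln_gcdl muln_gcdr (IH (ltnW ls)) nth_charac_prefix.
Qed.

Let D_gt0 : (0 < D)%N.
Proof. by case: DP => /(dvdn_gt0 (prim_order_gt0 zP)). Qed.

Lemma charac_prefix_ok : jumps_ok c D charac_prefix.
Proof.
move=> k; rewrite size_charac_prefix ltnS => ks.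
have kb : (k.+1 < size b)%N by apply: leq_ltn_trans sb.
have [nd _ _] := jump kb.
have nd' : ~~ (egcd_upto charac_prefix k %| nth 0%N charac_prefix k.+1)%N.
  rewrite -(dvdn_pmul2r D_gt0) nth_charac_prefix // egcd_charac_prefix ?(ltnW ks) //.
  by rewrite dvdn_pmul2l.
split=> //; first by apply: contraNneq nd' => ->.
  by rewrite nth_charac_prefix //; apply: cQ.
move=> j nj cj; rewrite -(leq_pmul2r D_gt0) nth_charac_prefix // leqNgt.
apply: contra nj => lt; have s0 : (s == 0)%N = false by case: s ks.
have ltQ : (j * D < Q s)%N.
  apply: leq_trans lt _; rewrite leq_pmul2l //.
  by apply: (jump_mono jump) => //; rewrite ks.
move: close; rewrite s0 orbF => /agreeP/(_ _ ltQ) Ej.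
have aj : alpha (j * D)%N != 0.
  by apply: contraNneq cj => a0; rewrite -Ej conjE a0 mulr0.
rewrite -(dvdn_pmul2r D_gt0) egcd_charac_prefix ?(ltnW ks) //.
by apply: (supp_lt zP supp jump (i := k.+1)).
Qed.

Lemma map_charac_prefix l : (l <= s)%N ->
  (nth 0 charac_prefix l)%:R / (nth 0 charac_prefix 0)%:R =
  (nth 0 b l)%:R / b0%:R :> rat.
Proof.
move=> ls; have n0 : (0 < nth 0 charac_prefix 0)%N.
  rewrite -(ltn_pmul2r D_gt0) nth_charac_prefix // muln_gt0 M_gt0.
  exact: b0_gt0.
apply/eqP; rewrite natr_fracE // -(eqn_pmul2r D_gt0) mulnAC nth_charac_prefix //.
by rewrite -[X in _ == X]mulnA nth_charac_prefix // [X in _ == X]mulnCA mulnA.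
Qed.

End Prefix.

(** * The factorization of a higher derivative *)

Lemma negmodzE (k n : nat) : (0 < n)%N ->
  ((- k%:Z) %% n%:Z)%Z = (negmod k n)%:Z.
Proof.
move=> n0; rewrite /negmod; case: (posnP (k %% n)%N) => [k0|k0].
  have -> : - k%:Z = (- (k %/ n)%N%:Z) * n%:Z + 0.
    have := divn_eq k n; lia.
  by rewrite modzMDl mod0z k0 subn0 modnn.
rewrite modn_small; last by lia.
have kn := ltn_pmod k n0.
have -> : - k%:Z = (- (k %/ n).+1%N%:Z) * n%:Z + (n - k %% n)%N%:Z.
  have := divn_eq k n; lia.
by rewrite modzMDl modz_small //; lia.
Qed.

Lemma ceil_negmod (k n l : nat) : (0 < n)%N -> (n * l = k + negmod k n)%N ->
  Num.ceil (k%:R / n%:R : rat) = l%:Z.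
Proof.
move=> n0 El; have rn : (negmod k n < n)%N by rewrite ltn_pmod.
apply: ceil_def; rewrite ltr_pdivlMr ?ler_pdivrMr ?ltr0n //.
rewrite intrB -!pmulrn mulrBl mul1r -!natrM ler_nat ltrBlDr -natrD ltr_nat.
by rewrite mulnC El ltn_add2l rn leq_addr.
Qed.

Section Factorization.
Variable K : numClosedFieldType.
Variables (b : seq nat) (M : nat) (z : K) (alpha : powser K).
Let b0 := nth 0%N b 0.
Let e := egcd_upto b.
Let Q i := (M * nth 0 b i)%N.
Let n i := (e i.-1 %/ e i)%N.
Let N := (b0 * M)%N.
Hypothesis zP : N.-primitive_root z.
Hypothesis sb : (0 < size b)%N.
Hypothesis supp : forall m, alpha m != 0 -> (M %| m)%N.
Hypothesis jump : forall i, (i.+1 < size b)%N ->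
  [/\ ~~ (e i %| nth 0%N b i.+1)%N, alpha (Q i.+1) != 0 &
   forall m, alpha (M * m)%N != 0 -> ~~ (e i %| m)%N -> (nth 0%N b i.+1 <= m)%N].
Hypothesis elast : e (size b).-1 = 1%N.
Hypothesis alpha0 : alpha 0%N = 0.
Implicit Types (c d : powser K) (g : powser2 K).

Let N_gt0 : (0 < N)%N := prim_order_gt0 zP.
Let b0_gt0 : (0 < b0)%N.
Proof. by have := N_gt0; rewrite muln_gt0 => /andP[]. Qed.
Let M_gt0 : (0 < M)%N.
Proof. by have := N_gt0; rewrite muln_gt0 => /andP[]. Qed.

Local Notation conj := (galconj z).
Local Notation orb := (orbit N z alpha).
Local Notation contact := (contact_at b M z alpha).

Lemma agree_galconj q x c d : agree q (conj x c) (conj x d) = agree q c d.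
Proof.
apply/agreeP/agreeP => h i /h; rewrite !conjE; last by move=> ->.
by apply: mulfI; rewrite expf_neq0 // (prim_root_neq0 zP).
Qed.

Lemma has_agree_orbit q c d : d \in orbit N z c ->
  has (fun a => agree q a d) orb = has (fun a => agree q a c) orb.
Proof.
move=> /(orbitP zP)[x ->]; have [y Ey] := conj_inv zP x c.
apply/hasP/hasP => -[a aorb ag].
  exists (conj y a); first by rewrite conj_orbit.
  by rewrite -Ey agree_galconj.
by exists (conj x a); rewrite ?conj_orbit // agree_galconj.
Qed.

Lemma contact_orbit i c d : d \in orbit N z c -> contact i d = contact i c.
Proof. by move=> dc; rewrite /contact_at !(has_agree_orbit _ dc). Qed.

Lemma conj_eq0 x c m : (conj x c m == 0) = (c m == 0).
Proof.
by rewrite conjE mulf_eq0 expf_eq0 (negPf (prim_root_neq0 zP)) andbF.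
Qed.

Lemma orbit_eq0 c d m : d \in orbit N z c -> (d m == 0) = (c m == 0).
Proof. by move=> /(orbitP zP)[x ->]; apply: conj_eq0. Qed.

Lemma contact_uniq i j c : (0 < i < size b)%N -> (0 < j < size b)%N ->
  contact i c -> contact j c -> i = j.
Proof.
suff lt i' j' : (0 < i' < size b)%N -> (0 < j' < size b)%N ->
    contact i' c -> contact j' c -> ~~ (i' < j')%N.
  move=> ib jb ci cj; apply/eqP.
  by rewrite eqn_leq leqNgt (lt j i jb ib cj ci) leqNgt (lt i j ib jb ci cj).
move=> /andP[i0 _] /andP[_ jb] /andP[_ /hasPn no] /andP[/hasP[d dorb ag] _].
apply/negP => ij; have := no _ dorb; rewrite (agreeW _ ag) //.
by rewrite ltn_pmul2l // (jump_smono jump) // ij.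
Qed.

Section Branch.
Variables (i : nat) (c : powser K).
Hypothesis ib : (0 < i < size b)%N.
Hypothesis ci : contact i c.
Hypothesis c0 : c 0%N = 0.

Let i0 : (0 < i)%N. Proof. by case/andP: ib. Qed.
Let il : (i < size b)%N. Proof. by case/andP: ib. Qed.

Lemma contact_close : exists x, agree (Q i) (conj x alpha) c.
Proof. by case/andP: ci => /hasP[_ /(orbitP zP)[x ->] ag] _; exists x. Qed.

Lemma contact_jump_neq0 l : (0 < l < i)%N -> c (Q l) != 0.
Proof.
move=> /andP[l0 li]; have [x /agreeP h] := contact_close.
have Ql : (Q l < Q i)%N by rewrite ltn_pmul2l // (jump_smono jump) // li.
rewrite -h // conj_eq0; apply: (alpha_jump jump); rewrite l0.
exact: ltn_trans il.
Qed.

(** The Galois group preserves the orders of differences, so contacts can be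
    computed with a single root of one of the two branches. *)
Lemma contact_is_contact u w : u \is a GRing.unit -> w \is a GRing.unit ->
  is_contact (u * minpol N z alpha) (w * minpol N z c)
             ((nth 0%N b i)%:R / b0%:R)%:E.
Proof.
move=> uu wu; have EQ : (nth 0%N b i)%:R / b0%:R = (Q i)%:R / N%:R :> rat.
  by apply/eqP; rewrite natr_fracE // /Q /N mulnA [(M * _)%N]mulnC mulnAC.
rewrite EQ; split.
  have /andP[/hasP[d dorb ag] /hasPn no] := ci.
  exists (of_t N d), (of_t N c); have nd := no d dorb.
  have hd := in_root_of_t d N_gt0; have hc := in_root_of_t c N_gt0.
  split.
  - apply/(Zer_minpol zP _ uu alpha0); split; first exact: hd.
    by rewrite (of_tK _ N_gt0); exact: dorb.
  - apply/(Zer_minpol zP _ wu c0); split; first exact: hc.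
    by rewrite (of_tK _ N_gt0); apply: mem_orbit.
  - by apply: (coincidenceE hd hc); rewrite !(of_tK _ N_gt0).
move=> a1 a2 /(Zer_minpol zP _ uu alpha0)[h1r h1o].
move=> /(Zer_minpol zP _ wu c0)[h2r h2o]; apply: (coincidence_le h1r h2r).
have : contact i (in_t N a2) by rewrite (contact_orbit _ h2o); exact: ci.
by case/andP => _ /hasPn/(_ _ h1o).
Qed.

Let ZerP w a : w \is a GRing.unit -> Zer (w * minpol N z c) a ->
  in_root N a /\ forall m, (in_t N a m == 0) = (c m == 0).
Proof.
move=> wu /(Zer_minpol zP _ wu c0)[aN ao]; split=> // m.
exact: orbit_eq0.
Qed.

Let Zer_neq0 w : w \is a GRing.unit -> Zer (w * minpol N z c) !=set0.
Proof.
move=> wu; exists (of_t N c); apply/(Zer_minpol zP _ wu c0).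
by split; [apply: in_root_of_t | rewrite (of_tK _ N_gt0); apply: mem_orbit].
Qed.

Lemma take_char_exponents s D cs' : (s < size b)%N ->
    support_gcd N c D -> (forall l, (0 < l <= s)%N -> c (Q l) != 0) ->
  take s (char_exponents (charac_prefix b M s D ++ cs')) =
  take s (char_exponents b).
Proof.
move=> sl DP cQ; rewrite /char_exponents /=.
have s1 : size [seq (M * nth 0 b l %/ D)%N | l <- iota 1 s] = s.
  by rewrite size_map size_iota.
have s2 : size (behead b) = (size b).-1 by rewrite size_behead.
apply: (@eq_from_nth _ 0).
  rewrite !size_take !size_map size_cat s1 s2.
  by case: ltnP => h1; case: ltnP => h2; lia.
move=> j; rewrite size_take size_map size_cat s1 => lt.
have js : (j < s)%N by apply: leq_trans lt _; case: ifP => //; lia.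
rewrite !nth_take // !(nth_map 0%N) ?size_cat ?s1 ?s2; [|lia|lia].
rewrite nth_cat s1 js nth_behead.
have := map_charac_prefix zP cQ DP js.
by rewrite /charac_prefix /= (nth_map 0%N) ?size_iota.
Qed.

(** The first [i - 1] jumps of [c] are those of [alpha], and the characteristic is
    completed by later jumps, which are exponents of [c]; the exponent
    [b_i / b0] does not occur in [c]. *)
Lemma charac_contact_zero w : w \is a GRing.unit -> c (Q i) = 0 ->
  exists2 cs, charac (w * minpol N z c) cs &
    take i.-1 (char_exponents cs) = take i.-1 (char_exponents b) /\
    (nth 0%N b i)%:R / b0%:R \notin char_exponents cs.
Proof.
move=> wu cQ0; have [D DP] := support_gcd_exists c N_gt0.
have [x ag] := contact_close; pose s := i.-1.
have sl : (s < size b)%N by apply: leq_ltn_trans il; apply: leq_pred.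
have cQ l : (0 < l <= s)%N -> c (Q l) != 0.
  by move=> ls; apply: contact_jump_neq0; move: ls i0; rewrite /s; lia.
have close : agree (Q s) (conj x alpha) c || (s == 0)%N.
  case: (posnP s) => [->|s0]; first by rewrite orbT.
  rewrite (agreeW _ ag) // leq_pmul2l // (jump_mono jump) // leq_pred.
  exact: il.
have ok := charac_prefix_ok zP supp jump sl close cQ DP.
have [||cs' [ok' last']] := charac_extend N_gt0 DP _ _ ok.
- by rewrite size_map size_iota.
- by rewrite /= mulnC.
set cs := _ ++ cs' in ok' last'.
have cs0 : nth 0%N cs 0 = (N %/ D)%N by rewrite /cs /= mulnC.
have [DN _ _] := DP; have D0 := dvdn_gt0 N_gt0 DN.
have n0 : (0 < N %/ D)%N by rewrite divn_gt0 // dvdn_leq.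
exists cs; first (split; first exact: Zer_neq0).
  move=> a /(ZerP wu)[aN az].
  exact: (puiseux_characI N_gt0 DP _ cs0 ok' last' aN az).
split; first exact: take_char_exponents.
apply/mapP => -[j /(nthP 0%N)[l ls <-] /eqP].
rewrite nth_behead cs0 natr_fracE // => /eqP El.
have ls' : (l.+1 < size cs)%N by rewrite -ltn_predRL -size_behead.
have [_ _ /eqP nz _] := ok' l ls'; case: nz; rewrite -[RHS]cQ0.
congr (pcoef c _); apply/eqP; rewrite -(eqn_pmul2r b0_gt0) /Q mulnAC -El.
by rewrite -mulnA divnK // /N mulnA [(M * _)%N]mulnC mulnAC.
Qed.

Section Fixed.
Hypothesis cQ0 : c (Q i) != 0.
Hypothesis fixc : conj (b0 %/ e i) c = c.

Let cQ l : (0 < l <= i)%N -> c (Q l) != 0.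
Proof.
move=> /andP[l0]; rewrite leq_eqVlt => /orP[/eqP->//|li].
by apply: contact_jump_neq0; rewrite l0.
Qed.

(** The stabilizer of [c] contains the subgroup of index [b0 / e_i], and is not
    larger since the first [i] characteristic exponents occur in [c]. *)
Lemma size_orbit_contact : size (orbit N z c) = (b0 %/ e i)%N.
Proof.
apply: (size_orbit_period zP); first by rewrite egcd_index_gt0.
have per q : conj (q * (b0 %/ e i)) c = c.
  by elim: q => [|q IH]; rewrite ?conj0 // mulSn -conj_conj IH fixc.
move=> x y; apply/eqP/eqP => [E|exy].
  by apply: (eqmod_jumps zP cQ) => l _; rewrite E.
rewrite (divn_eq x (b0 %/ e i)) (divn_eq y (b0 %/ e i)) exy.
by rewrite ![(_ * _ + _)%N]addnC -!conj_conj !per.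
Qed.

(** The series [c] lies in [K[[x^(e_i/b0)]]], so the first [i] jumps, which it
    shares with [alpha], exhaust its characteristic. *)
Lemma charac_contact_nonzero w : w \is a GRing.unit ->
  exists2 cs, charac (w * minpol N z c) cs &
    char_exponents cs =i take i (char_exponents b).
Proof.
move=> wu; have [D DP] := support_gcd_exists c N_gt0.
have [x ag] := contact_close.
have close : agree (Q i) (conj x alpha) c || (i == 0)%N by rewrite ag.
have ok := charac_prefix_ok zP supp jump il close cQ DP.
have Ee := egcd_charac_prefix cQ DP (leqnn i).
have [DN _ Dmax] := DP; have D0 := dvdn_gt0 N_gt0 DN.
have eb : (e i %| b0)%N by apply: egcd_upto_dvd0.
have Me : (M * e i %| D)%N.
  apply: Dmax; first by rewrite /N mulnC dvdn_pmul2r.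
  move=> m cm; have := congr1 (fun p : powser K => p m) fixc.
  rewrite conjE -{2}[c m]mul1r => /(mulIf cm)/eqP.
  rewrite -(prim_order_dvd zP) /N -{1}(divnK eb) -mulnA [(e i * M)%N]mulnC.
  by rewrite dvdn_pmul2l // egcd_index_gt0.
have e1 : egcd_upto (charac_prefix b M i D) i = 1%N.
  apply/eqP; rewrite -(eqn_pmul2r D0) mul1n Ee eqn_dvd Me /=.
  by rewrite -Ee dvdn_mull.
set cs := charac_prefix b M i D in ok e1.
have scs : size cs = i.+1 by rewrite size_map size_iota.
have cs0 : nth 0%N cs 0 = (N %/ D)%N by rewrite /cs /= mulnC.
exists cs; first (split; first exact: Zer_neq0).
  move=> a /(ZerP wu)[aN az].
  by apply: (puiseux_characI N_gt0 DP _ cs0 ok _ aN az); rewrite scs.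
move=> q; have := take_char_exponents [::] il DP cQ; rewrite cats0 -/cs => <-.
by rewrite take_oversize // size_map size_behead scs.
Qed.

End Fixed.
End Branch.
End Factorization.

Section Product.
Variables (K : numClosedFieldType) (N : nat) (z : K).
Hypothesis zP : N.-primitive_root z.
Implicit Types (c d : powser K) (C : seq (powser K)).

Lemma ordY_prod_minpol u C (P : pred (powser K)) : u \is a GRing.unit ->
    positive C ->
  ordY_is (u * \prod_(c <- C | P c) minpol N z c)
    (\sum_(c <- C | P c) size (orbit N z c)).
Proof.
move=> uu C0; rewrite -[(\sum_(c <- C | _) _)%N]add0n.
apply: ordY_isM; first exact/ordY_is_unit.
elim: C C0 => [|c C IH] C0.
  by rewrite !big_nil; apply/ordY_is_unit/unitr1.
have {}IH : ordY_is (\prod_(c <- C | P c) minpol N z c)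
    (\sum_(c <- C | P c) size (orbit N z c)).
  by apply: IH => d dC; apply: C0; rewrite inE dC orbT.
rewrite !big_cons; case: ifP => // _.
by apply: ordY_isM IH; apply: (ordY_minpol zP); apply: C0; rewrite mem_head.
Qed.

Lemma count_orbits C (P : pred (powser K)) :
    (forall c d, d \in orbit N z c -> P d = P c) ->
  count P (flatten [seq orbit N z c | c <- C]) =
  (\sum_(c <- C | P c) size (orbit N z c))%N.
Proof.
move=> PO; elim: C => [|c C IH]; first by rewrite big_nil.
rewrite /= count_cat big_cons -IH; case: ifPn => Pc.
  by rewrite (eq_in_count (a2 := predT)) ?count_predT // => d /PO ->.
rewrite (eq_in_count (a2 := pred0)) ?count_pred0 // => d /PO -> /=.
exact: negbTE.
Qed.

End Product.

Lemma ordY_iter_derivY (K : numClosedFieldType) (f : powser2 K) m k :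
  (k <= m)%N -> ordY_is f m -> ordY_is (iter k derivY f) (m - k).
Proof.
move=> km [fm fm0].
have E j : at_x0 (iter k derivY f) j = at_x0 f (j + k)%N *+ (j + k) ^_ k.
  by rewrite -[LHS]/(iter k derivY f j 0%N) derivYn_coef psMn.
split=> [j lt|]; rewrite E.
  by rewrite fm ?mul0rn //; lia.
by rewrite subnK // mulrn_eq0 negb_or fm0 -lt0n ffact_gt0 km.
Qed.

Lemma NP_factorization_ordY (K : numClosedFieldType) (g : powser2 K) s :
  NP_factorization g s -> ordY_is g (size s).
Proof.
move=> [N [u [N0 uu sP E]]]; apply/(ordY_is_ramify N); rewrite E.
have -> : \prod_(c <- s) (ps_var (powser K) - ps_const (in_t N c)) =
    linprod [seq in_t N c | c <- s] by rewrite /linprod big_map.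
rewrite -[size s]add0n -(size_map (in_t N) s); apply: ordY_isM.
  by apply/ordY_is_unit; rewrite ramify_unit.
apply: ordY_linprod => _ /mapP[c /sP[cN c0] ->].
exact: (puiseux_order_gt0 cN).1.
Qed.

(** The factors are products of minimal polynomials of the roots [c] of the
    derivative: [G i] collects those of contact [b_i / b0] with [f], and its two
    parts those whose coefficient at that exponent vanishes, respectively does
    not. The shape of the derivatives of powers of binomials is a hypothesis, so
    that the field of coefficients remains abstract. *)
Lemma higher_polar_factorization (K : numClosedFieldType)
  (splitK : binomial_derivs_split K) (f : powser2 K) (b : seq nat)
  (k ik : nat)
  (b0 := nth 0%N b 0)
  (e := egcd_upto b)
  (n := fun i : nat => (e i.-1 %/ e i)%N)
  (hf_irr : irreducible_elt f)
  (hb : charac f b)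
  (hk_ord : (k%:R%:E < ordY f)%E)
  (hik : (0 < ik < size b)%N) (hik_e : (e ik <= k < e ik.-1)%N) :
  exists G : nat -> powser2 K,
    iter k derivY f = \prod_(1 <= i < ik.+1) G i /\
    forall i : nat, (1 <= i <= ik)%N ->
      let q : rat := (nth 0%N b i)%:R / b0%:R in
      let N : int := (minn (e i) k)%:Z - Num.ceil (k%:R / (n i)%:R : rat) in
      [/\ forall g : powser2 K, irreducible_factor g (G i) -> is_contact f g q%:E,
          ordY (G i) =
            (if (i < ik)%N
             then (b0%:R / (e i)%:R - b0%:R / (e i.-1)%:R) * k%:R
             else b0%:R - b0%:R / (e i.-1)%:R * k%:R)%:E &
          exists G1 G2 : powser2 K,
            [/\ G i = G1 * G2,
                (forall g : powser2 K, irreducible_factor g G1 ->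
                  exists2 c, charac g c &
                    take i.-1 (char_exponents c) = take i.-1 (char_exponents b)
                    /\ q \notin char_exponents c) /\
                (forall g : powser2 K, irreducible_factor g G2 ->
                  exists2 c, charac g c &
                    char_exponents c =i take i (char_exponents b)),
                ordY G1 =
                  (b0%:R / (e i.-1)%:R * ((- k%:Z) %% (n i)%:Z)%Z%:~R)%:E,
                ordY G2 = (b0%:R / (e i)%:R * N%:~R)%:E &
                exists2 s : seq (powser2 K),
                  factorization G2 s & (size s)%:Z = N]].
Proof.
have [[a0 Za0] cha] := hb.
have [aidx sb bjump elast] := cha _ Za0; rewrite -/b0 in aidx bjump.
have [ab0 _] := aidx; have [b0_gt0 ab0P] := ab0.
have [N' [aN' a00 root_a]] := Zer_root Za0; have [N'0 _] := aN'.
have [s Zs _] := Za0; have f_ord := NP_factorization_ordY Zs.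
have e_gt0 i : (0 < e i)%N by apply: egcd_upto_gt0.
have km : (k < size s)%N.
  by move: hk_ord; rewrite (ordY_isE f_ord) lte_fin ltr_nat.
have [Ng Ng0 g_splits] := splits_exists (ordY_iter_derivY (ltnW km) f_ord).
(* a level at which f and its derivative split *)
pose M := (N' * Ng)%N; pose N := (b0 * M)%N.
have M0 : (0 < M)%N by rewrite muln_gt0 N'0.
have N0 : (0 < N)%N by rewrite muln_gt0 b0_gt0.
have [z zP] : exists z : K, N.-primitive_root z by apply: prim_root_exists.
pose alpha := in_t N a0; pose Q i := (M * nth 0 b i)%N.
have alphaE i : alpha (M * i)%N = a0 (i%:R / b0%:R).
  rewrite /alpha in_tE; congr (puiseux_coef a0 _); apply/eqP.
  by rewrite natr_fracE // /N mulnAC mulnC [(M * b0)%N]mulnC.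
have supp m : alpha m != 0 -> (M %| m)%N.
  rewrite /alpha in_tE => /ab0P[i /eqP]; rewrite natr_fracE // /N mulnCA mulnC.
  by rewrite eqn_pmul2l // => /eqP ->; apply: dvdn_mull.
have jump i : (i.+1 < size b)%N ->
  [/\ ~~ (e i %| nth 0%N b i.+1)%N, alpha (Q i.+1) != 0 &
   forall m, alpha (M * m)%N != 0 -> ~~ (e i %| m)%N -> (nth 0%N b i.+1 <= m)%N].
  move=> /bjump[_ [nd aj] min]; split; rewrite ?alphaE // => m am nm.
  by apply: min; split; rewrite // -alphaE.
have alpha0 : alpha 0%N = 0.
  rewrite -[0%N](muln0 M) alphaE -[RHS]a00 in_tE.
  by rewrite !mul0r.
have root_alpha : ps_eval alpha (ramify N f) = 0.
  have -> : N = (N' * (b0 * Ng))%N by rewrite /N /M mulnCA.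
  have := Zer_root_mul (M := (b0 * Ng)%N) _ aN' a00 root_a.
  rewrite /alpha; have -> : N = (N' * (b0 * Ng))%N by rewrite /N /M mulnCA.
  by apply; rewrite muln_gt0 b0_gt0.
have [u uu Ef] := irreducible_root zP hf_irr alpha0 root_alpha.
have spl : splits N (iter k derivY f).
  have -> : N = (Ng * (b0 * N'))%N by rewrite /N /M; lia.
  by apply: splits_ramify; rewrite // muln_gt0 b0_gt0.
have [v [C [vu C0 EC]]] := minpol_factorization zP spl.
pose orb := orbit N z alpha.
pose sg := flatten [seq orbit N z c | c <- C].
have Uu : ramify N u \is a GRing.unit by rewrite ramify_unit.
have Vu : ramify N v \is a GRing.unit by rewrite ramify_unit.
have polar : iter k derivY (ramify N u * linprod orb) = ramify N v * linprod sg.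
  have E1 : ramify N f = ramify N u * linprod orb.
    rewrite Ef (rmorphM (@ramify _ N)); congr (_ * _); exact: ramify_minpol.
  have E2 : ramify N (iter k derivY f) = ramify N v * linprod sg.
    by rewrite EC; apply: ramify_prod_minpol.
  by rewrite -E1 -E2 derivYn_ramify.
have sg0 : positive sg by apply: positive_orbits.
have csg c x : c \in C -> galconj z x c \in sg.
  move=> cC; apply/flattenP; exists (orbit N z c); first exact: map_f.
  by apply/(orbitP zP); exists x.
have csg0 c : c \in C -> c \in sg by move=> /(csg _ 0%N); rewrite conj0.
pose ct := contact_at b M z alpha.
have /andP[ik0 ikb] := hik; have /andP[kl ku] := hik_e.
have in_b i : (0 < i <= ik)%N -> (0 < i < size b)%N.
  by move=> /andP[-> i_ik]; apply: leq_ltn_trans i_ik ikb.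
have k_lt i j : (i <= j)%N -> (k < e j)%N -> (k < e i)%N.
  move=> ij kj; apply: (leq_trans kj); apply: dvdn_leq => //.
  exact: egcd_upto_dvd.
have ke i : (0 < i <= ik)%N -> (k < e i.-1)%N.
  by move=> i_ik; apply: k_lt ku; lia.
have ct_ex c : c \in C -> exists2 i, (0 < i <= ik)%N & ct i c.
  by move=> /csg0; apply: (contact_exists zP sb supp jump elast splitK alpha0 Uu Vu polar).
(* the unit goes into the last factor *)
pose w i := if i == ik then v else 1.
have wu i : w i \is a GRing.unit by rewrite /w; case: eqP => _; rewrite ?unitr1.
pose G i := w i * \prod_(c <- C | ct i c) minpol N z c.
exists G; split.
  rewrite EC big_split /=; congr (_ * _).
    rewrite (bigD1_seq ik) ?iota_uniq ?mem_index_iota ?ik0 ?ltnSn //=.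
    by rewrite /w eqxx big1 ?mulr1 // => i /negPf ->.
  under [RHS]eq_bigr do rewrite big_mkcond.
  rewrite exchange_big /=; apply: eq_big_seq => c cC.
  have [i i_ik ci] := ct_ex c cC.
  rewrite (bigD1_seq i) ?iota_uniq ?mem_index_iota ?ltnS //= ci.
  rewrite big_nat_cond big1 ?mulr1 // => j /andP[j_ik nji]; case: ifP => // cj.
  case/eqP: nji; apply: (contact_uniq zP jump (c := c)) => //; exact: in_b.
move=> i i_ik q Ni; have ib := in_b i i_ik; have ki := ke i i_ik.
have [i0 il] := andP ib.
have n0 : (0 < n i)%N by apply: egcd_ratio_gt0.
(* [l] is the ceiling of [k / n_i] *)
have [l [_ [_ [El _ _ _ _]]]] :=
  polar_ball zP sb supp jump elast splitK alpha0 Uu Vu polar 0 ib ki.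
rewrite -/(n i) in El.
have [lm cnt1] := count_contact_nonzero zP sb supp jump elast splitK alpha0 Uu Vu polar ib ki El.
have cnt0 := count_contact_zero zP sb supp jump elast splitK alpha0 Uu Vu polar ib ki.
set m := minn (e i) k in lm cnt1; set d := (b0 %/ e i.-1)%N.
rewrite -/b0 -/e -/(n i) -/d -/m in cnt0 cnt1.
pose P0 c := ct i c && (c (Q i) == 0); pose P1 c := ct i c && (c (Q i) != 0).
have inv0 c c' : c' \in orbit N z c -> P0 c' = P0 c.
  by move=> h; rewrite /P0 /ct (contact_orbit alpha zP i h) (orbit_eq0 zP _ h).
have inv1 c c' : c' \in orbit N z c -> P1 c' = P1 c.
  by move=> h; rewrite /P1 /ct (contact_orbit alpha zP i h) (orbit_eq0 zP _ h).
have s0 : (\sum_(c <- C | P0 c) size (orbit N z c) = d * negmod k (n i))%N.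
  by rewrite -(@count_orbits _ _ _ C P0 inv0).
have s1 : (\sum_(c <- C | P1 c) size (orbit N z c) = d * (n i * (m - l)))%N.
  by rewrite -(@count_orbits _ _ _ C P1 inv1).
pose G1 := w i * \prod_(c <- C | P0 c) minpol N z c.
pose G2 := \prod_(c <- C | P1 c) minpol N z c.
have EG : G i = G1 * G2.
  by rewrite /G (bigID (fun c : powser K => c (Q i) == 0)) /= mulrA.
have o1 : ordY_is G1 (d * negmod k (n i)).
  by rewrite -s0; apply: ordY_prod_minpol.
have o2 : ordY_is G2 (d * (n i * (m - l))).
  by rewrite -s1 -[G2]mul1r; apply: ordY_prod_minpol => //; apply: unitr1.
have fixed c : c \in C -> P1 c -> galconj z (b0 %/ e i) c = c.
  move=> cC /andP[ci nz].
  apply: (contact_nonzero_fixed zP sb supp jump elast splitK alpha0 Uu Vu polar ib ki) => //.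
  - by move=> x; apply: csg.
  - exact: csg0.
have dn : (d * n i = b0 %/ e i)%N by rewrite /d /n -egcd_index_ratio.
have ceilE : Num.ceil (k%:R / (n i)%:R : rat) = l%:Z by apply: ceil_negmod El.
have NiE : Ni = (m - l)%N by rewrite /Ni ceilE -/m subzn.
have e0r j : (e j)%:R != 0 :> rat by apply: natr_neq0.
have dR : d%:R = b0%:R / (e i.-1)%:R :> rat.
  by rewrite /d natf_div // egcd_upto_dvd0.
have dnR : (b0 %/ e i)%:R = b0%:R / (e i)%:R :> rat.
  by rewrite natf_div // egcd_upto_dvd0.
have factor_of (u' : powser2 K) (P : pred (powser K)) g :
    u' \is a GRing.unit ->
    irreducible_factor g (u' * \prod_(c <- C | P c) minpol N z c) ->
  exists c, [/\ c \in C, P c, c 0%N = 0 &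
    exists2 u1, u1 \is a GRing.unit & g = u1 * minpol N z c].
  move=> u'u; rewrite -big_filter => /(irreducible_factor_minpol zP u'u).
  case=> [c|c [cC hc]]; first by rewrite mem_filter => /andP[_ /C0].
  move: cC; rewrite mem_filter => /andP[Pc cC]; exists c; split=> //.
  exact: C0.
split.
- move=> g /factor_of[//|c [cC ci c0 [u1 u1u ->]]].
  by rewrite Ef; apply: (contact_is_contact zP alpha0 ci c0 uu u1u).
- rewrite EG (ordY_isE (ordY_isM o1 o2)); congr (_%:E).
  have -> : (d * negmod k (n i) + d * (n i * (m - l)) = d * (n i * m - k))%N.
    rewrite -mulnDr mulnBr El; congr (d * _)%N.
    have : (n i * l <= n i * m)%N by rewrite leq_mul2l lm orbT.
    by rewrite El; lia.
  have km' : (k <= n i * m)%N.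
    by apply: leq_trans (leq_addr (negmod k (n i)) k) _; rewrite -El leq_mul2l lm orbT.
  rewrite mulnBr natrB; last by rewrite leq_mul2l km' orbT.
  rewrite mulnA dn !natrM dR dnR; case: ifPn => [lt|].
    have -> : m = k by apply/minn_idPr; apply: ltnW; apply: k_lt ku; lia.
    by rewrite mulrBl.
  rewrite -leqNgt => le; have Ei : i = ik by lia.
  have -> : m = e i by apply/minn_idPl; rewrite Ei.
  by rewrite divfK.
exists G1, G2; split=> //.
- split=> g.
    move=> /factor_of[//|c [cC /andP[ci /eqP nz] c0 [u1 u1u ->]]].
    exact: (charac_contact_zero zP sb supp jump elast ib ci c0 u1u nz).
  rewrite -[G2]mul1r => /factor_of[|c [cC P1c c0 [u1 u1u ->]]]; first exact: unitr1.
  have /andP[ci nz] := P1c.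
  exact: (charac_contact_nonzero zP sb supp jump elast ib ci c0 nz (fixed c cC P1c) u1u).
- by rewrite (ordY_isE o1) natrM dR negmodzE // -pmulrn.
- by rewrite (ordY_isE o2) mulnA dn natrM dnR NiE -pmulrn.
exists [seq minpol N z c | c <- C & P1 c].
  split; last by exists 1; rewrite ?unitr1 // mul1r big_map big_filter.
  move=> g /mapP[c]; rewrite mem_filter => /andP[_ cC] ->.
  by apply: (minpol_irreducible zP); apply: C0.
(* the branches of [G2] all have the same order [b0 / e_i] *)
rewrite NiE; congr Posz; rewrite size_map size_filter.
apply/eqP; rewrite -(eqn_pmul2l (_ : 0 < b0 %/ e i)%N); last first.
  by apply: egcd_index_gt0.
have E2 : (b0 %/ e i * (m - l) = \sum_(c <- C | P1 c) size (orbit N z c))%N.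
  by rewrite s1 mulnA dn.
rewrite E2 -sum1_count big_distrr /=.
apply/eqP; rewrite big_seq_cond [RHS]big_seq_cond; apply: eq_bigr => c.
move=> /andP[cC P1c]; have /andP[ci nz] := P1c; rewrite muln1.
by rewrite (size_orbit_contact zP jump ib ci nz (fixed c cC P1c)).
Qed.

Theorem theorem6p2 (R : realType) (f : powser2 R[i]) (b : seq nat)
  (k ik : nat)
  (b0 := nth 0%N b 0)
  (e := egcd_upto b)
  (n := fun i : nat => (e i.-1 %/ e i)%N)
  (hf_irr : irreducible_elt f)
  (hf_ord : (1 < ordY f < +oo)%E)
  (hb : charac f b)
  (hk : (0 < k)%N) (hk_ord : (k%:R%:E < ordY f)%E)
  (hik : (0 < ik < size b)%N) (hik_e : (e ik <= k < e ik.-1)%N) :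
  exists G : nat -> powser2 R[i],
    iter k derivY f = \prod_(1 <= i < ik.+1) G i /\
    forall i : nat, (1 <= i <= ik)%N ->
      let q : rat := (nth 0%N b i)%:R / b0%:R in
      let N : int := (minn (e i) k)%:Z - Num.ceil (k%:R / (n i)%:R : rat) in
      [/\ forall g : powser2 R[i], irreducible_factor g (G i) -> is_contact f g q%:E,
          ordY (G i) =
            (if (i < ik)%N
             then (b0%:R / (e i)%:R - b0%:R / (e i.-1)%:R) * k%:R
             else b0%:R - b0%:R / (e i.-1)%:R * k%:R)%:E &
          exists G1 G2 : powser2 R[i],
            [/\ G i = G1 * G2,
                (forall g : powser2 R[i], irreducible_factor g G1 ->
                  exists2 c, charac g c &
                    take i.-1 (char_exponents c) = take i.-1 (char_exponents b)
                    /\ q \notin char_exponents c) /\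
                (forall g : powser2 R[i], irreducible_factor g G2 ->
                  exists2 c, charac g c &
                    char_exponents c =i take i (char_exponents b)),
                ordY G1 =
                  (b0%:R / (e i.-1)%:R * ((- k%:Z) %% (n i)%:Z)%Z%:~R)%:E,
                ordY G2 = (b0%:R / (e i)%:R * N%:~R)%:E &
                exists2 s : seq (powser2 R[i]),
                  factorization G2 s & (size s)%:Z = N]].
Proof.
exact: (higher_polar_factorization (@complex_binomial_derivs_split R)
  hf_irr hb hk_ord hik hik_e).
Qed.
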